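(* The maps $$L:\mathfrak{dmr}_0\cap\mathrm{Skew}\to\mathfrak{rc}_0,\qquad \psi\mapsto\psi,$$ and $$\mathfrak{dmr}_0\cap\mathrm{Skew}\cap\mathrm{Vep}\xrightarrow{\ L\ }\mathfrak{rc}_0\cap\mathrm{Vep}\xrightarrow{\ L_1\ }\mathfrak{krv}_2,\qquad \psi(x_0,x_1)\mapsto\psi(x_0,x_1)\mapsto\bigl(-\psi(-x_0-x_1,x_0),\,-\psi(-x_0-x_1,x_1)\bigr),$$ are (well-defined) injective Lie algebra maps, where $\mathfrak{dmr}_0\cap\mathrm{Skew}$, $\mathfrak{rc}_0$ and their intersections with $\mathrm{Vep}$ carry the Ihara bracket and $\mathfrak{krv}_2$ carries the bracket of tangential derivations.
   Context: Let $k$ be a field of characteristic zero, $A=k\langle\langle x_0,x_1\rangle\rangle$ the algebra of noncommutative formal power series with counit $\varepsilon$ (constant term), $c_w(\varphi)$ the coefficient of the word $w$ in $\varphi\in A$, and $\mathfrak{fr}_k(x_0,x_1)\subset A$ the (completed) free Lie algebra of formal Lie series. $\mathfrak{fr}^{>1}_k(x_0,x_1)$ is the set of $\psi\in\mathfrak{fr}_k(x_0,x_1)$ with $\psi(x_0,0)=\psi(0,x_1)=0$. Put $\mathrm{Skew}=\{\psi\in\mathfrak{fr}^{>1}_k(x_0,x_1)\mid\psi(x_0,x_1)=-\psi(x_1,x_0)\}$, $\mathrm{Vep}=\{\psi\in\mathfrak{fr}^{>1}_k(x_0,x_1)\mid[x_1,\psi(-x_0-x_1,x_1)]+[x_0,\psi(-x_0-x_1,x_0)]=0\}$.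 Ihara bracket: $\{\psi_1,\psi_2\}=d_{\psi_2}(\psi_1)-d_{\psi_1}(\psi_2)-[\psi_1,\psi_2]$, where $d_\psi$ is the derivation with $d_\psi(x_0)=0$, $d_\psi(x_1)=[x_1,\psi]$. Double shuffle Lie algebra. $\mathfrak{dmr}_0$ is the set of $\psi\in\mathfrak{fr}_k(x_0,x_1)$ with $c_{x_0}(\psi)=c_{x_1}(\psi)=c_{x_0x_1}(\psi)=0$ and $\Delta_*(\psi_* )=1\otimes\psi_*+\psi_*\otimes1$, where $\psi_*=\psi_{\mathrm{corr}}+\pi_Y(\psi)\in k\langle\langle y_1,y_2,\dots\rangle\rangle$, $\psi_{\mathrm{corr}}=\sum_{n\ge1}\frac{(-1)^n}{n}c_{x_0^{n-1}x_1}(\psi)\,y_1^n$, $\pi_Y$ is the $k$-linear map sending words ending in $x_0$ to $0$ and $x_0^{n_m-1}x_1\cdots x_0^{n_1-1}x_1$ to $(-1)^m y_{n_m}\cdots y_{n_1}$, and $\Delta_*$ is the coproduct (algebra morphism) with $\Delta_*y_n=\sum_{i=0}^n y_i\otimes y_{n-i}$, $y_0=1$. (It is a Lie algebra for the Ihara bracket, by Racinet.) Reduced coaction. Every $\varphi\in A$ is uniquely written $\varphi=\varepsilon(\varphi)+x_0d^R_0(\varphi)+x_1d^R_1(\varphi)=\varepsilon(\varphi)+d^L_0(\varphi)x_0+d^L_1(\varphi)x_1$. The reduced coaction $\mu:A\to A$ is the (continuous) linear map with $\mu(x_0)=\mu(x_1)=0$ and $\mu(k_1\cdots k_n)=\sum_{i=1}^{n-1}k_1\cdots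 k_{i-1}(k_i\odot k_{i+1})k_{i+2}\cdots k_n$ for letters $k_j\in\{x_0,x_1\}$, where $x_i\odot x_j=\delta_{ij}x_i$. For a Lie series $\eta$ with $c_{x_0}(\eta)=c_{x_1}(\eta)=0$ let $r_\eta(x)=\sum_{l\ge0}c_{x_0^{l+1}x_1}(\eta)x^{l+1}$. The reduced coaction equation for $\eta$ is $\mu(\eta)=-r_\eta(x_1)+r_\eta(-x_0)-d^L_0(\eta)-d^R_1(\eta)$. $\mathfrak{rc}$ is the set of $\psi\in\mathrm{Skew}$ satisfying this equation, and $\mathfrak{rc}_0\subset\mathfrak{rc}$ is the subset of elements whose coefficient of the commutator $[x_0,x_1]$ is $0$. Kashiwara–Vergne Lie algebra. $\mathfrak{tder}_2=\mathfrak{fr}_k(x_0,x_1)\oplus\mathfrak{fr}_k(x_0,x_1)$; for $u=(u_0,u_1)$ let $\rho(u)$ be the derivation of $A$ with $\rho(u)(x_i)=[x_i,u_i]$, $i=0,1$. The bracket is $[u,v]=([u,v]_0,[u,v]_1)$ with $[u,v]_i=\rho(u)(v_i)-\rho(v)(u_i)+[u_i,v_i]$. $\mathfrak{sder}_2=\{u\in\mathfrak{tder}_2\mid[x_0,u_0]+[x_1,u_1]=0\}$. Let $|A|=A/[A,A]$ with projection $|\cdot|$, and $\mathrm{div}(u)=|x_0d^R_0(u_0)+x_1d^R_1(u_1)|$. $\mathfrak{krv}_2$ is the set of $u\in\mathfrak{sder}_2$ such that $\mathrm{div}(u)=|f(x_0+x_1)-f(x_0)-f(x_1)|$ for some $f\in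 k[[x]]$, with the bracket of $\mathfrak{tder}_2$. *)

(* Defs.v *)
From HB Require Import structures.
From mathcomp Require Import all_boot all_order all_algebra.
From mathcomp Require Import boolp classical_sets functions cardinality fsbigop.

Set Implicit Arguments.
Unset Strict Implicit.
Unset Printing Implicit Defensive.

Import GRing.Theory.

Local Open Scope classical_set_scope.
Local Open Scope ring_scope.
Local Open Scope quotient_scope.

(* [series X R] is R<<X>>, a series being its coefficient function on words.
   The coefficient ring R need not be commutative; this is used below with
   R = k<<Y>>. *)
Definition series (X : Type) (R : nzRingType) : Type := seq X -> R.

Section SeriesRing.
Variables (X : Type) (R : nzRingType).
Implicit Types f g h : series X R.

HB.instance Definition _ := GRing.Zmodule.copy (series X R) (seq X -> R).

Lemma seriesDE f g w : (f + g) w = f w + g w.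
Proof. by []. Qed.

Definition series_scale (c : R) f : series X R := fun w => c * f w.

Fact series_scaleA a b f :
  series_scale a (series_scale b f) = series_scale (a * b) f.
Proof. by apply/funext => w; rewrite /series_scale mulrA. Qed.

Fact series_scale1 : left_id 1 series_scale.
Proof. by move=> f; apply/funext => w; rewrite /series_scale mul1r. Qed.

Fact series_scaleDr : right_distributive series_scale +%R.
Proof.
by move=> a f g; apply/funext => w; rewrite seriesDE /series_scale mulrDr.
Qed.

Fact series_scaleDl f : {morph series_scale^~ f : a b / a + b}.
Proof.
by move=> a b; apply/funext => w; rewrite seriesDE /series_scale mulrDl.
Qed.

HB.instance Definition _ := GRing.Zmodule_isLmodule.Build R (series X R)
  series_scaleA series_scale1 series_scaleDr series_scaleDl.

Lemma seriesZE c f w : (c *: f) w = c * f w.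
Proof. by []. Qed.

Definition series1 : series X R := fun w => (nilp w)%:R.

Definition series_mul f g : series X R :=
  fun w => \sum_(i < (size w).+1) f (take i w) * g (drop i w).

Lemma series_mul_nil f g : series_mul f g [::] = f [::] * g [::].
Proof. by rewrite /series_mul big_ord1. Qed.

Lemma series_mul_cons f g x w : series_mul f g (x :: w) =
  f [::] * g (x :: w) + series_mul (fun v => f (x :: v)) g w.
Proof. by rewrite /series_mul big_ord_recl. Qed.

Lemma series_mulDl : left_distributive series_mul +%R.
Proof.
move=> f g h; apply/funext => w; rewrite seriesDE -big_split.
by apply: eq_bigr => i _; rewrite seriesDE mulrDl.
Qed.

Lemma series_mulDr : right_distributive series_mul +%R.
Proof.
move=> f g h; apply/funext => w; rewrite seriesDE -big_split.
by apply: eq_bigr => i _; rewrite seriesDE mulrDr.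
Qed.

Lemma series_mulZl (a : R) f g : series_mul (a *: f) g = a *: series_mul f g.
Proof.
apply/funext => w; rewrite seriesZE mulr_sumr.
by apply: eq_bigr => i _; rewrite seriesZE mulrA.
Qed.

Lemma series_mulA : associative series_mul.
Proof.
move=> f g h; apply/funext => w; elim: w f g => [|x w IHw] f g.
  by rewrite !series_mul_nil mulrA.
rewrite !series_mul_cons series_mul_nil IHw.
have -> : (fun v => series_mul f g (x :: v)) =
    f [::] *: ((fun v => g (x :: v)) : series X R) +
      series_mul (fun v => f (x :: v)) g.
  by apply/funext => v; rewrite series_mul_cons seriesDE seriesZE.
by rewrite series_mulDl series_mulZl mulrDr -!addrA mulrA.
Qed.

Lemma series_mul1l : left_id series1 series_mul.
Proof.
move=> f; apply/funext => w; rewrite /series_mul big_ord_recl take0 drop0 mul1r.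
rewrite big1 ?addr0// => i _; case: w i => [[]//|x w] i.
by rewrite /series1 /= mul0r.
Qed.

Lemma series_mul1r : right_id series1 series_mul.
Proof.
move=> f; apply/funext => w.
rewrite /series_mul big_ord_recr /= take_size drop_size mulr1.
rewrite big1 ?add0r// => i _; rewrite /series1 /nilp size_drop subn_eq0 leqNgt.
by rewrite ltn_ord mulr0.
Qed.

Lemma series1_neq0 : series1 != 0.
Proof.
by apply/eqP => /(congr1 (fun f : series X R => f [::])) /eqP; rewrite oner_eq0.
Qed.

HB.instance Definition _ := GRing.Zmodule_isNzRing.Build (series X R)
  series_mulA series_mul1l series_mul1r series_mulDl series_mulDr series1_neq0.

End SeriesRing.

Section Series.
Variables (X : choiceType) (R : nzRingType).

Definition var (x : X) : series X R := fun w => (w == [:: x])%:R.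

Definition mono (w : seq X) : series X R := \prod_(x <- w) var x.

Definition homog (n : nat) (f : series X R) : series X R :=
  fun w => if size w == n then f w else 0.

(* Continuous linear extension of a map g given on words. The big
   operator is 0 on infinite supports, but in all uses below only finitely many
   words w contribute to a given coefficient t. *)
Definition clin (T : Type) (g : seq X -> T -> R) (f : series X R) : T -> R :=
  fun t => \sum_(w \in [set: seq X]) f w * g w t.

(* f(a) = sum_n f_n a^n; meaningful when a has no constant term. *)
Definition psubst (f : nat -> R) (a : series X R) : series X R :=
  fun w => \sum_(n \in [set: nat]) f n * (a ^+ n) w.

End Series.

Section Bracket.
Variable B : nzRingType.

Definition lie (a b : B) : B := a * b - b * a.

(* [B, B]. An additive span suffices: in an algebra, c [a, b] = [c a, b].
   For formal power series in finitely many letters it is already closed, being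
   the sum of the [x, A] for x a letter. *)
Definition comm_span : {pred B} :=
  [pred a | `[< exists s : seq (B * B), a = \sum_(p <- s) lie p.1 p.2 >]].

Lemma comm_span_zmod : zmod_closed comm_span.
Proof.
split=> [|a b /asboolP[s ->] /asboolP[t ->]]; apply/asboolP.
  by exists [::]; rewrite big_nil.
exists (s ++ [seq (p.2, p.1) | p <- t]); rewrite big_cat big_map /=.
by congr (_ + _); rewrite -sumrN; apply: eq_bigr => p _; rewrite opprB.
Qed.

HB.instance Definition _ :=
  GRing.isZmodClosed.Build B comm_span comm_span_zmod.

Definition cyc : zmodType := Quotient.quot comm_span.

Definition tr (a : B) : cyc := \pi_cyc a.

End Bracket.

Section TwoLetters.
Variable k : fieldType.

(* The letters x_0 and x_1 are encoded by false and true. *)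
Notation A := (series bool k).
Notation x0 := (var k false : A).
Notation x1 := (var k true : A).

Implicit Types (phi psi eta a b : A) (u v : (A * A)%type).

Inductive lie_poly : A -> Prop :=
| lie_poly_var l : lie_poly (var k l)
| lie_poly_add a b : lie_poly a -> lie_poly b -> lie_poly (a + b)
| lie_poly_scale (c : k) a : lie_poly a -> lie_poly (c *: a)
| lie_poly_lie a b : lie_poly a -> lie_poly b -> lie_poly (lie a b).

(* Completion for the degree: Lie series have Lie polynomials as homogeneous
   components. *)
Definition fr : set A := [set psi | forall n, lie_poly (homog n psi)].

Definition subst (phi a b : A) : A :=
  clin (fun w => \prod_(l <- w) (if l then b else a)) phi.

Definition fr_gt1 : set A :=
  [set psi | [/\ fr psi, subst psi x0 0 = 0 & subst psi 0 x1 = 0]].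

Definition Skew : set A :=
  [set psi | fr_gt1 psi /\ subst psi x0 x1 = - subst psi x1 x0].

Definition Vep : set A :=
  [set psi | fr_gt1 psi /\
    lie x1 (subst psi (- x0 - x1) x1) + lie x0 (subst psi (- x0 - x1) x0) = 0].

(* The continuous derivation of A with x_0 |-> a and x_1 |-> b. *)
Definition der (a b : A) : A -> A :=
  clin (fun w => \sum_(i < size w)
    mono k (take i w) * (if nth false w i then b else a) *
    mono k (drop i.+1 w)).

Definition der_ihara psi : A -> A := der 0 (lie x1 psi).

Definition ihara psi1 psi2 : A :=
  der_ihara psi2 psi1 - der_ihara psi1 psi2 - lie psi1 psi2.

Definition dR (l : bool) phi : A := fun w => phi (l :: w).

Definition dL (l : bool) phi : A := fun w => phi (rcons w l).

Definition odot (l m : bool) : A := if l == m then var k l else 0.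

Definition mu : A -> A :=
  clin (fun w => \sum_(i < (size w).-1)
    mono k (take i w) * odot (nth false w i) (nth false w i.+1) *
    mono k (drop i.+2 w)).

Definition rser eta : nat -> k :=
  fun n => if n is l.+1 then eta (rcons (nseq l.+1 false) true) else 0.

Definition coaction_eq eta : Prop :=
  mu eta = - psubst (rser eta) x1 + psubst (rser eta) (- x0)
           - dL false eta - dR true eta.

Definition rc : set A := [set psi | Skew psi /\ coaction_eq psi].

(* The degree 2 part of a Lie series is c [x_0, x_1] with c its coefficient
   at the word x_0 x_1. *)
Definition rc0 : set A := [set psi | rc psi /\ psi [:: false; true] = 0].

(* k<<y_1, y_2, ...>>: the letter n encodes y_(n+1). The completed tensor
   square is (k<<Y>>)<<Y>>, where f s t is the coefficient of s (x) t. *)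
Notation AY := (series nat k).
Notation AYY := (series nat AY).

Definition yvar (n : nat) : AY := if n is m.+1 then var k m else 1.

Definition tensor (f g : AY) : AYY := fun s t => f s * g t.

Definition stuffle_var (n : nat) : AYY :=
  \sum_(i < n.+1) tensor (yvar i) (yvar (n - i)).

Definition stuffle_word (w : seq nat) : AYY := \prod_(m <- w) stuffle_var m.+1.

Definition stuffle (f : AY) : AYY :=
  fun s t => clin (fun w (p : seq nat * seq nat) => stuffle_word w p.1 p.2)
                  f (s, t).

(* The word x_0^(n_m - 1) x_1 ... x_0^(n_1 - 1) x_1 of y_(n_m) ... y_(n_1). *)
Definition x_word (w : seq nat) : seq bool :=
  flatten [seq rcons (nseq n false) true | n <- w].

Definition pi_Y psi : AY := fun w => (-1) ^+ size w * psi (x_word w).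

Definition psi_corr psi : AY :=
  psubst (fun n => if n is m.+1
                   then (-1) ^+ n / n%:R * psi (rcons (nseq m false) true)
                   else 0)
         (yvar 1).

Definition psi_star psi : AY := psi_corr psi + pi_Y psi.

Definition dmr0 : set A :=
  [set psi | [/\ fr psi,
    [/\ psi [:: false] = 0, psi [:: true] = 0 & psi [:: false; true] = 0] &
    stuffle (psi_star psi) =
      tensor 1 (psi_star psi) + tensor (psi_star psi) 1]].

Definition rho u : A -> A := der (lie x0 u.1) (lie x1 u.2).

Definition tder : set (A * A) := [set u | fr u.1 /\ fr u.2].

Definition tder_lie u v : (A * A)%type :=
  (rho u v.1 - rho v u.1 + lie u.1 v.1, rho u v.2 - rho v u.2 + lie u.2 v.2).

Definition sder : set (A * A) :=
  [set u | tder u /\ lie x0 u.1 + lie x1 u.2 = 0].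

Definition divergence u : cyc A := tr (x0 * dR false u.1 + x1 * dR true u.2).

Definition krv2 : set (A * A) :=
  [set u | sder u /\ exists f : nat -> k,
    divergence u = tr (psubst f (x0 + x1) - psubst f x0 - psubst f x1)].

Definition L1 psi : (A * A)%type :=
  (- subst psi (- x0 - x1) x0, - subst psi (- x0 - x1) x1).

End TwoLetters.

Record lie_algebra_on (k : nzRingType) (V : lmodType k) (S : set V)
    (br : V -> V -> V) : Prop := LieAlgebraOn {
  lie_on_0 : S 0;
  lie_on_lin : forall (c : k) x y, S x -> S y -> S (c *: x + y);
  lie_on_br : forall x y, S x -> S y -> S (br x y);
  lie_on_linl : forall (c : k) x y z, S x -> S y -> S z ->
    br (c *: x + y) z = c *: br x z + br y z;
  lie_on_linr : forall (c : k) x y z, S x -> S y -> S z ->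
    br z (c *: x + y) = c *: br z x + br z y;
  lie_on_alt : forall x, S x -> br x x = 0;
  lie_on_jacobi : forall x y z, S x -> S y -> S z ->
    br x (br y z) + br y (br z x) + br z (br x y) = 0
}.

(* F, restricted to S, is an injective morphism of Lie algebras S -> S'. *)
Record injective_lie_map (k : nzRingType) (V W : lmodType k)
    (S : set V) (br : V -> V -> V) (S' : set W) (br' : W -> W -> W)
    (F : V -> W) : Prop := InjectiveLieMap {
  lie_map_dom : lie_algebra_on S br;
  lie_map_cod : lie_algebra_on S' br';
  lie_map_to : forall x, S x -> S' (F x);
  lie_map_lin : forall (c : k) x y, S x -> S y ->
    F (c *: x + y) = c *: F x + F y;
  lie_map_br : forall x y, S x -> S y -> F (br x y) = br' (F x) (F y);
  lie_map_inj : forall x y, S x -> S y -> F x = F y -> x = y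
}.

(* Main.v *)
Require Import Defs.
From HB Require Import structures.
From mathcomp Require Import all_boot all_order all_algebra.
From mathcomp Require Import ring.
From mathcomp Require Import boolp classical_sets functions cardinality fsbigop.
From Stdlib Require Ncring Ncring_tac.

Set Implicit Arguments.
Unset Strict Implicit.
Unset Printing Implicit Defensive.

Import GRing.Theory.

Local Open Scope classical_set_scope.
Local Open Scope ring_scope.

(** All spaces of series below carry the topology of coefficientwise convergence,
    and an identity between continuous linear maps is proved by comparing words
    ([cont_ext]); for morphisms and derivations the letters suffice
    ([morphism_ext], [leibniz_ext]). On Lie series one knows in addition that the
    antipode acts as -1 ([fr_antipode]) and that the derivatives with respect to
    x_0 and x_1 vanish when there is no linear term ([fr_der1]).

    The common source of all arguments is the symmetry [kappa psi = 0], that is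
    d^R_1 psi - d^R_0 psi = d^L_1 psi - d^L_0 psi, which holds for a Lie series
    psi without terms of degree at most 2 that satisfies the coaction equation.
    Comparing the equation with its image under the antipode shows that
    [kappa psi] is a power series in x_0 plus one in x_1, which measures the odd
    part of r_psi; and this odd part vanishes, by an elementary manipulation of
    coefficients of depth two ([even_coeff]).

    - rc_0 is closed under the Ihara bracket. The failure of [mu] to commute with
      d_psi only involves d^L_0 psi, d^R_0 psi and a power series in x_0, because
      the other contributions of [x_1, psi] cancel by [kappa psi = 0]
      ([mu_der_ihara]). The left-hand side of
      the coaction equation of a bracket is then seen to vanish by expansion
      ([coact_ihara]); so does the right-hand side, which depends on the depth one
      part only.

    - [L1] maps into krv_2. Put z = - x_0 - x_1. The condition Vep says that the
      tangential derivation rho(L1 psi) kills z; it is then conjugate to - d_psi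
      by the substitutions (z, x_0) and (z, x_1), whence the compatibility with
      brackets ([rho_L1], [L1_ihara]). In the letters (z, x_l) the coaction
      equation expresses [mu u_l + dR l u_l], for u = L1 psi, by a power series in
      x_l and one in x_0 + x_1 ([coaction_L1]). Let H be the cyclically invariant
      series with H(l v) = u_l(v). The divergence reads the coefficients of H at
      words that start with a doubled letter, and [mu] at words with a doubled
      letter elsewhere, so that summing over rotations identifies
      x_0 mu(u_0) + x_1 mu(u_1) + div(u) with the degree times div(u), modulo
      commutators ([div_coaction], [krv2_of_coaction]). Dividing by the degree
      gives the equation of krv_2.

    - dmr_0 is contained in rc_0, up to skew-symmetry: the coaction equation is
      the part of the double shuffle relations of psi_* with a single letter y_1
      in one factor ([piY_ncoact], [dmr0_coaction]). The words that end with x_0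
      are reached by lowering indices, since d psi / d x_0 = 0 ([star_primitive]).

    - The intersection of dmr_0 and Skew is closed under the Ihara bracket. Up to
      a multiplication, the operator f |-> psi f + d_psi(f) induces on the algebra
      of the y_n the derivation y_m |-> sum_i (a_i y_(m+i) + y_(m+i) b_i), where
      the a_i and the b_i are made of the coefficients of psi at words ending,
      respectively starting, with x_0^i ([piY_action]). The a_i and b_i are
      primitive for the stuffle coproduct. Such a derivation is a coderivation
      provided that the analogous sums with y_m replaced by 1 or by a letter of
      negative index vanish ([cross_coderivation]); by d psi / d x_0 = 0 and
      [kappa psi = 0], they do ([kappa_shift], [star_cross0]). Coderivations
      preserve primitive elements, which gives the double shuffle relations of
      the bracket. *)

(** * Identities in noncommutative rings *)

#[export] Instance ncring_ops (B : nzRingType) :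
  @Ncring.Ring_ops B 0 1 +%R *%R (fun x y => x - y) -%R eq := {}.
#[export] Instance ncring (B : nzRingType) : Ncring.Ring (Ro := ncring_ops B).
Proof.
split; try exact _; try by move=> *; subst.
- exact: add0r.
- exact: addrC.
- exact: addrA.
- exact: mul1r.
- exact: mulr1.
- exact: mulrA.
- exact: mulrDl.
- by move=> x y z; exact: mulrDr.
- exact: subrr.
Qed.

Ltac ncring :=
  rewrite /lie;
  (* The ring structure is not found on the function type that [series X k]
     unfolds to. *)
  lazymatch goal with
  | |- @eq (forall _ : list ?X, GRing.Field.sort ?k) ?a ?b =>
      change (@eq (series X k) a b)
  | _ => idtac
  end; Ncring_tac.non_commutative_ring.

(** * Continuous linear maps between spaces of series *)

Section Continuous.
Variable k : fieldType.

(** Linear forms that are continuous for the product of the discrete topologies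
    are the finite combinations of coordinates. *)
Definition finitary (X : Type) (L : (X -> k) -> k) : Prop :=
  exists l : seq (k * X), forall f, L f = \sum_(p <- l) p.1 * f p.2.

Definition cont (X Z : Type) (T : (X -> k) -> (Z -> k)) : Prop :=
  forall z, finitary (fun f => T f z).

Lemma finitary_ext (X : eqType) (L L' : (X -> k) -> k) :
  finitary L -> finitary L' ->
  (forall x, L (fun y => (y == x)%:R) = L' (fun y => (y == x)%:R)) -> L =1 L'.
Proof.
move=> [l Ll] [l' Ll'] LL' f; apply/eqP; rewrite -subr_eq0.
pose m := l ++ [seq (- p.1, p.2) | p <- l'].
have Dm g : L g - L' g = \sum_(p <- m) p.1 * g p.2.
  rewrite Ll Ll' big_cat big_map /= -sumrN; congr (_ + _).
  by apply: eq_bigr => p _; rewrite mulNr.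
pose s := undup [seq p.2 | p <- m].
have Ef p : p \in m -> f p.2 = \sum_(x <- s) (p.2 == x)%:R * f x.
  move=> pm; have ps : p.2 \in s by rewrite mem_undup map_f.
  rewrite (bigD1_seq p.2) ?undup_uniq //= eqxx mul1r big1 ?addr0 // => x xp.
  by rewrite eq_sym (negPf xp) mul0r.
rewrite Dm big_seq (eq_bigr (fun p : k * X =>
    \sum_(x <- s) p.1 * (p.2 == x)%:R * f x)); last first.
  by move=> p pm; rewrite (Ef _ pm) mulr_sumr; apply: eq_bigr => x _; rewrite mulrA.
rewrite -big_seq exchange_big big1 //= => x _.
by rewrite -mulr_suml -(Dm (fun y => (y == x)%:R)) LL' subrr mul0r.
Qed.

Section Finitary.
Variable X : Type.
Implicit Types L M : (X -> k) -> k.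

Lemma finitary_eval (x : X) : finitary (fun f : X -> k => f x).
Proof. by exists [:: (1, x)] => f; rewrite big_seq1 mul1r. Qed.

Lemma finitary0 : finitary (fun _ : X -> k => 0).
Proof. by exists [::] => f; rewrite big_nil. Qed.

Lemma finitaryD L M : finitary L -> finitary M -> finitary (fun f => L f + M f).
Proof. by move=> [l Ll] [m Mm]; exists (l ++ m) => f; rewrite Ll Mm big_cat. Qed.

Lemma finitaryZ (c : k) L : finitary L -> finitary (fun f => c * L f).
Proof.
move=> [l Ll]; exists [seq (c * p.1, p.2) | p <- l] => f.
by rewrite Ll mulr_sumr big_map; apply: eq_bigr => p _; rewrite mulrA.
Qed.

Lemma finitaryN L : finitary L -> finitary (fun f => - L f).
Proof.
by move=> /(finitaryZ (-1))[l Ll]; exists l => f; rewrite -Ll mulN1r.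
Qed.

Lemma finitary_sum (I : Type) (r : seq I) (P : pred I) (F : I -> (X -> k) -> k) :
  (forall i, P i -> finitary (F i)) ->
  finitary (fun f => \sum_(i <- r | P i) F i f).
Proof.
move=> FF; elim: r => [|i r [l Hl]].
  by exists [::] => f; rewrite !big_nil.
case Pi : (P i).
  have [m Hm] := FF i Pi; exists (m ++ l) => f.
  by rewrite big_cons Pi Hm Hl big_cat.
by exists l => f; rewrite big_cons Pi Hl.
Qed.

Lemma finitary_comp (Z : Type) (L : (Z -> k) -> k) (T : (X -> k) -> (Z -> k)) :
  finitary L -> cont T -> finitary (fun f => L (T f)).
Proof.
move=> [l Ll] cT.
have [m Hm] := @finitary_sum _ l xpredT (fun p f => p.1 * T f p.2)
  (fun p _ => finitaryZ p.1 (cT p.2)).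
by exists m => f; rewrite Ll Hm.
Qed.

End Finitary.

Lemma cont_comp (X Y Z : Type) (U : (Y -> k) -> (Z -> k))
    (T : (X -> k) -> (Y -> k)) :
  cont U -> cont T -> cont (fun f => U (T f)).
Proof. by move=> cU cT z; exact: finitary_comp (cU z) cT. Qed.

Section Cont.
Variables (X : Type) (Z : Type).
Implicit Types T U : (X -> k) -> series Z k.

Lemma cont_id : cont (fun f : X -> k => f).
Proof. by move=> x; exact: finitary_eval. Qed.

Lemma cont0 : cont (fun _ : X -> k => 0 : series Z k).
Proof. by move=> z; exact: finitary0. Qed.

Lemma contD T U : cont T -> cont U -> cont (fun f => T f + U f).
Proof. by move=> cT cU z; exact: finitaryD (cT z) (cU z). Qed.

Lemma contN T : cont T -> cont (fun f => - T f).
Proof. by move=> cT z; exact: finitaryN (cT z). Qed.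

Lemma contZ (c : k) T : cont T -> cont (fun f => c *: T f).
Proof. by move=> cT z; exact: finitaryZ (cT z). Qed.

Lemma contMl (a : series Z k) T : cont T -> cont (fun f => a * T f).
Proof.
by move=> cT z; apply: finitary_sum => i _; exact: finitaryZ (cT _).
Qed.

Lemma contMr (a : series Z k) T : cont T -> cont (fun f => T f * a).
Proof.
move=> cT z; have [l Hl] : finitary (fun f => \sum_(i < (size z).+1)
    a (drop i z) * T f (take i z)).
  by apply: finitary_sum => i _; exact: finitaryZ (cT _).
by exists l => f; rewrite -Hl; apply: eq_bigr => i _; rewrite mulrC.
Qed.

Lemma cont_lin T : cont T -> forall (c : k) f g,
  T (fun x => c * f x + g x) = c *: T f + T g.
Proof.
move=> cT c f g; apply/funext => z; have [l Hl] := cT z.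
rewrite seriesDE seriesZE !Hl mulr_sumr -big_split; apply: eq_bigr => p _ /=.
by rewrite mulrDr !mulrA (mulrC c).
Qed.

End Cont.

Lemma cont_dR (X : Type) (l : bool) (T : (X -> k) -> series bool k) :
  cont T -> cont (fun f => dR l (T f)).
Proof. by move=> cT w; exact: (cT (l :: w)). Qed.

Lemma cont_dL (X : Type) (l : bool) (T : (X -> k) -> series bool k) :
  cont T -> cont (fun f => dL l (T f)).
Proof. by move=> cT w; exact: (cT (rcons w l)). Qed.

Section Summation.
Variables (X : choiceType) (Z : Type) (g : X -> Z -> k).

Lemma fsbig_cont : (forall z, finite_set [set x | g x z != 0]) ->
  cont (fun f z => \sum_(x \in [set: X]) f x * g x z).
Proof.
move=> fing z; have /finite_seqP[s Es] := fing z.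
exists [seq (g x z, x) | x <- undup s] => f; rewrite big_map.
rewrite (fsbigE (undup s)) ?undup_uniq //.
  by apply: eq_big => [x|x _]; rewrite ?in_setT // mulrC.
move=> x _; rewrite mem_undup => xs; apply/eqP; rewrite mulf_eq0 orbC.
case: eqP => //= /eqP gx; have : [set x | g x z != 0] x by [].
by rewrite Es /= (negPf xs).
Qed.

Lemma fsbig_dirac x z :
  \sum_(y \in [set: X]) (y == x)%:R * g y z = g x z.
Proof.
rewrite (fsbigE [:: x]) // ?big_seq1 ?in_setT ?big_cons ?big_nil ?in_setT //=.
  by rewrite eqxx mul1r addr0.
by move=> y _; rewrite inE => /negPf ->; rewrite mul0r.
Qed.

End Summation.

End Continuous.

(** * Monomials, weights, derivations *)

Lemma seriesNE (X : Type) (R : nzRingType) (f : series X R) w : (- f) w = - f w.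
Proof. by []. Qed.

Lemma seriesBE (X : Type) (R : nzRingType) (f g : series X R) w :
  (f - g) w = f w - g w.
Proof. by []. Qed.

Lemma series0E (X : Type) (R : nzRingType) w : (0 : series X R) w = 0.
Proof. by []. Qed.

Lemma series_sumE (X : Type) (R : nzRingType) (I : Type) (r : seq I) (P : pred I)
    (F : I -> series X R) w :
  (\sum_(i <- r | P i) F i) w = \sum_(i <- r | P i) F i w.
Proof. exact: (big_morph (fun f : series X R => f w)). Qed.

Section Monomials.
Variables (X : choiceType) (k : fieldType).
Implicit Types (f g h : series X k) (u v w : seq X) (x y : X).

Lemma mono_cons x w : mono k (x :: w) = var k x * mono k w.
Proof. by rewrite /mono big_cons. Qed.

Lemma mono_cat u v : mono k (u ++ v) = mono k u * mono k v.
Proof. by rewrite /mono big_cat. Qed.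

Lemma mono_nil : mono k ([::] : seq X) = 1 :> series X k.
Proof. by rewrite /mono big_nil. Qed.

Lemma mono1 x : mono k [:: x] = var k x.
Proof. by rewrite mono_cons mono_nil mulr1. Qed.

Lemma mul_nil f g : (f * g) [::] = f [::] * g [::].
Proof. exact: series_mul_nil. Qed.

Lemma mul_cons f g x w :
  (f * g) (x :: w) = f [::] * g (x :: w) + (((fun v => f (x :: v)) : series X k) * g) w.
Proof. by rewrite -[LHS]/(series_mul f g (x :: w)) series_mul_cons. Qed.

Lemma mul_neq0 f g w : (f * g) w != 0 ->
  exists u v, [/\ w = u ++ v, f u != 0 & g v != 0].
Proof.
move=> fgw; case: (pselect (exists i : 'I_(size w).+1, f (take i w) * g (drop i w) != 0)).
  case=> i; rewrite mulf_eq0 negb_or => /andP[fi gi].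
  by exists (take i w), (drop i w); rewrite cat_take_drop.
move=> H; case/eqP: fgw; apply: big1 => i _.
by apply: contrapT => /eqP fg; apply: H; exists i.
Qed.

Lemma scale_mul (c : k) f g : (c *: f) * g = c *: (f * g).
Proof. exact: series_mulZl. Qed.

Lemma var_mul_nil x f : (var k x * f) [::] = 0.
Proof. by rewrite mul_nil mul0r. Qed.

Lemma var_mul_cons x f y w : (var k x * f) (y :: w) = (y == x)%:R * f w.
Proof.
rewrite mul_cons {1}/var /= mul0r add0r.
have -> : (fun v => var k x (y :: v)) = (y == x)%:R *: (1 : series X k).
  apply/funext => v; rewrite seriesZE /var eqseq_cons.
  have -> : (1 : series X k) v = (nilp v)%:R by [].
  by case: (y == x); rewrite ?mul0r ?mul1r //; case: v.
by rewrite scale_mul mul1r.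
Qed.

Lemma monoE w v : mono k w v = (v == w)%:R.
Proof.
elim: w v => [|x w IHw] [|y v]; rewrite ?mono_nil ?mono_cons ?var_mul_nil //.
by rewrite var_mul_cons IHw eqseq_cons; case: eqP; rewrite ?mul1r ?mul0r.
Qed.

Lemma mul_scale (c : k) f g : f * (c *: g) = c *: (f * g).
Proof.
apply/funext => w; rewrite seriesZE -[LHS]/(series_mul _ _ _).
rewrite -[(f * g) w]/(series_mul f g w) /series_mul mulr_sumr.
by apply: eq_bigr => i _; rewrite seriesZE mulrCA.
Qed.

Lemma mul_var_nil f x : (f * var k x) [::] = 0.
Proof. by rewrite mul_nil mulr0. Qed.

Lemma mul_var_rcons f x w y : (f * var k x) (rcons w y) = f w * (y == x)%:R.
Proof.
have var1 : var k x [:: y] = (y == x)%:R by rewrite /var eqseq_cons andbT.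
elim: w f => [|z w IHw] f; rewrite mul_cons.
  by rewrite mul_var_nil addr0 var1.
have -> : var k x (z :: rcons w y) = 0.
  by rewrite /var; case: eqP => // -[_ /eqP]; case: w {IHw}.
by rewrite mulr0 add0r IHw.
Qed.

Lemma cont_ext (Z : Type) (T T' : series X k -> (Z -> k)) :
  cont T -> cont T' -> (forall w, T (mono k w) = T' (mono k w)) -> T =1 T'.
Proof.
move=> cT cT' TT' f; apply/funext => z.
apply: (finitary_ext (cT z) (cT' z)) => w.
have -> : (fun v => (v == w)%:R) = mono k w by apply/funext => v; rewrite monoE.
by rewrite TT'.
Qed.

Section Linear.
Variables (Z : Type) (T : series X k -> series Z k) (cT : cont T).

Lemma cont_eqP c f g : T (c *: f + g) = c *: T f + T g.
Proof. exact: (cont_lin cT). Qed.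

Lemma cont_eqD f g : T (f + g) = T f + T g.
Proof. by rewrite -[f in LHS]scale1r cont_eqP scale1r. Qed.

Lemma cont_eq0 : T 0 = 0.
Proof. by apply: (addrI (T 0)); rewrite -cont_eqD !addr0. Qed.

Lemma cont_eqZ c f : T (c *: f) = c *: T f.
Proof. by rewrite -[_ *: f]addr0 cont_eqP cont_eq0 addr0. Qed.

Lemma cont_eqN f : T (- f) = - T f.
Proof. by rewrite -scaleN1r cont_eqZ scaleN1r. Qed.

Lemma cont_eqB f g : T (f - g) = T f - T g.
Proof. by rewrite cont_eqD cont_eqN. Qed.

End Linear.

(** Besides derivations, where [s] is the identity, this covers the composites of a
    derivation and a substitution [s]. *)
Lemma leibniz_ext (B : nzRingType) (s T T' : series X k -> B) :
  T 1 = T' 1 ->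
  (forall f g, T (f * g) = T f * s g + s f * T g) ->
  (forall f g, T' (f * g) = T' f * s g + s f * T' g) ->
  (forall x, T (var k x) = T' (var k x)) ->
  forall w, T (mono k w) = T' (mono k w).
Proof.
move=> T1 TM TM' Tx; elim=> [|x w IHw]; first by rewrite mono_nil.
by rewrite mono_cons TM TM' Tx IHw.
Qed.

(** The weight is the length for the letters x_0, x_1 and, for the letters y_n,
    the sum of the indices; both have finitely many words of bounded weight. *)
Variable wt : X -> nat.

Definition weight w : nat := \sum_(x <- w) wt x.

Lemma weight_cat u v : weight (u ++ v) = (weight u + weight v)%N.
Proof. by rewrite /weight big_cat. Qed.

Lemma weight_cons x v : weight (x :: v) = (wt x + weight v)%N.
Proof. by rewrite /weight big_cons. Qed.

Definition finite_weight : Prop := (forall x, 0 < wt x)%N /\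
  forall n, exists s : seq X, forall x, (wt x <= n)%N -> x \in s.

Hypothesis fin_wt : finite_weight.

Lemma finite_words n : finite_set [set w | (weight w <= n)%N].
Proof.
have [wt0 fwt] := fin_wt.
suff [s Hs] : exists s : seq (seq X), forall w, (weight w <= n)%N -> w \in s.
  by apply: (sub_finite_set (B := [set` s])) => [w|]; [exact: Hs|apply/finite_seqP; exists s].
elim: n => [|n [s Hs]].
  exists [:: [::]] => -[|x w] //; rewrite weight_cons.
  by case: (wt x) (wt0 x).
have [l Hl] := fwt n.+1.
exists ([::] :: [seq x :: w | x <- l, w <- s]) => -[|x w] //.
rewrite weight_cons => xw; rewrite inE /=; apply/allpairsP; exists (x, w) => /=.
split => //; first by apply: Hl; apply: leq_trans xw; rewrite leq_addr.
apply: Hs; rewrite -ltnS; apply: leq_trans xw.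
by rewrite -add1n leq_add2r.
Qed.

Lemma clin_cont (Z : Type) (g : seq X -> Z -> k) (n : Z -> nat) :
  (forall w z, g w z != 0 -> (weight w <= n z)%N) -> cont (clin g).
Proof.
move=> gn; apply: fsbig_cont => z; apply: (sub_finite_set (B := [set w | (weight w <= n z)%N])).
  by move=> w; exact: gn.
exact: finite_words.
Qed.

Lemma clin_mono (Z : Type) (g : seq X -> Z -> k) w : clin g (mono k w) = g w.
Proof.
apply/funext => z; rewrite /clin -[RHS](fsbig_dirac g).
by apply: eq_fsbigr => v _; rewrite monoE.
Qed.

Fixpoint leibniz (d : X -> series X k) w : series X k :=
  if w is x :: v then d x * mono k v + var k x * leibniz d v else 0.

Lemma leibniz_cat d u v :
  leibniz d (u ++ v) = leibniz d u * mono k v + mono k u * leibniz d v.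
Proof.
elim: u => [|x u IHu] /=; first by rewrite mono_nil mul0r add0r mul1r.
by rewrite IHu mono_cat mono_cons; ncring.
Qed.

Definition derivation (d : X -> series X k) : series X k -> series X k :=
  clin (leibniz d).

(** Applied to letters and, by [leibniz_low], to words, [d] lowers weights by at
    most [c]; this is what makes [derivation d] well defined on series. *)
Definition low (c : nat) (d : X -> series X k) : Prop :=
  forall x w, d x w != 0 -> (wt x <= weight w + c)%N.

Variables (c : nat) (d : X -> series X k) (low_d : low c d).

Lemma leibniz_low w v : leibniz d w v != 0 -> (weight w <= weight v + c)%N.
Proof.
elim: w v => [|x w IHw] v /=; first by rewrite eqxx.
rewrite weight_cons seriesDE => H.
have /orP[] : ((d x * mono k w) v != 0) || ((var k x * leibniz d w) v != 0).
  by apply: contraNT H; rewrite negb_or !negbK => /andP[/eqP-> /eqP->]; rewrite addr0.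
- case/mul_neq0 => [u [t [-> /low_d xu]]]; rewrite monoE.
  case: (t =P w) => [-> _|]; last by rewrite eqxx.
  by rewrite weight_cat addnAC leq_add2r.
case: v {H} => [|y v]; first by rewrite var_mul_nil eqxx.
rewrite var_mul_cons; case: (y =P x) => [->|_]; last by rewrite mul0r eqxx.
by rewrite mul1r weight_cons -addnA leq_add2l; exact: IHw.
Qed.

Lemma derivation_cont : cont (derivation d).
Proof. exact: (clin_cont (n := fun v => (weight v + c)%N) leibniz_low). Qed.

Lemma derivation_local n f g :
  (forall w, (weight w <= n + c)%N -> f w = g w) ->
  forall w, (weight w <= n)%N -> derivation d f w = derivation d g w.
Proof.
move=> fg w wn; apply: eq_fsbigr => v _ /=.
case: (eqVneq (leibniz d v w) 0) => [->|/leibniz_low vw]; first by rewrite !mulr0.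
by rewrite fg // (leq_trans vw) // leq_add2r.
Qed.

Lemma derivation_var x : derivation d (var k x) = d x.
Proof. by rewrite -mono1 /derivation clin_mono /= mono_nil mulr1 mulr0 addr0. Qed.

Lemma derivation1 : derivation d 1 = 0.
Proof. by rewrite -mono_nil /derivation clin_mono. Qed.

Lemma derivationM f g :
  derivation d (f * g) = derivation d f * g + f * derivation d g.
Proof.
have cd := derivation_cont; move: f.
have cl h : cont (fun f : series X k => f * h) by apply: contMr; exact: cont_id.
have cr h : cont (fun f : series X k => h * f) by apply: contMl; exact: cont_id.
apply: cont_ext => [||u].
- by apply: (cont_comp cd); exact: cl.
- by apply: contD; apply: contMr => //; exact: cont_id.
move: g; apply: cont_ext => [||v].
- by apply: (cont_comp cd); exact: cr.
- by apply: contD; apply: contMl => //; exact: cont_id.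
by rewrite -mono_cat /derivation !clin_mono leibniz_cat.
Qed.

End Monomials.

(** ** Power series in one element *)

Section PSubst.
Variables (X : choiceType) (k : fieldType) (a : series X k) (a0 : a [::] = 0).
Implicit Type r : nat -> k.

Lemma exp_low n w : (a ^+ n) w != 0 -> (n <= size w)%N.
Proof.
elim: n w => // n IHn w; rewrite exprS => /mul_neq0[u [v [-> au /IHn nv]]].
rewrite size_cat; case: u au => [|l u] au; first by rewrite a0 eqxx in au.
by rewrite /= ltnS (leq_trans nv) ?leq_addl.
Qed.

Lemma psubst_cont : cont (fun r => psubst r a).
Proof.
apply: fsbig_cont => w; apply: (sub_finite_set (B := [set` iota 0 (size w).+1])).
  move=> n /exp_low nw; change (n \in iota 0 (size w).+1).
  by rewrite mem_iota.
by apply/finite_seqP; exists (iota 0 (size w).+1).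
Qed.

Lemma psubst_ext (Z : Type) (T T' : (nat -> k) -> (Z -> k)) : cont T -> cont T' ->
  (forall n, T (fun m : nat => (m == n)%:R) = T' (fun m : nat => (m == n)%:R)) -> T =1 T'.
Proof.
move=> cT cT' TT' r; apply/funext => w.
by apply: (finitary_ext (cT w) (cT' w)) => n; rewrite TT'.
Qed.

Lemma psubst_dirac n : psubst (fun m : nat => (m == n)%:R) a = a ^+ n.
Proof. by apply/funext => w; rewrite /psubst (fsbig_dirac (fun n w => (a ^+ n) w)). Qed.

Lemma psubst_lin c r r' : psubst (fun n => c * r n + r' n) a = c *: psubst r a + psubst r' a.
Proof. exact: (cont_lin psubst_cont). Qed.

Lemma psubst_zero : psubst (fun=> 0) a = 0.
Proof.
apply: (addrI (psubst (fun=> 0) a)); rewrite addr0 -[X in X + _]scale1r -psubst_lin.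
by congr psubst; apply/funext => n; rewrite mulr0 addr0.
Qed.

Lemma psubst_comm r : a * psubst r a = psubst r a * a.
Proof.
move: r; apply: psubst_ext; first exact: contMl psubst_cont.
  exact: contMr psubst_cont.
by move=> n; rewrite psubst_dirac -exprS -exprSr.
Qed.

Lemma psubst_shift r : a * psubst r a = psubst (fun n => if n is m.+1 then r m else 0) a.
Proof.
move: r; apply: psubst_ext; first exact: contMl psubst_cont.
- apply: (cont_comp psubst_cont) => -[|n]; [exact: finitary0|exact: finitary_eval].
move=> n; rewrite psubst_dirac -exprS -psubst_dirac.
by congr psubst; apply/funext => -[|m].
Qed.

Lemma psubst_leibniz (T : series X k -> series X k) r (c : series X k) :
  cont T -> (forall f g, T (f * g) = T f * g + f * T g) ->
  T a = lie a c -> T (psubst r a) = lie (psubst r a) c.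
Proof.
move=> cT TM Ta; have T1 : T 1 = 0.
  by apply: (addrI (T 1)); rewrite addr0 -[in RHS](mulr1 1) TM mulr1 mul1r.
move: r; apply: psubst_ext.
- exact: (cont_comp cT psubst_cont).
- by apply: contD; [exact: contMr psubst_cont|apply: contN; exact: contMl psubst_cont].
move=> n; rewrite psubst_dirac; elim: n => [|n IHn].
  by rewrite expr0 T1; ncring.
by rewrite exprS TM IHn Ta; ncring.
Qed.

End PSubst.

(** * Operators on series in two letters *)

Section Operators.
Variable k : fieldType.

Notation A := (series bool k).
Notation x0 := (var k false : A).
Notation x1 := (var k true : A).

Implicit Types (f g a b : A) (l m : bool) (u v w : seq bool).

Definition wtb (_ : bool) : nat := 1.

Lemma finite_wtb : finite_weight wtb.
Proof. by split=> // n; exists [:: false; true]; case. Qed.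

Lemma weight_size w : weight wtb w = size w.
Proof. by rewrite /weight sum1_size. Qed.

Lemma dR_mul l f g : dR l (f * g) = dR l f * g + f [::] *: dR l g.
Proof. by apply/funext => w; rewrite {1}/dR mul_cons addrC. Qed.

Lemma dL_mul l f g : dL l (f * g) = f * dL l g + g [::] *: dL l f.
Proof.
apply/funext => w; rewrite {1}/dL -[LHS]/(series_mul _ _ _) /series_mul.
rewrite size_rcons big_ord_recr /= take_oversize ?size_rcons //.
rewrite drop_oversize ?size_rcons // seriesDE mulrC; congr (_ + _).
apply: eq_bigr => -[i Hi] _ /=; rewrite ltnS in Hi.
by rewrite -cats1 takel_cat // drop_cat ltn_neqAle Hi andbT; case: eqP => [->|_] /=;
  rewrite /dL -cats1 ?subnn ?drop0 ?drop_size.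
Qed.

Lemma dR_var l m : dR l (var k m) = if l == m then 1 else 0.
Proof.
by apply/funext => -[|y w]; rewrite /dR /var eqseq_cons; case: (l == m).
Qed.

Lemma dL_var l m : dL l (var k m) = if l == m then 1 else 0.
Proof.
by apply/funext => -[|y [|z w]]; rewrite /dL /var eqseq_cons; case: (l == m) => //;
  rewrite ?andbF.
Qed.

Lemma var_nil l : (var k l : A) [::] = 0. Proof. by []. Qed.
Lemma one_nil : (1 : A) [::] = 1. Proof. by []. Qed.

Lemma dR1 l : dR l (1 : A) = 0. Proof. by apply/funext. Qed.
Lemma dL1 l : dL l (1 : A) = 0. Proof. by apply/funext; case. Qed.

Lemma dRD l f g : dR l (f + g) = dR l f + dR l g. Proof. by []. Qed.
Lemma dRN l f : dR l (- f) = - dR l f. Proof. by []. Qed.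
Lemma dRZ l c f : dR l (c *: f) = c *: dR l f. Proof. by []. Qed.
Lemma dLD l f g : dL l (f + g) = dL l f + dL l g. Proof. by []. Qed.
Lemma dLN l f : dL l (- f) = - dL l f. Proof. by []. Qed.
Lemma dLZ l c f : dL l (c *: f) = c *: dL l f. Proof. by []. Qed.

Lemma dR_varM l m g : dR l (var k m * g) = if l == m then g else 0.
Proof.
by rewrite dR_mul scale0r addr0 dR_var; case: eqP; rewrite ?mul1r ?mul0r.
Qed.

Lemma dL_Mvar l m f : dL l (f * var k m) = if l == m then f else 0.
Proof.
by rewrite dL_mul scale0r addr0 dL_var; case: eqP; rewrite ?mulr1 ?mulr0.
Qed.

Lemma decompR f : f = f [::] *: (1 : A) + x0 * dR false f + x1 * dR true f.
Proof.
apply/funext => -[|l w]; rewrite !seriesDE seriesZE.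
  by rewrite !var_mul_nil !addr0 mulr1.
by rewrite !var_mul_cons mulr0 add0r; case: l; rewrite /= ?mul0r ?mul1r ?add0r ?addr0.
Qed.

Lemma decompL f : f = f [::] *: (1 : A) + dL false f * x0 + dL true f * x1.
Proof.
apply/funext => w; case: (lastP w) => [|{}w l]; rewrite !seriesDE seriesZE.
  by rewrite !mul_var_nil !addr0 mulr1.
rewrite !mul_var_rcons; have -> : (1 : A) (rcons w l) = 0 by case: w.
by rewrite mulr0 add0r; case: l; rewrite /= ?mulr0 ?mulr1 ?add0r ?addr0.
Qed.

(** ** Derivations *)

Lemma derE a b : der a b = derivation (fun l => if l then b else a).
Proof.
apply/funext => f; rewrite /der /derivation; congr clin; apply/funext => w.
elim: w => [|l w IHw]; first by rewrite big_ord0.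
rewrite big_ord_recl /= mono_nil mul1r drop0 -IHw mulr_sumr; congr (_ + _).
by apply: eq_bigr => i _; rewrite mono_cons !mulrA.
Qed.

Lemma low_letter (d : bool -> A) : low wtb 1 d.
Proof. by move=> l w _; rewrite leq_addl. Qed.

Lemma der_cont a b : cont (der a b).
Proof. by rewrite derE; exact: (derivation_cont finite_wtb (low_letter (d := _))). Qed.

Lemma derM a b f g : der a b (f * g) = der a b f * g + f * der a b g.
Proof. by rewrite derE; exact: (derivationM finite_wtb (low_letter (d := _))). Qed.

Lemma der_x0 a b : der a b x0 = a.
Proof. by rewrite derE derivation_var. Qed.

Lemma der_x1 a b : der a b x1 = b.
Proof. by rewrite derE derivation_var. Qed.

Lemma der1 a b : der a b 1 = 0.
Proof. by rewrite derE derivation1. Qed.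

Definition agree n f g := forall w, (size w <= n)%N -> f w = g w.

Lemma der_agreeS a b n f g :
  agree n.+1 f g -> agree n (der a b f) (der a b g).
Proof.
rewrite derE => fg w; rewrite -weight_size.
apply: (derivation_local (low_letter (d := _))) => v; rewrite addn1 weight_size.
exact: fg.
Qed.

Lemma der_agree a b n f g : a [::] = 0 -> b [::] = 0 ->
  agree n f g -> agree n (der a b f) (der a b g).
Proof.
move=> a0 b0 fg w; rewrite derE -weight_size.
apply: (derivation_local (c := 0)) => [l v|v]; last by rewrite addn0 weight_size; exact: fg.
by case: v => [|m v]; [case: l; rewrite ?a0 ?b0 eqxx | rewrite weight_size].
Qed.

Lemma derD a b f g : der a b (f + g) = der a b f + der a b g.
Proof. exact: (cont_eqD (der_cont a b)). Qed.
Lemma derN a b f : der a b (- f) = - der a b f.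
Proof. exact: (cont_eqN (der_cont a b)). Qed.
Lemma derB a b f g : der a b (f - g) = der a b f - der a b g.
Proof. exact: (cont_eqB (der_cont a b)). Qed.
Lemma derZ a b c f : der a b (c *: f) = c *: der a b f.
Proof. exact: (cont_eqZ (der_cont a b)). Qed.
Lemma der0 a b : der a b 0 = 0.
Proof. exact: (cont_eq0 (der_cont a b)). Qed.

Lemma der_lie a b f g :
  der a b (lie f g) = lie (der a b f) g + lie f (der a b g).
Proof. by rewrite /lie derB !derM; ncring. Qed.

(** ** Substitutions *)

Definition subst_word (a b : A) w : A := \prod_(l <- w) (if l then b else a).

Lemma subst_word_low a b w v : a [::] = 0 -> b [::] = 0 ->
  subst_word a b w v != 0 -> (size w <= size v)%N.
Proof.
move=> a0 b0; elim: w v => [|l w IHw] v; first by [].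
rewrite /subst_word big_cons => /mul_neq0[u [t [-> Hu /IHw]]].
rewrite size_cat; case: u Hu => [|y u] Hu H; last by rewrite /= ltnS (leq_trans H) ?leq_addl.
by case: l Hu; rewrite ?a0 ?b0 eqxx.
Qed.

Section Subst.
Variables (a b : A) (a0 : a [::] = 0) (b0 : b [::] = 0).

Lemma subst_cont : cont (fun f => subst f a b).
Proof.
apply: (clin_cont finite_wtb (n := size)) => w v /=; rewrite weight_size.
exact: subst_word_low.
Qed.

Lemma subst_mono w : subst (mono k w) a b = subst_word a b w.
Proof. by rewrite /subst clin_mono. Qed.

Lemma subst_x0 : subst x0 a b = a.
Proof. by rewrite -mono1 subst_mono /subst_word big_seq1. Qed.

Lemma subst_x1 : subst x1 a b = b.
Proof. by rewrite -mono1 subst_mono /subst_word big_seq1. Qed.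

Lemma subst1 : subst 1 a b = 1.
Proof. by have := subst_mono [::]; rewrite mono_nil => ->; rewrite /subst_word big_nil. Qed.

Lemma substM f g : subst (f * g) a b = subst f a b * subst g a b.
Proof.
have cs := subst_cont; move: f; apply: cont_ext => [||u].
- by apply: (cont_comp cs); apply: contMr; exact: cont_id.
- by apply: contMr.
move: g; apply: cont_ext => [||v].
- by apply: (cont_comp cs); apply: contMl; exact: cont_id.
- by apply: contMl.
by rewrite -mono_cat !subst_mono /subst_word big_cat.
Qed.

Lemma substD f g : subst (f + g) a b = subst f a b + subst g a b.
Proof. exact: (cont_eqD subst_cont). Qed.
Lemma substN f : subst (- f) a b = - subst f a b.
Proof. exact: (cont_eqN subst_cont). Qed.
Lemma substB f g : subst (f - g) a b = subst f a b - subst g a b.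
Proof. exact: (cont_eqB subst_cont). Qed.
Lemma substZ c f : subst (c *: f) a b = c *: subst f a b.
Proof. exact: (cont_eqZ subst_cont). Qed.
Lemma subst0 : subst 0 a b = 0.
Proof. exact: (cont_eq0 subst_cont). Qed.
Lemma subst_lie f g : subst (lie f g) a b = lie (subst f a b) (subst g a b).
Proof. by rewrite /lie substB !substM. Qed.

Lemma subst_nil f : subst f a b [::] = f [::].
Proof.
rewrite [in LHS](decompR f) !substD substZ subst1 !substM subst_x0 subst_x1.
by rewrite !seriesDE seriesZE !mul_nil a0 b0 !mul0r !addr0 mulr1.
Qed.

End Subst.

Lemma morphism_ext (s t : A -> A) : cont s -> cont t ->
  s 1 = t 1 -> (forall f g, s (f * g) = s f * s g) ->
  (forall f g, t (f * g) = t f * t g) -> s x0 = t x0 -> s x1 = t x1 -> s =1 t.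
Proof.
move=> cs ct s1 sM tM sx0 sx1; apply: cont_ext => //.
elim=> [|l w IHw]; first by rewrite mono_nil.
by rewrite mono_cons sM tM IHw; case: l; rewrite ?sx0 ?sx1.
Qed.

Lemma derivation_ext (s T T' : A -> A) : cont T -> cont T' -> T 1 = T' 1 ->
  (forall f g, T (f * g) = T f * s g + s f * T g) ->
  (forall f g, T' (f * g) = T' f * s g + s f * T' g) ->
  T x0 = T' x0 -> T x1 = T' x1 -> T =1 T'.
Proof.
move=> cT cT' T1 TM TM' Tx0 Tx1; apply: cont_ext => //.
by apply: leibniz_ext T1 TM TM' _ => -[].
Qed.

(** ** Derivations and substitutions of power series *)

Section PSubst.
Variables (a : A) (a0 : a [::] = 0).
Implicit Type r : nat -> k.

Lemma psubst_der d0 d1 r (c : A) : der d0 d1 a = lie a c ->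
  der d0 d1 (psubst r a) = lie (psubst r a) c.
Proof. by apply: psubst_leibniz => //; [exact: der_cont|exact: derM]. Qed.

Lemma psubst_subst r (b c : A) : b [::] = 0 -> c [::] = 0 -> 
  subst (psubst r a) b c = psubst r (subst a b c).
Proof.
move=> b0 c0; have s0 : subst a b c [::] = 0 by rewrite subst_nil.
have cs := subst_cont b0 c0; move: r; apply: psubst_ext.
- exact: (cont_comp cs (psubst_cont a0)).
- move=> w; have [l Hl] : finitary (fun r => \sum_(i < (size w).+1) (subst a b c ^+ i) w * r i).
    by apply: finitary_sum => i _; apply: finitaryZ; exact: finitary_eval.
  exists l => r; rewrite -Hl /psubst (fsbigE (iota 0 (size w).+1)) ?iota_uniq //.
    rewrite -(big_mkord xpredT (fun i => (subst a b c ^+ i) w * r i)) /index_iota subn0.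
    by apply: eq_big => [n|n _]; rewrite ?in_setT // mulrC.
  move=> n _; rewrite mem_iota => nw; apply/eqP; rewrite mulf_eq0 orbC.
  by case: eqP => // /eqP /(exp_low s0) H; rewrite add0n ltnS H in nw.
move=> n; rewrite psubst_dirac (_ : psubst _ (subst a b c) = subst a b c ^+ n); last first.
  by apply/funext => w; rewrite /psubst (fsbig_dirac (fun n w => (subst a b c ^+ n) w)).
by elim: n => [|n IHn]; rewrite ?expr0 ?subst1 // !exprS substM // IHn.
Qed.

End PSubst.

(** ** The reduced coaction *)

Fixpoint mu_word w : A :=
  if w is l :: v then
    var k l * mu_word v + (if v is m :: t then odot k l m * mono k t else 0)
  else 0.

Lemma muE : @mu k = clin mu_word.
Proof.
rewrite /mu; congr clin; apply/funext => w.
elim: w => [|l w IHw]; first by rewrite big_ord0.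
case: w IHw => [|m w] IHw; first by rewrite big_ord0 /= mulr0 addr0.
rewrite [size _]/= -pred_Sn big_ord_recl /= mono_nil mul1r drop0 addrC.
congr (_ + _); rewrite -[X in _ * X]/(mu_word (m :: w)) -IHw mulr_sumr.
by apply: eq_bigr => i _; rewrite mono_cons !mulrA.
Qed.

Lemma mu_word_low w v : mu_word w v != 0 -> (size w <= (size v).+1)%N.
Proof.
elim: w v => [|l w IHw] v /=; first by rewrite eqxx.
rewrite seriesDE => H.
have /orP[] : ((var k l * mu_word w) v != 0) || ((if w is m :: t then odot k l m * mono k t else 0) v != 0).
- by apply: contraNT H; rewrite negb_or !negbK => /andP[/eqP-> /eqP->]; rewrite addr0.
- case: v {H} => [|y v]; first by rewrite var_mul_nil eqxx.
  by rewrite var_mul_cons => H; apply: IHw; apply: contraNneq H => ->; rewrite mulr0.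
case: w {IHw H} => [|m w]; first by rewrite eqxx.
move=> /mul_neq0[u [t [-> Hu]]]; rewrite monoE; case: (t =P w) => [->|]; last by rewrite eqxx.
move=> _; rewrite size_cat /= !ltnS; case: u Hu => [|y u]; last by rewrite /= ltnS leq_addl.
by rewrite /odot; case: (l == m) => /=; rewrite eqxx.
Qed.

Lemma mu_cont : cont (@mu k).
Proof.
rewrite muE; apply: (clin_cont finite_wtb (n := fun v => (size v).+1)) => w v.
by rewrite weight_size; exact: mu_word_low.
Qed.

Lemma dR_cont l : cont (@dR k l).
Proof. exact: (cont_dR (T := fun f => f) _ (@cont_id _ _)). Qed.

Lemma dL_cont l : cont (@dL k l).
Proof. exact: (cont_dL (T := fun f => f) _ (@cont_id _ _)). Qed.

End Operators.

Ltac continuity := repeat first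
  [ exact: cont_id | exact: mu_cont | exact: der_cont | exact: dR_cont | exact: dL_cont
  | exact: cont0 | apply: contD | apply: contN | apply: contZ
  | apply: contMl | apply: contMr | apply: cont_dR | apply: cont_dL
  | apply: (cont_comp (@mu_cont _)) | apply: (cont_comp (der_cont _ _)) ].

Section Coaction.
Variable k : fieldType.

Notation A := (series bool k).
Notation x0 := (var k false : A).
Notation x1 := (var k true : A).

Implicit Types (f g : A) (l m : bool) (w : seq bool).

Lemma mu_mono w : mu (mono k w) = mu_word k w.
Proof. by rewrite muE clin_mono. Qed.

Lemma muD f g : mu (f + g) = mu f + mu g.
Proof. exact: (cont_eqD (@mu_cont k)). Qed.
Lemma muN f : mu (- f) = - mu f.
Proof. exact: (cont_eqN (@mu_cont k)). Qed.
Lemma muB f g : mu (f - g) = mu f - mu g.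
Proof. exact: (cont_eqB (@mu_cont k)). Qed.
Lemma muZ c f : mu (c *: f) = c *: mu f.
Proof. exact: (cont_eqZ (@mu_cont k)). Qed.

Lemma mu1 : mu (1 : A) = 0.
Proof. by rewrite -mono_nil mu_mono. Qed.

Lemma mu_varM l f : mu (var k l * f) = var k l * mu f + var k l * dR l f.
Proof.
move: f; apply: cont_ext => [||w].
- by continuity.
- by continuity.
rewrite -mono_cons !mu_mono /=; congr (_ + _).
case: w => [|m w]; first by rewrite mono_nil dR1 mulr0.
rewrite mono_cons dR_varM /odot; by case: (l == m); rewrite ?mul0r ?mulr0.
Qed.

Lemma mu_var l : mu (var k l) = 0.
Proof. by rewrite -[var k l]mulr1 mu_varM mu1 dR1 !mulr0 addr0. Qed.

(** The extra terms merge the last letter of [f] with the first one of [g]. *)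
Lemma muM f g : mu (f * g) = mu f * g + f * mu g +
  dL false f * x0 * dR false g + dL true f * x1 * dR true g.
Proof.
move: f; apply: cont_ext => [||w].
- by continuity.
- by continuity.
elim: w => [|l w IHw]; first by rewrite mono_nil mu1 !dL1 !mul1r; ncring.
rewrite mono_cons -[X in mu X]mulrA !mu_varM IHw dR_mul !dL_mul !dL_var.
have -> : mono k w [::] = (w == [::])%:R by rewrite monoE eq_sym.
case: eqP => [->|_]; rewrite ?mono_nil ?scale1r ?scale0r ?dL1 ?dR1.
  by case: l => /=; ncring.
by case: l => /=; ncring.
Qed.

Lemma mu_nil f : mu f [::] = 0.
Proof.
rewrite (decompR f) !muD muZ mu1 scaler0 !mu_varM !seriesDE.
by rewrite !var_mul_nil !addr0.
Qed.

Lemma mu_cons f l w : mu f (l :: w) = mu (dR l f) w + f (l :: l :: w).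
Proof.
rewrite [in LHS](decompR f) !muD muZ mu1 scaler0 !mu_varM !seriesDE !var_mul_cons.
by rewrite !addrA; case: l; rewrite /= !mul0r !mul1r ?addr0 !add0r.
Qed.

Lemma muE_sum f w : mu f w =
  \sum_(i < size w) f (take i w ++ nth false w i :: drop i w).
Proof.
elim: w f => [|l w IHw] f; first by rewrite big_ord0 mu_nil.
by rewrite mu_cons IHw big_ord_recl addrC.
Qed.

End Coaction.

(** * Lie series *)

Section LieSeries.
Variable k : fieldType.

Notation A := (series bool k).
Notation x0 := (var k false : A).
Notation x1 := (var k true : A).

Implicit Types (f g a b : A) (l : bool) (w : seq bool) (c : k).

Lemma homogD n f g : homog n (f + g) = homog n f + homog n g.
Proof.
by apply/funext => w; rewrite /homog !seriesDE; case: eqP; rewrite ?addr0.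
Qed.

Lemma homogZ n c f : homog n (c *: f) = c *: homog n f.
Proof.
by apply/funext => w; rewrite /homog !seriesZE; case: eqP; rewrite ?mulr0.
Qed.

Lemma homogN n f : homog n (- f) = - homog n f.
Proof. by rewrite -scaleN1r homogZ scaleN1r. Qed.

Lemma homogM n f g : homog n (f * g) =
  \sum_(i < n.+1) homog i f * homog (n - i) g.
Proof.
apply/funext => w; rewrite series_sumE.
case: (eqVneq (size w) n) => [Hw|Hw]; rewrite {1}/homog.
  rewrite Hw eqxx -[LHS]/(series_mul _ _ _) /series_mul Hw.
  apply: eq_bigr => i _; rewrite -[RHS]/(series_mul _ _ _) /series_mul Hw.
  have iw := leq_ord i; rewrite (bigD1 i) //= big1 => [|j ji].
    by rewrite /homog size_takel ?Hw // size_drop Hw !eqxx addr0.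
  have jw := leq_ord j; rewrite /homog size_takel ?Hw //.
  by case: eqP => [E|_]; rewrite ?mul0r //; case/eqP: ji; apply: val_inj.
rewrite (negPf Hw) big1 // => i _; apply: big1 => j _.
have jw := leq_ord j; rewrite /homog size_takel // size_drop.
case: eqP => [E|]; last by rewrite mul0r.
case: eqP => [E'|]; last by rewrite mulr0.
have jn : (j <= n)%N by rewrite E leq_ord.
by case/eqP: Hw; rewrite -(subnKC jw) E' -E subnKC.
Qed.

Lemma lie_poly0 : lie_poly (0 : A).
Proof. by rewrite -(scale0r x0); apply: lie_poly_scale; exact: lie_poly_var. Qed.

Lemma lie_polyN f : lie_poly f -> lie_poly (- f).
Proof. by rewrite -scaleN1r; exact: lie_poly_scale. Qed.

Lemma lie_poly_sum (I : Type) (r : seq I) (P : pred I) (F : I -> A) :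
  (forall i, P i -> lie_poly (F i)) -> lie_poly (\sum_(i <- r | P i) F i).
Proof.
by move=> HF; elim/big_ind: _ => //; [exact: lie_poly0|exact: lie_poly_add].
Qed.

Lemma fr0 : fr (0 : A).
Proof.
move=> n; have -> : homog n (0 : A) = 0 by apply/funext => w; rewrite /homog; case: eqP.
exact: lie_poly0.
Qed.

Lemma frD f g : fr f -> fr g -> fr (f + g).
Proof. by move=> Hf Hg n; rewrite homogD; apply: lie_poly_add. Qed.

Lemma frZ c f : fr f -> fr (c *: f).
Proof. by move=> Hf n; rewrite homogZ; apply: lie_poly_scale. Qed.

Lemma frN f : fr f -> fr (- f).
Proof. by rewrite -scaleN1r; exact: frZ. Qed.

Lemma frB f g : fr f -> fr g -> fr (f - g).
Proof. by move=> Hf Hg; apply: frD => //; apply: frN. Qed.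

Lemma fr_var l : fr (var k l).
Proof.
move=> n; case: (eqVneq n 1%N) => [->|n1].
  have -> : homog 1 (var k l) = var k l; last exact: lie_poly_var.
  apply/funext => w; rewrite /homog; case: eqP => // w1.
  by rewrite /var; case: (w =P _) w1 => // ->.
have -> : homog n (var k l) = 0; last exact: lie_poly0.
apply/funext => w; rewrite /homog; case: eqP => // wn.
by rewrite /var; case: (w =P _) => // E; rewrite -wn E eqxx in n1.
Qed.

Lemma fr_lie f g : fr f -> fr g -> fr (lie f g).
Proof.
move=> Hf Hg n; rewrite /lie homogD homogN !homogM.
rewrite [X in _ - X](reindex_inj rev_ord_inj) -sumrB.
apply: lie_poly_sum => i _ /=; rewrite subSS subKn ?leq_ord //.
exact: lie_poly_lie.
Qed.

Lemma lie_poly_fr f : lie_poly f -> fr f.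
Proof.
elim=> [l|? ? _ ? _ ?|? ? _ ?|? ? _ ? _ ?].
- exact: fr_var.
- exact: frD.
- exact: frZ.
- exact: fr_lie.
Qed.

(** Every coefficient of a Lie series is one of a Lie polynomial, so that
    coefficientwise identities follow by induction on [lie_poly]. *)
Lemma fr_approx n f : fr f -> exists2 p, lie_poly p & agree n f p.
Proof.
move=> Hf; exists (\sum_(i < n.+1) homog i f).
  by apply: lie_poly_sum => i _; exact: Hf.
move=> w wn; rewrite series_sumE.
rewrite (bigD1 (Ordinal (wn : size w < n.+1)%N)) //= {1}/homog eqxx big1 ?addr0 // => i iw.
by rewrite /homog; case: eqP => // E; case/eqP: iw; apply: val_inj.
Qed.

Lemma agree_homog n f g : agree n f g -> homog n f = homog n g.
Proof.
by move=> fg; apply/funext => w; rewrite /homog; case: eqP => // E; rewrite fg ?E.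
Qed.

Lemma agree_eq f g : (forall n, agree n f g) -> f = g.
Proof. by move=> fg; apply/funext => w; exact: (fg (size w)). Qed.

Lemma lie_nil f g : lie f g [::] = 0.
Proof. by rewrite /lie seriesBE !mul_nil mulrC subrr. Qed.

Lemma lie_poly_nil f : lie_poly f -> f [::] = 0.
Proof.
elim=> [l|f' g _ f0 _ g0|c f' _ f0|f' g _ _ _ _] //.
- by rewrite seriesDE f0 g0 addr0.
- by rewrite seriesZE f0 mulr0.
- exact: lie_nil.
Qed.

Lemma fr_nil f : fr f -> f [::] = 0.
Proof. by move=> /(@fr_approx 0)[p /lie_poly_nil p0 ->]. Qed.

Lemma fr_der a b f : fr a -> fr b -> fr f -> fr (der a b f).
Proof.
move=> Ha Hb Hf n; have [p Hp fp] := fr_approx n Hf.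
have a0 := fr_nil Ha; have b0 := fr_nil Hb.
rewrite (agree_homog (der_agree a0 b0 fp)).
suff : fr (der a b p) by [].
elim: Hp => [l|? ? _ ? _ ?|? ? _ ?|? ? Hf' ? Hg' ?].
- by case: l; rewrite ?der_x0 ?der_x1.
- by rewrite derD; apply: frD.
- by rewrite derZ; apply: frZ.
- by rewrite der_lie; apply: frD; apply: fr_lie => //; exact: lie_poly_fr.
Qed.

Lemma subst_word_homog a b w v : homog 1 a = a -> homog 1 b = b ->
  subst_word a b w v != 0 -> size v = size w.
Proof.
move=> a1 b1; elim: w v => [|l w IHw] v.
  by rewrite /subst_word big_nil; case: v => // y v; rewrite eqxx.
rewrite /subst_word big_cons => /mul_neq0[u [t [-> Hu /IHw tw]]].
rewrite size_cat tw /=; suff -> : size u = 1%N by [].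
by case: l Hu => Hu; [rewrite -b1 in Hu|rewrite -a1 in Hu]; move: Hu;
  rewrite /homog; case: (size u =P 1%N); rewrite ?eqxx.
Qed.

Lemma homog_subst a b n f : homog 1 a = a -> homog 1 b = b ->
  homog n (subst f a b) = subst (homog n f) a b.
Proof.
move=> a1 b1; apply/funext => v; rewrite /homog; case: eqP => [vn|vn].
  apply: eq_fsbigr => w _; have := @subst_word_homog a b w v a1 b1.
  rewrite -/(subst_word a b w); case: (eqVneq (subst_word a b w v) 0) => [->|_ H].
    by rewrite !mulr0.
  by rewrite -(H isT) vn eqxx.
symmetry; rewrite /subst /clin; apply: fsbig1 => w _.
have := @subst_word_homog a b w v a1 b1; rewrite -/(subst_word a b w).
case: (eqVneq (subst_word a b w v) 0) => [->|_ H]; first by rewrite !mulr0.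
by rewrite -(H isT); move/eqP/negPf: vn => ->; rewrite mul0r.
Qed.

Lemma fr_subst a b f : lie_poly a -> lie_poly b -> homog 1 a = a -> homog 1 b = b ->
  fr f -> fr (subst f a b).
Proof.
move=> Ha Hb a1 b1 Hf n; rewrite homog_subst //.
have a0 := lie_poly_nil Ha; have b0 := lie_poly_nil Hb.
elim: (Hf n) => [l|? ? _ ? _ ?|? ? _ ?|? ? _ ? _ ?].
- by case: l; rewrite ?subst_x0 ?subst_x1.
- by rewrite substD //; apply: lie_poly_add.
- by rewrite substZ //; apply: lie_poly_scale.
- by rewrite subst_lie //; apply: lie_poly_lie.
Qed.

(** A derivation with constant values on the letters maps brackets to 0. In terms
    of coefficients ([fr_insert]) these are the shuffle relations with one letter. *)
Lemma lie_poly_der1 (b : bool) f : lie_poly f ->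
  exists c, der (if b then 0 else 1) (if b then 1 else 0) f = c *: (1 : A).
Proof.
set d := der _ _; elim=> [l|f' g _ [c Hc] _ [c' Hc']|c f' _ [c' Hc']|f' g _ [c Hc] _ [c' Hc']].
- exists (l == b)%:R; rewrite /d; case: l; rewrite ?der_x0 ?der_x1; case: b {d};
  by rewrite ?scale1r ?scale0r.
- by exists (c + c'); rewrite /d derD -/d Hc Hc' scalerDl.
- by exists (c * c'); rewrite /d derZ -/d Hc' scalerA.
- exists 0; rewrite /d der_lie -/d Hc Hc' /lie !scale_mul !mul_scale.
  by rewrite !mul1r !mulr1 !subrr scale0r addr0.
Qed.

Lemma fr_der1 (b : bool) f : fr f -> f [:: b] = 0 ->
  der (if b then 0 else 1) (if b then 1 else 0) f = 0.
Proof.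
move=> Hf fb; set d := der _ _.
have d1 : d f [::] = f [:: b].
  rewrite /d (@der_agreeS k _ _ 0 _ (f [:: false] *: x0 + f [:: true] *: x1)) //.
    rewrite derD !derZ der_x0 der_x1; case: b {fb d} => /=;
    rewrite seriesDE !seriesZE ?one_nil ?series0E ?mulr0 ?mulr1 ?add0r ?addr0 //.
  case=> [_|[|] []] //; rewrite seriesDE !seriesZE /var /= ?(fr_nil Hf);
  by rewrite ?mulr0 ?mulr1 ?add0r ?addr0.
apply: agree_eq => n w wn; have [p Hp fp] := fr_approx n.+1 Hf.
have [c Hc] := lie_poly_der1 b Hp.
have Hw v : (size v <= n)%N -> d f v = (c *: (1 : A)) v.
  by move=> vn; rewrite /d (der_agreeS _ _ fp) // Hc.
have c0 : c = 0.
  have := Hw [::] isT; rewrite d1 fb seriesZE one_nil mulr1.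
  by move=> <-.
by rewrite Hw // c0 scale0r.
Qed.

(** ** The antipode *)

(** The antipode of the Hopf algebra of words; it is an antiautomorphism and
    hence acts as -1 on all brackets as soon as it does so on the letters. *)
Definition antipode f : A := fun w => (-1) ^+ size w * f (rev w).

Lemma antipode_cont : cont antipode.
Proof. by move=> w; apply: finitaryZ; exact: finitary_eval. Qed.

Lemma antipodeD f g : antipode (f + g) = antipode f + antipode g.
Proof. exact: (cont_eqD antipode_cont). Qed.
Lemma antipodeN f : antipode (- f) = - antipode f.
Proof. exact: (cont_eqN antipode_cont). Qed.
Lemma antipodeZ c f : antipode (c *: f) = c *: antipode f.
Proof. exact: (cont_eqZ antipode_cont). Qed.

Lemma antipodeM f g : antipode (f * g) = antipode g * antipode f.
Proof.
apply/funext => w; rewrite /antipode -[f * g]/(series_mul f g).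
rewrite -[RHS]/(series_mul _ _ _) /series_mul size_rev mulr_sumr.
rewrite (reindex_inj rev_ord_inj); apply: eq_bigr => -[i Hi] _ /=.
rewrite ltnS in Hi; rewrite subSS take_rev drop_rev subKn // mulrACA -exprD.
by rewrite size_takel // size_drop subnKC // (mulrC (f _)).
Qed.

Lemma antipode_var l : antipode (var k l) = - var k l.
Proof.
apply/funext => -[|m [|n w]]; rewrite /antipode seriesNE /var.
- by rewrite mulr0 oppr0.
- by rewrite mulN1r.
rewrite rev_cons [RHS]/= [_ == _ :> seq _](_ : _ = false) ?mulr0 ?oppr0.
  by rewrite eqseq_cons andbF oppr0.
by apply/eqP => /(congr1 size); rewrite size_rcons size_rev.
Qed.

Lemma fr_antipode f : fr f -> antipode f = - f.
Proof.
move=> Hf; apply: agree_eq => n w wn; have [p Hp fp] := fr_approx n Hf.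
have {Hp} Sp : antipode p = - p.
  elim: Hp => [l|f' g _ Hf' _ Hg|c f' _ Hf'|f' g _ Hf' _ Hg].
  - exact: antipode_var.
  - by rewrite antipodeD Hf' Hg opprD.
  - by rewrite antipodeZ Hf' scalerN.
  - by rewrite /lie antipodeD antipodeN !antipodeM Hf' Hg; ncring.
by rewrite seriesNE fp // -seriesNE -Sp /antipode fp ?size_rev.
Qed.

End LieSeries.

(** * The Ihara bracket *)

Section Ihara.
Variable k : fieldType.

Notation A := (series bool k).
Notation x0 := (var k false : A).
Notation x1 := (var k true : A).

Implicit Types (f g a b x y z : A) (l : bool) (w : seq bool) (c : k).

Lemma der_lin c a b a' b' f :
  der (c *: a + a') (c *: b + b') f = c *: der a b f + der a' b' f.
Proof.
move: f; apply: (derivation_ext (s := fun f => f)) => [|||f g|f g||].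
- exact: der_cont.
- by continuity.
- by rewrite !der1 scaler0 addr0.
- exact: derM.
- by rewrite !derM scalerDr -scale_mul -mul_scale; ncring.
- by rewrite !der_x0.
- by rewrite !der_x1.
Qed.

Lemma lie_linl c a b f : lie (c *: a + b) f = c *: lie a f + lie b f.
Proof. by rewrite /lie scalerBr -scale_mul -mul_scale; ncring. Qed.

Lemma lie_linr c a b f : lie f (c *: a + b) = c *: lie f a + lie f b.
Proof. by rewrite /lie scalerBr -mul_scale -scale_mul; ncring. Qed.

Lemma der_ihara_lin c a b f :
  der_ihara (c *: a + b) f = c *: der_ihara a f + der_ihara b f.
Proof. by rewrite /der_ihara -der_lin scaler0 addr0 lie_linr. Qed.

Lemma ihara_linl c a b f : ihara (c *: a + b) f = c *: ihara a f + ihara b f.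
Proof.
rewrite /ihara der_ihara_lin lie_linl /der_ihara derD derZ !scalerBr.
by ncring.
Qed.

Lemma ihara_alt a : ihara a a = 0.
Proof. by rewrite /ihara; ncring. Qed.

Lemma ihara_anti a b : ihara a b = - ihara b a.
Proof. by rewrite /ihara; ncring. Qed.

Lemma ihara_linr c a b f : ihara f (c *: a + b) = c *: ihara f a + ihara f b.
Proof.
by rewrite ihara_anti ihara_linl opprD -scalerN -!(ihara_anti f).
Qed.

(** The Ihara bracket is the commutator of the derivations d_psi, whence the
    Jacobi identity. *)
Lemma der_ihara_ihara a b f : der_ihara (ihara a b) f =
  der_ihara b (der_ihara a f) - der_ihara a (der_ihara b f).
Proof.
move: f; apply: (derivation_ext (s := fun f => f)) => [|||f g|f g||]; rewrite /der_ihara.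
- exact: der_cont.
- by continuity.
- by rewrite !der1 !der0 subrr.
- exact: derM.
- by rewrite !derM !derD !derM; ncring.
- by rewrite !der_x0 !der0 subrr.
- by rewrite !der_x1 !der_lie !der_x1 /ihara /der_ihara; ncring.
Qed.

Lemma ihara_jacobi a b f :
  ihara a (ihara b f) + ihara b (ihara f a) + ihara f (ihara a b) = 0.
Proof.
have E x y : ihara x y = der_ihara y x - der_ihara x y - lie x y by [].
rewrite !(E _ (ihara _ _)) !der_ihara_ihara /ihara /der_ihara /lie !derB !derM.
by ncring.
Qed.

Lemma ihara_lie_algebra (S : set A) : S 0 ->
  (forall c x y, S x -> S y -> S (c *: x + y)) ->
  (forall x y, S x -> S y -> S (ihara x y)) -> lie_algebra_on S (@ihara k).
Proof.
move=> S0 Slin Sbr; split=> // *.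
- exact: ihara_linl.
- exact: ihara_linr.
- exact: ihara_alt.
- exact: ihara_jacobi.
Qed.

(** ** Depth *)

(** With respect to the letter [l]; the depth of a series is the case [l = true]. *)
Definition vanish l n f := forall w, (count_mem l w < n)%N -> f w = 0.

Lemma vanish0 l f : vanish l 0 f.
Proof. by []. Qed.

Arguments vanish0 l f : clear implicits.

Lemma vanishD l n f g : vanish l n f -> vanish l n g -> vanish l n (f + g).
Proof. by move=> Hf Hg w wn; rewrite seriesDE Hf // Hg // addr0. Qed.

Lemma vanishN l n f : vanish l n f -> vanish l n (- f).
Proof. by move=> Hf w wn; rewrite seriesNE Hf // oppr0. Qed.

Lemma vanishM l n m f g : vanish l n f -> vanish l m g -> vanish l (n + m) (f * g).
Proof.
move=> Hf Hg w wn; case: (eqVneq ((f * g) w) 0) => // /mul_neq0[u [v [wuv fu gv]]].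
move: wn; rewrite wuv count_cat; case: (ltnP (count_mem l u) n) => [/Hf E|nu].
  by rewrite E eqxx in fu.
case: (ltnP (count_mem l v) m) => [/Hg E|mv]; first by rewrite E eqxx in gv.
by rewrite ltnNge leq_add.
Qed.

Lemma vanish_var l : vanish l 1 (var k l).
Proof.
move=> w wl; rewrite /var; case: (w =P _) => // E.
by rewrite E /= eqxx in wl.
Qed.

Lemma vanish_lie l n m f g : vanish l n f -> vanish l m g -> vanish l (n + m) (lie f g).
Proof.
move=> Hf Hg; apply: vanishD; first exact: vanishM.
by apply: vanishN; rewrite addnC; exact: vanishM.
Qed.

Lemma vanish_der l n a b f : vanish l n a -> vanish l n b -> vanish l n (der a b f).
Proof.
move=> Ha Hb w wn; rewrite derE; apply: fsbig1 => v _ /=.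
suff H : vanish l n (leibniz (fun l => if l then b else a) v) by rewrite H ?mulr0.
elim: v => [|m v IHv] /=.
  by [].
apply: vanishD; last by move: (vanishM (vanish0 l (var k m)) IHv).
by rewrite -[n]addn0; apply: vanishM; [case: m|exact: vanish0].
Qed.

Lemma subst_pure l f : subst f (if l then 0 else x0) (if l then x1 else 0) =
  (fun w => if (~~ l) \in w then 0 else f w).
Proof.
set a := if l then _ else _; set b := (X in subst _ _ X).
have a0 : a [::] = 0 by rewrite /a; case: l {a b}.
have b0 : b [::] = 0 by rewrite /b; case: l {a a0 b}.
move: f; apply: cont_ext => [||w].
- exact: subst_cont.
- by move=> w; case: (~~ l \in w); [exact: finitary0|exact: finitary_eval].
rewrite subst_mono; apply/funext => v; rewrite monoE.
have -> : subst_word a b w = if (~~ l) \in w then 0 else mono k w.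
  elim: w => [|m w IHw]; first by rewrite mono_nil /subst_word big_nil.
  rewrite /subst_word big_cons -/(subst_word a b w) IHw inE /a /b mono_cons.
  by case: l {a b a0 b0 IHw}; case: m => /=; rewrite ?mul0r //; case: ifP; rewrite ?mulr0.
case: (eqVneq v w) => [->|vw]; first by case: ifP => // _; rewrite monoE eqxx.
by case: ifP => _; rewrite ?monoE ?(negPf vw) //; case: ifP.
Qed.

Lemma fr_gt1P f : fr_gt1 f <-> [/\ fr f, vanish true 1 f & vanish false 1 f].
Proof.
have Hl l : vanish l 1 f <-> (fun w => if l \in w then 0 else f w) = 0 :> A.
  split=> [Hf|Hf w].
    apply/funext => w; case: ifP => // /negbT wl; apply: Hf.
    by rewrite ltnS leqn0; apply/eqP/count_memPn.
  rewrite ltnS leqn0 => /eqP/count_memPn /negPf wl.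
  by have := congr1 (fun g : A => g w) Hf; rewrite /= wl.
have E0 := subst_pure false f; have E1 := subst_pure true f.
by split=> -[Hf H0 H1]; split=> //; move: H0 H1;
  rewrite ?E0 ?E1 /= => H0 H1; apply/Hl.
Qed.

Lemma fr_gt1_ihara f g : fr_gt1 f -> fr_gt1 g -> fr_gt1 (ihara f g).
Proof.
move=> /fr_gt1P[Ff Tf Ff'] /fr_gt1P[Fg Tg Fg'].
have Fd a b : fr a -> fr b -> fr (der_ihara a b).
  by move=> Ha Hb; apply: fr_der Hb; [exact: fr0|apply: fr_lie => //; exact: fr_var].
have V l a b : vanish l 1 a -> vanish l 1 (der_ihara a b).
  by move=> Ha; apply: vanish_der => //; exact: (vanish_lie (vanish0 l x1) Ha).
apply/fr_gt1P; split.
- by apply: frB; [apply: frB; exact: Fd|exact: fr_lie].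
- apply: vanishD; first by apply: vanishD; [exact: V|apply: vanishN; exact: V].
  by apply: vanishN; exact: (vanish_lie (vanish0 _ f) Tg).
- apply: vanishD; first by apply: vanishD; [exact: V|apply: vanishN; exact: V].
  by apply: vanishN; exact: (vanish_lie (vanish0 _ f) Fg').
Qed.

Lemma vanish_ihara f g : vanish true 1 f -> vanish true 1 g -> vanish true 2 (ihara f g).
Proof.
move=> Hf Hg; have V a b : vanish true 1 a -> vanish true 2 (der_ihara a b).
  by move=> Ha; apply: vanish_der => //; exact: vanish_lie (@vanish_var true) Ha.
apply: vanishD; first by apply: vanishD; [exact: V|apply: vanishN; exact: V].
by apply: vanishN; exact: vanish_lie Hf Hg.
Qed.

Lemma fr_gt1_lin c f g : fr_gt1 f -> fr_gt1 g -> fr_gt1 (c *: f + g).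
Proof.
move=> /fr_gt1P[Ff Tf Ff'] /fr_gt1P[Fg Tg Fg']; apply/fr_gt1P; split.
- by apply: frD => //; apply: frZ.
- by move=> w Hw; rewrite seriesDE seriesZE Tf // Tg // mulr0 addr0.
- by move=> w Hw; rewrite seriesDE seriesZE Ff' // Fg' // mulr0 addr0.
Qed.

Lemma fr_gt1_0 : fr_gt1 (0 : A).
Proof. by apply/fr_gt1P; split=> //; exact: fr0. Qed.

(** ** Skew-symmetric series *)

Lemma subst_id f : subst f x0 x1 = f.
Proof.
have cs := @subst_cont k x0 x1 erefl erefl; move: f; apply: morphism_ext => //.
- exact: cont_id.
- by rewrite subst1.
- by move=> f g; rewrite substM.
- by rewrite subst_x0.
- by rewrite subst_x1.
Qed.

Lemma Skew_lin c f g : Skew f -> Skew g -> Skew (c *: f + g).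
Proof.
rewrite /Skew /= !subst_id => -[Ff Sf] [Fg Sg]; split; first exact: fr_gt1_lin.
by rewrite {1}Sf {1}Sg substD // substZ // opprD scalerN.
Qed.

Lemma Skew0 : Skew (0 : A).
Proof. by split; [exact: fr_gt1_0|rewrite !subst0 // oppr0]. Qed.

(** The exchange of the letters conjugates d_psi to d_psi + ad psi; the additional
    terms fit together in the Ihara bracket. *)
Lemma swap_der_ihara psi f : subst psi x1 x0 = - psi ->
  subst (der_ihara psi f) x1 x0 =
  der_ihara psi (subst f x1 x0) + lie psi (subst f x1 x0).
Proof.
have cs := @subst_cont k x1 x0 erefl erefl => Spsi.
move: f; apply: (derivation_ext (s := fun f => subst f x1 x0)) => [|||f g|f g||];
  rewrite /der_ihara.
- exact: (cont_comp cs (der_cont _ _)).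
- apply: contD; first exact: (cont_comp (der_cont _ _) cs).
  by apply: contD; [exact: contMl|apply: contN; exact: contMr].
- by rewrite subst1 !der1 subst0 //; ncring.
- by rewrite derM substD // !substM.
- by rewrite substM // derM; ncring.
- by rewrite der_x0 subst0 // subst_x0 der_x1; ncring.
- by rewrite der_x1 subst_lie // !subst_x1 Spsi der_x0; ncring.
Qed.

Lemma Skew_ihara f g : Skew f -> Skew g -> Skew (ihara f g).
Proof.
rewrite /Skew /= !subst_id => -[Ff Sf] [Fg Sg]; split; first exact: fr_gt1_ihara.
have {}Sf : subst f x1 x0 = - f by rewrite {2}Sf opprK.
have {}Sg : subst g x1 x0 = - g by rewrite {2}Sg opprK.
rewrite /ihara !substB // !substM // !swap_der_ihara // Sf Sg /der_ihara !derN.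
by ncring.
Qed.

End Ihara.

(** * The coaction equation *)

Section CoactionEquation.
Variable k : fieldType.
Hypothesis char_k : [pchar k] =i pred0.

Notation A := (series bool k).
Notation x0 := (var k false : A).
Notation x1 := (var k true : A).

Implicit Types (f g a b psi phi : A) (l m : bool) (u v w : seq bool) (c : k).

Lemma char0_neq0 n : n.+1%:R != 0 :> k.
Proof. by rewrite ((pcharf0P _).1 char_k). Qed.

Lemma varN_nil l : (- var k l : A) [::] = 0.
Proof. by rewrite seriesNE oppr0. Qed.

(** The terms of the coaction equation that depend on all of [psi]. *)
Definition coact f : A := mu f + dL false f + dR true f.

Definition coact_rhs (r : nat -> k) : A := - psubst r x1 + psubst r (- x0).

Lemma coaction_eqP psi : coaction_eq psi <-> coact psi = coact_rhs (rser psi).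
Proof.
rewrite /coaction_eq /coact /coact_rhs; split=> [->|E]; first by ncring.
by rewrite -E; ncring.
Qed.

(** The defect of the symmetry d^R_1 - d^R_0 = d^L_1 - d^L_0. *)
Definition kappa f : A := dR true f - dR false f - dL true f + dL false f.

(** ** Compatibility with the antipode *)

Lemma antipode_dR l f : antipode (dR l f) = - dL l (antipode f).
Proof.
apply/funext => w; rewrite seriesNE /antipode /dR /dL size_rcons rev_rcons.
by rewrite exprS mulN1r mulNr opprK.
Qed.

Lemma antipode_dL l f : antipode (dL l f) = - dR l (antipode f).
Proof.
apply/funext => w; rewrite seriesNE /antipode /dR /dL /= rev_cons.
by rewrite exprS mulN1r mulNr opprK.
Qed.

Lemma antipode_mu f : antipode (mu f) = - mu (antipode f).
Proof.
have cS := @antipode_cont k; move: f; apply: cont_ext => [||w].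
- exact: (cont_comp cS (@mu_cont k)).
- by apply: contN; exact: (cont_comp (@mu_cont k) cS).
elim: w => [|l w IHw].
  have -> : antipode (mono k ([::] : seq bool)) = 1.
    apply/funext => w; rewrite mono_nil /antipode; case: w => [|m w].
      by rewrite mul1r.
    by rewrite rev_cons; case: (rev w) => *; rewrite mulr0.
  by rewrite mono_nil !mu1 (cont_eq0 cS) oppr0.
rewrite mono_cons mu_varM antipodeD !antipodeM IHw antipode_dR antipode_var.
rewrite muM muN mu_var !dRN !dR_var.
by case: l => /=; ncring.
Qed.

Lemma antipode_psubst r a : a [::] = 0 ->
  antipode (psubst r a) = psubst r (antipode a).
Proof.
move=> a0; have Sa0 : antipode a [::] = 0 by rewrite /antipode a0 mulr0.
have cS := @antipode_cont k; move: r; apply: psubst_ext => [||n].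
- exact: (cont_comp cS (psubst_cont a0)).
- exact: psubst_cont.
rewrite !psubst_dirac; elim: n => [|n IHn]; last by rewrite exprS exprSr antipodeM IHn.
apply/funext => w; rewrite !expr0 /antipode; case: w => [|m w]; first by rewrite mul1r.
by rewrite rev_cons; case: (rev w) => *; rewrite mulr0.
Qed.

Lemma psubst_opp r a : a [::] = 0 ->
  psubst r (- a) = psubst (fun n => (-1) ^+ n * r n) a.
Proof.
move=> a0; have Na0 : (- a) [::] = 0 by rewrite seriesNE a0 oppr0.
move: r; apply: psubst_ext => [||n].
- exact: psubst_cont.
- apply: (cont_comp (psubst_cont a0)) => n.
  by apply: finitaryZ; exact: finitary_eval.
rewrite psubst_dirac.
have -> : (fun m : nat => (-1) ^+ m * (m == n)%:R) =
    (fun m : nat => (-1) ^+ n * (m == n)%:R + (fun=> 0) m) :> (nat -> k).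
  by apply/funext => m; rewrite addr0; case: eqP => [->|]; rewrite ?mulr0.
rewrite psubst_lin // psubst_dirac psubst_zero // addr0.
elim: n => [|n IHn]; first by rewrite !expr0 scale1r.
by rewrite !exprS IHn !mulNr mul1r scaleNr mul_scale.
Qed.

(** The antipode exchanges the left and right derivatives of a Lie series and
    preserves [mu psi], so that [mu psi] cancels between the equation and its
    image. *)
Lemma kappa_coaction psi : fr psi -> coaction_eq psi ->
  kappa psi = coact_rhs (rser psi) - antipode (coact_rhs (rser psi)).
Proof.
move=> /fr_antipode Spsi /coaction_eqP E; rewrite -E /coact /kappa.
rewrite !antipodeD antipode_mu antipode_dL antipode_dR Spsi muN !dRN !dLN.
by ncring.
Qed.

Lemma psubst_pure r a l : (forall w, l \in w -> a w = 0) ->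
  forall w, l \in w -> psubst r a w = 0.
Proof.
move=> Ha w lw; apply: fsbig1 => n _ /=; suff -> : (a ^+ n) w = 0 by rewrite mulr0.
elim: n w lw => [|n IHn] w lw; first by rewrite expr0; case: w lw.
rewrite exprS; case: (eqVneq ((a * a ^+ n) w) 0) => // /mul_neq0[u [v [wuv au av]]].
move: lw; rewrite wuv mem_cat => /orP[/Ha E|/IHn E]; first by rewrite E eqxx in au.
by rewrite E eqxx in av.
Qed.

Lemma kappa_mixed psi w : fr psi -> coaction_eq psi ->
  false \in w -> true \in w -> kappa psi w = 0.
Proof.
move=> Fpsi Cpsi w0 w1; rewrite kappa_coaction // /coact_rhs.
rewrite antipodeD antipodeN !antipode_psubst ?varN_nil // antipodeN !antipode_var.
rewrite !opprK !(seriesDE, seriesNE).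
have P (l m : bool) a : l != m -> a = var k l \/ a = - var k l -> m \in w ->
    psubst (rser psi) a w = 0.
  move=> lm Ea; apply: psubst_pure => v mv.
  have E : var k l v = 0 by rewrite /var; case: (v =P _) mv => // ->; rewrite inE eq_sym (negPf lm).
  by case: Ea => ->; rewrite ?seriesNE E ?oppr0.
rewrite (P true false x1) ?(P false true x0) ?(P false true (- x0)) ?(P true false (- x1)) //; auto.
by rewrite !(oppr0, addr0).
Qed.

Lemma der_insert (b : bool) f w :
  der (if b then 0 else 1) (if b then 1 else 0) f w =
  \sum_(i < (size w).+1) f (take i w ++ b :: drop i w).
Proof.
set d := der _ _.
have dE g : d g = dR b g + x0 * d (dR false g) + x1 * d (dR true g).
  rewrite [in LHS](decompR g) /d !derD derZ der1 scaler0 !derM der_x0 der_x1.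
  by case: b {d}; rewrite /=; ncring.
elim: w f => [|l w IHw] f; rewrite dE !seriesDE.
  by rewrite !var_mul_nil !addr0 big_ord1.
rewrite !var_mul_cons big_ord_recl -addrA /=; congr (_ + _).
transitivity (d (dR l f) w); last by rewrite IHw.
by case: l => /=; rewrite mul0r mul1r ?add0r ?addr0.
Qed.

Lemma fr_insert (b : bool) psi w : fr psi -> psi [:: b] = 0 ->
  \sum_(i < (size w).+1) psi (take i w ++ b :: drop i w) = 0.
Proof. by move=> F0 F1; rewrite -der_insert fr_der1. Qed.

Lemma fr_rev psi w : fr psi -> psi (rev w) = - (-1) ^+ size w * psi w.
Proof.
move=> /fr_antipode /(congr1 (fun f : A => f w)); rewrite /antipode seriesNE => E.
by rewrite mulNr -mulrN -E mulrA -expr2 sqrr_sign mul1r.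
Qed.

Notation O n := (nseq n false).

Lemma nseqSr n : O n.+1 = rcons (O n) false.
Proof. by rewrite -cats1 -(nseqD n 1) addn1. Qed.

(** Depth-one coefficients of even weight vanish. By [kappa_mixed] the symmetry
    [kappa psi = 0] is known at words with both letters. Summed over all words
    with a single x_1, it identifies the coefficient [c] at x_0^(p+1) x_1 with the
    one at x_0^p x_1 x_1, by means of shuffles with x_1. At the word x_0^p x_1
    it then becomes (p + 3) c = 0. *)
Lemma even_coeff psi p : fr psi -> coaction_eq psi ->
  psi [:: false] = 0 -> psi [:: true] = 0 -> (0 < p)%N -> ~~ odd p ->
  psi (rcons (O p.+1) true) = 0.
Proof.
move=> F C psi0 psi1 p0 podd; set c := psi _.
have K w : false \in w -> true \in w ->
    psi (true :: w) - psi (false :: w) - psi (rcons w true) + psi (rcons w false) = 0.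
  by move=> w0 w1; have := kappa_mixed F C w0 w1.
have R w : ~~ odd (size w) -> psi (rev w) = - psi w.
  by move=> ew; rewrite fr_rev // -signr_odd (negPf ew) expr0 mulN1r.
(* [L i], [D i.+1], [M i] and [D i] are the four terms of [kappa psi] at the
   word x_0^i x_1 x_0^(p-i). *)
pose D i := psi (O i ++ true :: O (p.+1 - i)).
pose L i := psi (true :: O i ++ true :: O (p - i)).
pose M i := psi (O i ++ true :: rcons (O (p - i)) true).
pose B := psi (O p ++ [:: true; true]).
have sumD : \sum_(i < p.+2) D i = 0.
  have := @fr_insert true psi (O p.+1) F psi1; rewrite size_nseq => E.
  rewrite -[RHS]E; apply: eq_bigr => i _; rewrite take_nseq ?leq_ord //.
  by rewrite drop_nseq.
have Dlast : D p.+1 = c by rewrite /D subnn cats1.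
have Dfirst : D 0 = - c.
  rewrite /D /c subn0 -R; last by rewrite size_rcons size_nseq /= negbK.
  by rewrite rev_rcons rev_nseq.
have sumM : \sum_(i < p.+1) M i = - B.
  have := @fr_insert true psi (rcons (O p) true) F psi1.
  rewrite size_rcons size_nseq big_ord_recr /= take_oversize ?size_rcons ?size_nseq //.
  rewrite drop_oversize ?size_rcons ?size_nseq // -cats1 -catA /= => /eqP.
  rewrite addr_eq0 => /eqP <-; apply: eq_bigr => i _ /=.
  rewrite takel_cat ?size_nseq ?leq_ord // take_nseq ?leq_ord // drop_cat size_nseq.
  rewrite /M; case: ltnP => [ip|pi]; first by rewrite drop_nseq cats1.
  have -> : nat_of_ord i = p by apply/eqP; rewrite eqn_leq pi leq_ord.
  by rewrite subnn drop0.
have sumL : \sum_(i < p.+1) L i = B.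
  have := @fr_insert true psi (true :: O p) F psi1.
  rewrite /= size_nseq big_ord_recl /= => /eqP; rewrite addrC addr_eq0 => /eqP E.
  have -> : B = - psi [:: true, true & O p].
    rewrite /B -R ?rev_cat ?rev_nseq //= ?size_nseq ?negbK //.
    by rewrite !rev_cons rev_nseq -!cats1 -catA.
  rewrite -E; apply: eq_bigr => i _; rewrite /L /= take_nseq ?leq_ord // drop_nseq.
  by [].
have BC : B = c.
  have : \sum_(i < p.+1) (L i - D i.+1 - M i + D i) = 0.
    apply: big1 => i _; have := K (O i ++ true :: O (p - i)).
    rewrite rcons_cat /= rcons_cat /=.
    have -> : false :: O i ++ true :: O (p - i) = O i.+1 ++ true :: O (p.+1 - i.+1) by [].
    have -> : rcons (O (p - i)) false = O (p.+1 - i).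
      by rewrite subSn ?leq_ord // nseqSr.
    apply; last by rewrite mem_cat inE eqxx orbT.
    rewrite mem_cat inE /= !mem_nseq eqxx !andbT lt0n lt0n subn_eq0 -ltnNge.
    by case: (nat_of_ord i) p0 => [->|//].
  rewrite big_split !sumrB /= sumL sumM => E.
  have S1 : \sum_(i < p.+1) D i.+1 = c.
    by move/eqP: sumD; rewrite big_ord_recl Dfirst addrC subr_eq0 => /eqP.
  have S2 : \sum_(i < p.+1) D i = - c.
    by move/eqP: sumD; rewrite big_ord_recr /= Dlast addr_eq0 => /eqP.
  rewrite S1 S2 in E; have {}E : (B - c) *+ 2 = 0 by rewrite -[RHS]E mulr2n; ring.
  apply/eqP; rewrite -subr_eq0; move/eqP: E; rewrite -mulr_natl mulf_eq0.
  by rewrite (negPf (char0_neq0 1)).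
(* From here on, [kappa psi] is taken at the word x_0^p x_1. *)
have w0 : false \in rcons (O p) true by rewrite mem_rcons inE mem_nseq p0.
have w1 : true \in rcons (O p) true by rewrite mem_rcons inE.
have := K _ w0 w1.
have -> : psi (true :: rcons (O p) true) = 0.
  have := R (true :: rcons (O p) true); rewrite /= size_rcons size_nseq /= negbK.
  rewrite rev_cons rev_rcons rev_nseq => /(_ podd) /eqP.
  by rewrite -addr_eq0 -mulr2n -mulr_natl mulf_eq0 (negPf (char0_neq0 1)) => /eqP.
have -> : psi (rcons (rcons (O p) true) true) = c by rewrite -BC /B -!cats1 -catA.
have -> : psi (rcons (rcons (O p) true) false) = - c *+ p.+1.
  have := @fr_insert false psi (rcons (O p) true) F psi0.
  rewrite size_rcons size_nseq big_ord_recr /= take_oversize ?size_rcons ?size_nseq //.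
  rewrite drop_oversize ?size_rcons ?size_nseq // cats1 => /eqP.
  rewrite addrC addr_eq0 => /eqP ->; rewrite mulNrn; congr (- _).
  rewrite -[p.+1 in RHS]card_ord -sumr_const; apply: eq_bigr => i _ /=.
  rewrite -cats1 takel_cat ?size_nseq ?leq_ord // take_nseq ?leq_ord // drop_cat size_nseq.
  case: ltnP => [ip|pi].
    rewrite drop_nseq /c -cats1 -cat_cons catA; congr (psi (_ ++ _)).
    rewrite -[false :: _]/(O (p - i).+1) -nseqD; congr (nseq _ false).
    by rewrite addnS subnKC // ltnW.
  have -> : nat_of_ord i = p by apply/eqP; rewrite eqn_leq pi leq_ord.
  by rewrite subnn /= /c -cats1 -cat_rcons; congr (psi (_ ++ _)); elim: (p) => //= n ->.
rewrite -[psi (false :: _)]/c => E; have {}E : p.+3%:R * c = 0.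
  by apply: oppr_inj; rewrite oppr0 -E mulr_natl !mulrS mulNrn; ring.
by apply/eqP; move/eqP: E; rewrite mulf_eq0 (negPf (char0_neq0 _)).
Qed.

End CoactionEquation.

(** * Closure of rc_0 under the Ihara bracket *)

Section Rc0.
Variable k : fieldType.
Hypothesis char_k : [pchar k] =i pred0.

Notation A := (series bool k).
Notation x0 := (var k false : A).
Notation x1 := (var k true : A).

Implicit Types (f g a b psi phi : A) (l m : bool) (u v w : seq bool) (c : k).

Lemma rser_odd psi n : fr_gt1 psi -> coaction_eq psi -> psi [:: false; true] = 0 ->
  odd n -> rser psi n = 0.
Proof.
move=> /fr_gt1P[F V1 V0] C c0; case: n => [|[|p]] // podd.
apply: (even_coeff char_k (p := p.+1)) => //; first exact: V1.
exact: V0.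
Qed.

(** Now r_psi is even, which makes the right-hand side of [kappa_coaction] vanish. *)
Lemma kappa_eq0 psi : fr_gt1 psi -> coaction_eq psi -> psi [:: false; true] = 0 ->
  kappa psi = 0.
Proof.
move=> Fpsi C c0; have odd0 := rser_odd Fpsi C c0.
have [F _ _] := Fpsi; rewrite kappa_coaction // /coact_rhs.
have E a : a [::] = 0 -> psubst (rser psi) (- a) = psubst (rser psi) a.
  move=> a0; rewrite psubst_opp //; congr psubst; apply/funext => n.
  rewrite -signr_odd; case: (boolP (odd n)) => [/odd0 ->|_]; first by rewrite mulr0.
  by rewrite expr0 mul1r.
rewrite antipodeD antipodeN !antipode_psubst ?varN_nil // antipodeN !antipode_var.
by rewrite !E ?varN_nil //; ncring.
Qed.

Lemma rc0_kappa psi : rc0 psi -> kappa psi = 0.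
Proof. by move=> -[[[F _] C] c0]; exact: kappa_eq0. Qed.

Lemma decompR0 f : f [::] = 0 -> f = x0 * dR false f + x1 * dR true f.
Proof. by move=> f0; rewrite {1}(decompR f) f0 scale0r add0r. Qed.

Lemma dR_der_ihara psi l f : psi [::] = 0 -> dR l (der_ihara psi f) =
  der_ihara psi (dR l f) + (if l then psi else 0) * dR true f - dR l psi * x1 * dR true f.
Proof.
move=> psi0; rewrite {1}(decompR f) /der_ihara !derD derZ der1 scaler0 !derM der_x0 der_x1.
rewrite /lie mul0r !add0r mulrBl -!mulrA !dRD !dRN !dR_varM dR_mul psi0 scale0r addr0.
by case: l => /=; ncring.
Qed.

Lemma dL_der_ihara psi l f : psi [::] = 0 -> dL l (der_ihara psi f) =
  der_ihara psi (dL l f) + dL true f * x1 * dL l psi - dL true f * (if l then psi else 0).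
Proof.
move=> psi0; rewrite {1}(decompL f) /der_ihara !derD derZ der1 scaler0 !derM der_x0 der_x1.
rewrite /lie mulr0 add0r addr0 mulrBr !mulrA !dLD !dLN !dL_Mvar dL_mul psi0 scale0r addr0.
by case: l => /=; ncring.
Qed.

(** A word [w] contributes to [mu (d_psi w)] by merging two letters of [w], which
    gives [d_psi (mu w)]; two letters of an inserted psi, where the coaction
    equation applies; or a letter of psi and one of its neighbours. By
    [kappa psi = 0] the last two kinds of terms cancel, but for the power series
    in x_0 and the insertions that are next to the first or last letter of [w]. *)
Lemma mu_der_ihara psi f : fr_gt1 psi -> coaction_eq psi -> kappa psi = 0 ->
  mu (der_ihara psi f) = der_ihara psi (mu f)
    + der 0 (lie x1 (psubst (rser psi) (- x0))) f
    - dL true f * x1 * dL false psi + dR false psi * x1 * dR true f.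
Proof.
move=> [F _ _] /coaction_eqP Epsi Kpsi; have psi0 := fr_nil F.
have ER0 : dR false psi = dR true psi - dL true psi + dL false psi.
  by apply: (addrI (kappa psi - dR false psi)); rewrite {2}Kpsi /kappa; ncring.
set r1 := psubst (rser psi) x1; set q := psubst (rser psi) (- x0).
have Emu : mu psi = - r1 + q - dL false psi - dR true psi.
  by apply: (addIr (dL false psi + dR true psi)); rewrite addrA [LHS]Epsi /coact_rhs; ncring.
have Cr : r1 * x1 = x1 * r1 by rewrite /r1 psubst_comm.
move: f; apply: cont_ext => [||w]; rewrite /der_ihara.
- by continuity.
- by continuity.
elim: w => [|l w IHw]; first by rewrite mono_nil !der1 mu1 dL1 dR1 der0 (cont_eq0 (@mu_cont k)); ncring.
rewrite mono_cons !derM mu_varM !derD !derM dL_mul !dR_varM dL_var.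
case: l => /=; rewrite ?der_x0 ?der_x1; last first.
  rewrite !mul0r !add0r !scaler0 !addr0 mu_varM IHw -/(der_ihara psi _) (dR_der_ihara _ _ psi0).
  by ncring.
have -> : mono k w [::] = (w == [::])%:R by rewrite monoE eq_sym.
rewrite muD mu_varM IHw -/(der_ihara psi _) -/(der_ihara psi _) (dR_der_ihara _ _ psi0).
rewrite {1}/lie mulrBl -!mulrA muB mu_varM (muM psi (mono k w)) (muM psi (_ * _)) mu_varM.
rewrite !dR_varM dR_mul psi0 scale0r addr0 Emu /=.
(* The normalization in free rings is not aware of the fact that [x1] commutes
   with [r1], which is therefore added by hand, times the rest of the word. *)
have E (b y : A) : y = y + (x1 * r1 - r1 * x1) * b by rewrite Cr subrr mul0r addr0.
case: eqP => [->|/eqP w0].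
  rewrite mono_nil !dR1 dL1 mu1 !der1 /der_ihara !der0 scale1r ER0 [LHS](E 1).
  by ncring.
rewrite scale0r addr0.
have Ew : mono k w = x0 * dR false (mono k w) + x1 * dR true (mono k w).
  by rewrite -decompR0 // monoE eq_sym (negPf w0).
rewrite [LHS](E (mono k w)); move: Ew {IHw E}; rewrite /der_ihara /lie.
move: (dR false (mono k w)) (dR true (mono k w)) (dL true (mono k w)) => b0 b1 Lb.
move: (der 0 _ b1) (mu (mono k w)) => db1 m.
move: (der 0 _ m) (der 0 _ (mono k w)) => dm qb.
by move: (mono k w) => b ->; rewrite ER0; ncring.
Qed.

Lemma der_psubst_x0 r f :
  der 0 (lie x1 (psubst r (- x0))) f = - lie (psubst r (- x0)) f.
Proof.
set q := psubst _ _; have Cq : x0 * q = q * x0.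
  by apply: oppr_inj; rewrite -mulNr -mulrN /q psubst_comm ?varN_nil.
move: f; apply: (derivation_ext (s := fun f => f)) => [|||f g|f g||].
- exact: der_cont.
- by rewrite /lie; continuity.
- by rewrite der1; ncring.
- exact: derM.
- by ncring.
- by rewrite der_x0 /lie Cq subrr oppr0.
- by rewrite der_x1; ncring.
Qed.

(** By [rser0] this is the coaction equation of the bracket. *)
Lemma coact_ihara f g : rc0 f -> rc0 g -> coact (ihara f g) = 0.
Proof.
move=> Rf Rg; have Kf := rc0_kappa Rf; have Kg := rc0_kappa Rg.
have [[[Ff Sf] Cf] _] := Rf; have [[[Fg Sg] Cg] _] := Rg.
have f0 : f [::] = 0 by have [/fr_nil] := Ff.
have g0 : g [::] = 0 by have [/fr_nil] := Fg.
have ER0 (h : A) : kappa h = 0 -> dR false h = dR true h - dL true h + dL false h.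
  by move=> Kh; apply: (addrI (kappa h - dR false h)); rewrite {2}Kh /kappa; ncring.
have Emu h : coaction_eq h -> mu h = - psubst (rser h) x1 +
    psubst (rser h) (- x0) - dL false h - dR true h.
  move=> /coaction_eqP Eh; apply: (addIr (dL false h + dR true h)).
  by rewrite addrA [LHS]Eh /coact_rhs; ncring.
have Ed h p : der_ihara p (mu h) = der_ihara p (- psubst (rser h) x1 +
    psubst (rser h) (- x0) - dL false h - dR true h) ->
  der_ihara p (mu h) = - lie (psubst (rser h) x1) p - der_ihara p (dL false h) -
    der_ihara p (dR true h).
  move=> ->; rewrite /der_ihara !derD !derN.
  rewrite (@psubst_der k x1 erefl 0 (lie x1 p) (rser h) p) ?der_x1 //.
  rewrite (@psubst_der k (- x0) (@varN_nil k false) 0 (lie x1 p) (rser h) 0).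
    by ncring.
  by rewrite derN der_x0; ncring.
have Edfg := Ed f g (congr1 (der_ihara g) (Emu f Cf)).
have Edgf := Ed g f (congr1 (der_ihara f) (Emu g Cg)).
rewrite /coact /ihara !muB !mu_der_ihara // !der_psubst_x0 Edfg Edgf {Ed Edfg Edgf}.
rewrite !muM (Emu f Cf) (Emu g Cg) [lie f g]/lie !(dLD, dLN, dRD, dRN).
rewrite !dL_der_ihara // !dR_der_ihara // !dL_mul !dR_mul f0 g0 !scale0r !addr0 /=.
(* By [kappa = 0] everything is expressed by d^L_0, d^L_1 and d^R_1 of [f] and
   [g], for which the identity holds in the free ring. *)
have := decompR0 f0; have := decompR0 g0; rewrite (ER0 f Kf) (ER0 g Kg).
move: (psubst (rser f) x1) (psubst (rser f) (- x0)) => r1 q1.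
move: (psubst (rser g) x1) (psubst (rser g) (- x0)) => r2 q2.
move: (der_ihara g (dL false f)) (der_ihara g (dR true f)) => d1 d2.
move: (der_ihara f (dL false g)) (der_ihara f (dR true g)) => d3 d4.
move: (dL false f) (dL true f) (dR true f) (dL false g) (dL true g) (dR true g).
move=> a0 a1 b1 a0' a1' b1' Ef Eg.
clear -Ef Eg; move: f g Ef Eg => f g -> ->.
by ncring.
Qed.

Lemma rser0 psi : vanish true 2 psi -> rser psi = fun=> 0.
Proof.
move=> V; apply/funext => -[|n] //=; apply: V.
by rewrite /= -cats1 count_cat count_nseq.
Qed.

Lemma rc0_ihara f g : rc0 f -> rc0 g -> rc0 (ihara f g).
Proof.
move=> Rf Rg; have [[Sf _] _] := Rf; have [[Sg _] _] := Rg.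
have V : vanish true 2 (ihara f g).
  by apply: vanish_ihara; [have [/fr_gt1P[_ V _] _] := Sf|have [/fr_gt1P[_ V _] _] := Sg].
split; last exact: V.
split; first exact: Skew_ihara.
apply/coaction_eqP; rewrite coact_ihara // rser0 // /coact_rhs !psubst_zero ?varN_nil //.
by rewrite oppr0 addr0.
Qed.

Lemma rser_lin c f g : rser (c *: f + g) = fun n => c * rser f n + rser g n.
Proof. by apply/funext => -[|n] //=; rewrite mulr0 addr0. Qed.

Lemma coaction_lin c f g : coaction_eq f -> coaction_eq g -> coaction_eq (c *: f + g).
Proof.
move=> /coaction_eqP Ef /coaction_eqP Eg; apply/coaction_eqP.
have -> : coact (c *: f + g) = c *: coact f + coact g.
  rewrite /coact (cont_eqP (@mu_cont k)) !scalerDr dLD dLZ dRD dRZ.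
  by ncring.
rewrite Ef Eg /coact_rhs rser_lin !psubst_lin ?varN_nil // scalerDr scalerN.
by ncring.
Qed.

Lemma rc0_lin c f g : rc0 f -> rc0 g -> rc0 (c *: f + g).
Proof.
move=> [[Sf Cf] cf] [[Sg Cg] cg]; split; last by rewrite seriesDE seriesZE cf cg mulr0 addr0.
by split; [exact: Skew_lin|exact: coaction_lin].
Qed.

Lemma rc0_0 : rc0 (0 : A).
Proof.
split=> //; split; first exact: Skew0.
apply/coaction_eqP; rewrite rser0 // /coact_rhs !psubst_zero ?varN_nil //.
by rewrite /coact (cont_eq0 (@mu_cont k)) oppr0 !addr0.
Qed.

End Rc0.

(** * Tangential derivations *)

Section Tangential.
Variable k : fieldType.

Notation A := (series bool k).
Notation x0 := (var k false : A).
Notation x1 := (var k true : A).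
Notation z := (- x0 - x1 : A).

Implicit Types (f g a b psi phi : A) (l m : bool) (w : seq bool) (c : k).
Implicit Types (u v : (A * A)%type).

Lemma z_nil : z [::] = 0.
Proof. by rewrite seriesBE seriesNE !var_nil subr0 oppr0. Qed.

Lemma subst_z b : b [::] = 0 -> subst z z b = - z - b.
Proof. by move=> b0; rewrite substB ?substN ?subst_x0 ?subst_x1 ?z_nil. Qed.

Lemma rho_lin c u v f : rho (c *: u + v) f = c *: rho u f + rho v f.
Proof. by rewrite /rho -der_lin -!lie_linr. Qed.

Lemma rho_x0 u : rho u x0 = lie x0 u.1. Proof. exact: der_x0. Qed.
Lemma rho_x1 u : rho u x1 = lie x1 u.2. Proof. exact: der_x1. Qed.

Lemma rho_cont u : cont (rho u). Proof. exact: der_cont. Qed.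

Lemma pair_eq (u v : (A * A)%type) : u.1 = v.1 -> u.2 = v.2 -> u = v.
Proof. by case: u v => [? ?] [? ?] /= -> ->. Qed.

Lemma fst_lin c u v : (c *: u + v).1 = c *: u.1 + v.1. Proof. by []. Qed.
Lemma snd_lin c u v : (c *: u + v).2 = c *: u.2 + v.2. Proof. by []. Qed.

Lemma tder_lie_linl c u v (t : (A * A)%type) :
  tder_lie (c *: u + v) t = c *: tder_lie u t + tder_lie v t.
Proof.
apply: pair_eq; rewrite ?(fst_lin, snd_lin) /tder_lie /= ?(fst_lin, snd_lin) !rho_lin;
  rewrite lie_linl /rho derD derZ !scalerDr !scalerN; by ncring.
Qed.

Lemma tder_lie_anti u v : tder_lie u v = - tder_lie v u.
Proof. by apply: pair_eq; rewrite /tder_lie /=; ncring. Qed.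

Lemma tder_lie_linr c u v (t : (A * A)%type) :
  tder_lie t (c *: u + v) = c *: tder_lie t u + tder_lie t v.
Proof. by rewrite tder_lie_anti tder_lie_linl opprD -scalerN -!(tder_lie_anti t). Qed.

Lemma tder_lie_alt u : tder_lie u u = 0.
Proof. by apply: pair_eq; rewrite /tder_lie /=; ncring. Qed.

Lemma rho_tder_lie u v f :
  rho (tder_lie u v) f = rho u (rho v f) - rho v (rho u f).
Proof.
move: f; apply: (derivation_ext (s := fun f => f)) => [|||f g|f g||]; rewrite /rho.
- exact: der_cont.
- by continuity.
- by rewrite !der1 !der0 subrr.
- exact: derM.
- by rewrite !derM !derD !derM; ncring.
- by rewrite !der_x0 !der_lie !der_x0 /tder_lie /rho /=; ncring.
- by rewrite !der_x1 !der_lie !der_x1 /tder_lie /rho /=; ncring.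
Qed.

Lemma tder_lie_jacobi (u v t : (A * A)%type) :
  tder_lie u (tder_lie v t) + tder_lie v (tder_lie t u) + tder_lie t (tder_lie u v) = 0.
Proof.
have E (s r : (A * A)%type) : tder_lie s r =
  (rho s r.1 - rho r s.1 + lie s.1 r.1, rho s r.2 - rho r s.2 + lie s.2 r.2) by [].
by apply: pair_eq; rewrite !(E _ (tder_lie _ _)) /= !rho_tder_lie /rho /lie !derD !derN !derM;
  ncring.
Qed.

Lemma special_tder_lie u v :
  lie x0 u.1 + lie x1 u.2 = 0 -> lie x0 v.1 + lie x1 v.2 = 0 ->
  lie x0 (tder_lie u v).1 + lie x1 (tder_lie u v).2 = 0.
Proof.
move=> Eu Ev; have E s t : lie x0 t.1 + lie x1 t.2 = 0 ->
    lie (lie x0 s.1) t.1 + lie x0 (rho s t.1) + (lie (lie x1 s.2) t.2 + lie x1 (rho s t.2)) = 0.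
  by move=> Et; rewrite -{1}rho_x0 -{1}rho_x1 /rho -!der_lie -derD Et der0.
rewrite -[RHS](subr0 0) -[X in _ = X - _](E u v Ev) -[X in _ = _ - X](E v u Eu) /=.
by ncring.
Qed.

Lemma tder_tder_lie u v : tder u -> tder v -> tder (tder_lie u v).
Proof.
move=> [u1 u2] [v1 v2]; have Fr s f : fr s.1 -> fr s.2 -> fr f -> fr (rho s f).
  by move=> s1 s2 Hf; apply: fr_der => //; apply: fr_lie => //; exact: fr_var.
by split; apply: frD; try exact: fr_lie; apply: frB; exact: Fr.
Qed.

Lemma sder_tder_lie u v : sder u -> sder v -> sder (tder_lie u v).
Proof.
move=> [Tu Eu] [Tv Ev]; split; [exact: tder_tder_lie|exact: special_tder_lie].
Qed.

(** ** From Vep to special derivations *)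

(** Vep says that [rho (L1 psi)] kills [z]. Like [- d_psi], it thus kills one
    letter of [(z, x_l)] and maps the other one to a bracket with the image of
    [psi], for [l = 0] as well as for [l = 1]. *)
Lemma rho_L1 l psi f : Vep psi ->
  rho (L1 psi) (subst f z (var k l)) = - subst (der_ihara psi f) z (var k l).
Proof.
move=> [_ V]; have cs := @subst_cont k z (var k l) z_nil erefl.
have Ez : rho (L1 psi) z = 0.
  rewrite /rho derB derN -/(rho _) rho_x0 rho_x1 -[RHS]V /L1 /=.
  by ncring.
have Ex : rho (L1 psi) (var k l) = - lie (var k l) (subst psi z (var k l)).
  by case: l {cs}; rewrite ?rho_x0 ?rho_x1 /L1 /=; ncring.
move: f; apply: (derivation_ext (s := fun f => subst f z (var k l))) => [|||f g|f g||].
- exact: (cont_comp (rho_cont _) cs).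
- by apply: contN; exact: (cont_comp cs (der_cont _ _)).
- by rewrite subst1 /rho /der_ihara !der1 subst0 ?z_nil // oppr0.
- by rewrite substM ?z_nil // /rho derM.
- by rewrite /der_ihara derM substD ?substM ?z_nil //; ncring.
- by rewrite subst_x0 ?Ez /der_ihara der_x0 subst0 ?oppr0 ?z_nil.
- by rewrite subst_x1 Ex /der_ihara der_x1 subst_lie ?subst_x1 ?z_nil.
Qed.

Lemma L1_ihara f g : Vep f -> Vep g -> L1 (ihara f g) = tder_lie (L1 f) (L1 g).
Proof.
move=> Vf Vg; have RN p (h : A) l : Vep p -> rho (L1 p) (- subst h z (var k l)) =
    subst (der_ihara p h) z (var k l).
  by move=> Vp; rewrite /rho derN -/(rho _) rho_L1 // opprK.
apply: pair_eq; rewrite /tder_lie {2 4}/L1 /= !RN //.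
  by rewrite /ihara !substB ?substM ?z_nil //; ncring.
by rewrite /ihara !substB ?substM ?z_nil //; ncring.
Qed.

Lemma Vep_special psi : fr_gt1 psi ->
  (lie x0 (L1 psi).1 + lie x1 (L1 psi).2 = 0) <-> Vep psi.
Proof.
move=> F; have E : lie x0 (L1 psi).1 + lie x1 (L1 psi).2 =
    - (lie x1 (subst psi z x1) + lie x0 (subst psi z x0)) by rewrite /L1 /=; ncring.
rewrite E; split=> [H|[_ ->]]; last by rewrite oppr0.
by split=> //; apply: oppr_inj; rewrite H oppr0.
Qed.

Lemma L1_lin c f g : L1 (c *: f + g) = c *: L1 f + L1 g.
Proof.
by apply: pair_eq; rewrite /L1 /= substD ?substZ ?z_nil // opprD scalerN.
Qed.

Lemma Vep_lin c f g : Vep f -> Vep g -> Vep (c *: f + g).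
Proof.
move=> Vf Vg; have [Ff _] := Vf; have [Fg _] := Vg.
apply/(Vep_special (fr_gt1_lin c Ff Fg)); rewrite L1_lin /= !lie_linr.
move/(Vep_special Ff): Vf => Ef; move/(Vep_special Fg): Vg => Eg.
by rewrite addrACA -scalerDr Ef Eg scaler0 addr0.
Qed.

Lemma Vep0 : Vep (0 : A).
Proof.
split; first exact: fr_gt1_0.
by rewrite !subst0 ?z_nil //; ncring.
Qed.

Lemma Vep_ihara f g : Vep f -> Vep g -> Vep (ihara f g).
Proof.
move=> Vf Vg; have [Ff _] := Vf; have [Fg _] := Vg.
apply/(Vep_special (fr_gt1_ihara Ff Fg)); rewrite L1_ihara //.
by apply: special_tder_lie; [exact/(Vep_special Ff)|exact/(Vep_special Fg)].
Qed.

Lemma subst_zK f : subst (subst f z x1) z x1 = f.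
Proof.
have cs := @subst_cont k z x1 z_nil erefl; move: f; apply: morphism_ext => //.
- exact: (cont_comp cs cs).
- exact: cont_id.
- by rewrite !subst1.
- by move=> f g; rewrite !substM ?z_nil.
- by rewrite subst_x0 subst_z //; ncring.
- by rewrite !subst_x1.
Qed.

(** The substitution (z, x1) is an involution. *)
Lemma L1_inj : injective (@L1 k).
Proof.
move=> f g /(congr1 snd) /= /oppr_inj /(congr1 (fun h => subst h z x1)).
by rewrite !subst_zK.
Qed.

Lemma fr_L1 psi : fr psi -> tder (L1 psi).
Proof.
have Hz : lie_poly z.
  by apply: lie_poly_add; apply: lie_polyN; exact: lie_poly_var.
have hv l : homog 1 (var k l) = var k l.
  apply/funext => w; rewrite /homog; case: eqP => // w1.
  by rewrite /var; case: (w =P _) w1 => // ->.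
have hz : homog 1 z = z by rewrite homogD !homogN !hv.
by move=> F; split; apply: frN; apply: fr_subst => //; exact: lie_poly_var.
Qed.

Lemma sder_L1 psi : Vep psi -> sder (L1 psi).
Proof.
move=> V; have [[F _ _] _] := V; split; first exact: fr_L1.
by case: V => Fg V; apply/(Vep_special Fg).
Qed.

End Tangential.

(** * The Kashiwara-Vergne Lie algebra *)

Section KashiwaraVergne.
Variable k : fieldType.

Notation A := (series bool k).
Notation x0 := (var k false : A).
Notation x1 := (var k true : A).
Notation z := (- x0 - x1 : A).

Implicit Types (f g a b psi phi : A) (l m : bool) (w : seq bool) (c : k).
Implicit Types (u v : (A * A)%type) (r : nat -> k).

(** ** Sums of commutators *)

Lemma trP a b : tr a = tr b <-> a - b \in @comm_span A.
Proof.
rewrite /tr; split=> [E|]; first by rewrite Quotient.idealrBE; apply/eqP.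
by rewrite Quotient.idealrBE => /eqP.
Qed.

Lemma comm_lie a b : lie a b \in @comm_span A.
Proof. by apply/asboolP; exists [:: (a, b)]; rewrite big_seq1. Qed.

Lemma comm_ind (P : A -> Prop) : P 0 -> (forall a b, P (lie a b)) ->
  (forall a b, P a -> P b -> P (a + b)) -> forall a, a \in @comm_span A -> P a.
Proof.
move=> P0 Pl PD a /asboolP[s ->].
by elim/big_ind: _ => // p _; exact: Pl.
Qed.

Lemma comm_scale c a : a \in @comm_span A -> c *: a \in @comm_span A.
Proof.
move: a; apply: comm_ind => [|a b|a b Ha Hb]; first by rewrite scaler0 rpred0.
  have -> : c *: lie a b = lie (c *: a) b.
    by have := lie_linl c a 0 b; rewrite addr0 => ->; ncring.
  exact: comm_lie.
by rewrite scalerDr rpredD.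
Qed.

Lemma comm_der a b f : f \in @comm_span A -> der a b f \in @comm_span A.
Proof.
move: f; apply: comm_ind => [|f g|f g Hf Hg]; first by rewrite der0 rpred0.
  by rewrite der_lie rpredD ?comm_lie.
by rewrite derD rpredD.
Qed.

Definition rotate f : A := fun w => f (rot 1 w).

(** The difference of a word and its rotation is a commutator with a letter. *)
Lemma comm_rotate f : rotate f - f \in @comm_span A.
Proof.
have -> : rotate f - f = lie x0 (dL false f) + lie x1 (dL true f); last first.
  by rewrite rpredD ?comm_lie.
have -> : rotate f = f [::] *: (1 : A) + x0 * dL false f + x1 * dL true f.
  apply/funext => -[|l w]; rewrite !seriesDE seriesZE /rotate.
    by rewrite !var_mul_nil mulr1 !addr0.
  rewrite !var_mul_cons /rot /= drop0 take0 cats1 mulr0 add0r /dL.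
  by case: l => /=; rewrite mul0r mul1r ?add0r ?addr0.
by rewrite {4}(decompL f); ncring.
Qed.

(** ** The divergence cocycle *)

Definition div_series u : A := x0 * dR false u.1 + x1 * dR true u.2.

Definition kv_rhs r : A := psubst r (x0 + x1) - psubst r x0 - psubst r x1.

Lemma krv2P u : krv2 u <->
  sder u /\ exists r, div_series u - kv_rhs r \in @comm_span A.
Proof. by split=> -[S [r H]]; split=> //; exists r; exact/trP. Qed.

Lemma x01_nil : (x0 + x1) [::] = 0. Proof. by rewrite seriesDE addr0. Qed.

Lemma dR_rho u l f : u.1 [::] = 0 -> u.2 [::] = 0 -> dR l (rho u f) =
  rho u (dR l f) + (if l then u.2 else u.1) * dR l f
  - dR l u.1 * x0 * dR false f - dR l u.2 * x1 * dR true f.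
Proof.
move=> u1 u2; rewrite {1}(decompR f) /rho !derD derZ der1 scaler0 !derM der_x0 der_x1.
rewrite /lie add0r !mulrBl -!mulrA !(dRD, dRN) !dR_varM !dR_mul u1 u2 !scale0r !addr0.
by case: l => /=; ncring.
Qed.

(** The divergence is a cocycle with values in the series modulo commutators; the
    proof exhibits the commutators. *)
Lemma div_tder_lie u v : u.1 [::] = 0 -> u.2 [::] = 0 -> v.1 [::] = 0 -> v.2 [::] = 0 ->
  div_series (tder_lie u v) - (rho u (div_series v) - rho v (div_series u))
    \in @comm_span A.
Proof.
move=> u1 u2 v1 v2; case: u v u1 u2 v1 v2 => [u0 u1] [v0 v1] /= u00 u10 v00 v10.
set X := _ - _.
have -> : X = lie u0 (x0 * dR false v0) + lie u1 (x1 * dR true v1)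
    - lie v0 (x0 * dR false u0) - lie v1 (x1 * dR true u1)
    - lie (x0 * dR false u0) (x0 * dR false v0)
    - lie (x0 * dR false u1) (x1 * dR true v0)
    - lie (x1 * dR true u0) (x0 * dR false v1)
    - lie (x1 * dR true u1) (x1 * dR true v1).
  rewrite /X /div_series /tder_lie /= /lie !(dRD, dRN) !dR_rho //= !dR_mul.
  rewrite u00 u10 v00 v10 !scale0r /rho /lie !derD !derM !der_x0 !der_x1 /=.
  by ncring.
by repeat first [exact: comm_lie | apply: rpredB | apply: rpredD].
Qed.

(** [rho u] maps each of x_0 + x_1, x_0 and x_1, and hence every power series in
    one of them, to a bracket with a fixed element, which is 0 for x_0 + x_1. *)
Lemma comm_rho_kv u r : lie x0 u.1 + lie x1 u.2 = 0 -> rho u (kv_rhs r) \in @comm_span A.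
Proof.
move=> Eu; rewrite /kv_rhs /rho !derB.
rewrite (@psubst_der k (x0 + x1) x01_nil _ _ r 0); last first.
  by rewrite derD der_x0 der_x1 Eu; ncring.
rewrite (@psubst_der k x0 erefl _ _ r u.1) ?der_x0 //.
rewrite (@psubst_der k x1 erefl _ _ r u.2) ?der_x1 //.
by repeat first [exact: comm_lie | apply: rpredB].
Qed.

Lemma sder_nil u : sder u -> u.1 [::] = 0 /\ u.2 [::] = 0.
Proof. by move=> [[F1 F2] _]; split; exact: fr_nil. Qed.

Lemma krv2_tder_lie u v : krv2 u -> krv2 v -> krv2 (tder_lie u v).
Proof.
move=> /krv2P[Su [r Hr]] /krv2P[Sv [s Hs]]; apply/krv2P; split; first exact: sder_tder_lie.
have [u1 u2] := sder_nil Su; have [v1 v2] := sder_nil Sv.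
exists (fun=> 0); rewrite /kv_rhs !psubst_zero ?x01_nil // !subr0.
have Cu := comm_rho_kv s (proj2 Su); have Cv := comm_rho_kv r (proj2 Sv).
have Hu : rho u (div_series v) \in @comm_span A.
  by have := rpredD (comm_der (lie x0 u.1) (lie x1 u.2) Hs) Cu; rewrite derB subrK.
have Hv : rho v (div_series u) \in @comm_span A.
  by have := rpredD (comm_der (lie x0 v.1) (lie x1 v.2) Hr) Cv; rewrite derB subrK.
by have := rpredD (div_tder_lie u1 u2 v1 v2) (rpredB Hu Hv); rewrite subrK.
Qed.

Lemma krv2_lin c u v : krv2 u -> krv2 v -> krv2 (c *: u + v).
Proof.
move=> /krv2P[[[Fu1 Fu2] Eu] [r Hr]] /krv2P[[[Fv1 Fv2] Ev] [s Hs]].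
apply/krv2P; split.
  split; first by split; apply: frD => //; exact: frZ.
  rewrite fst_lin snd_lin !lie_linr addrACA -scalerDr Eu Ev scaler0 addr0 //.
exists (fun n => c * r n + s n).
have -> : div_series (c *: u + v) - kv_rhs (fun n => c * r n + s n) =
    c *: (div_series u - kv_rhs r) + (div_series v - kv_rhs s).
  rewrite /div_series fst_lin snd_lin !dRD !dRZ !mulrDr !mul_scale /kv_rhs.
  rewrite !psubst_lin ?x01_nil // !(scalerBr, scalerDr); ncring.
by rewrite rpredD // comm_scale.
Qed.

Lemma krv2_0 : krv2 (0 : A * A).
Proof.
apply/krv2P; split.
  split; first by split; exact: fr0.
  by rewrite /lie !mulr0 !mul0r subrr addr0.
exists (fun=> 0); rewrite /kv_rhs !psubst_zero ?x01_nil // !subr0.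
have -> : div_series (0 : A * A) = 0 by rewrite /div_series /= !mulr0 addr0.
exact: rpred0.
Qed.

Lemma krv2_lie_algebra : lie_algebra_on (@krv2 k) (@tder_lie k).
Proof.
split=> [|c x y|x y|c x y t _ _ _|c x y t _ _ _|x _|x y t _ _ _].
- exact: krv2_0.
- exact: krv2_lin.
- exact: krv2_tder_lie.
- exact: tder_lie_linl.
- exact: tder_lie_linr.
- exact: tder_lie_alt.
- exact: tder_lie_jacobi.
Qed.

End KashiwaraVergne.

(** ** From the coaction equation to the divergence *)

Section Divergence.
Variable k : fieldType.
Hypothesis char_k : [pchar k] =i pred0.

Notation A := (series bool k).
Notation x0 := (var k false : A).
Notation x1 := (var k true : A).
Notation z := (- x0 - x1 : A).

Implicit Types (f g a b psi phi : A) (l m : bool) (w : seq bool) (c : k).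
Implicit Types (u v : (A * A)%type) (r : nat -> k).

(** For the product of letters behind [mu], x_0 and x_1 are orthogonal idempotents,
    so that [- z] is a unit. In the letters (z, x1) a merge that involves [z] thus
    deletes it, up to sign, which is expressed by [der 1 0]. This derivation occurs
    twice because a letter has two neighbours; the terms [dL] and [dR] account
    for the missing neighbours at the ends, and [mu f] for the merges of two
    letters [z], which are otherwise counted twice. *)
Lemma mu_subst_z f : mu (subst f z x1) =
  subst (mu f + dL false f + dR false f - der 1 0 f - der 1 0 f) z x1.
Proof.
have cs := @subst_cont k z x1 (z_nil k) erefl.
move: f; apply: cont_ext => [||w].
- exact: (cont_comp (@mu_cont k) cs).
- by apply: (cont_comp cs); continuity.
have muz f : mu (z * f) = z * mu f - x0 * dR false f - x1 * dR true f.
  by rewrite mulrBl mulNr muB muN !mu_varM; ncring.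
elim: w => [|l w IHw].
  rewrite mono_nil subst1 mu1 dL1 dR1 der1.
  by rewrite !addr0 !subr0 subst0 ?z_nil.
rewrite mono_cons substM ?z_nil // mu_varM dL_mul dL_var dR_varM derM.
move: (mono k w) IHw => b IHb; case: l; rewrite ?subst_x0 ?subst_x1 /=.
  rewrite der_x1 mu_varM IHb mul0r !add0r scaler0 !addr0.
  rewrite !(substB, substD, substM, subst_x1) ?z_nil //.
  have -> : dR true (subst b z x1) = subst (dR true b) z x1 - subst (dR false b) z x1.
    rewrite [in LHS](decompR b) !substD ?substZ ?substM ?subst1 ?subst_x0 ?subst_x1 ?z_nil //.
    by rewrite mulrBl mulNr !dRD dRZ !dRN dR1 scaler0 !dR_varM /=; ncring.
  by ncring.
rewrite der_x0 muz IHb mul1r.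
have -> : x0 * dR false (subst b z x1) =
    subst b z x1 - b [::] *: (1 : A) - x1 * dR true (subst b z x1).
  by rewrite [X in _ = X - _ - _](decompR (subst b z x1)) subst_nil ?z_nil //; ncring.
rewrite !(substB, substD, substM, substZ, subst_x0, subst1) ?z_nil //.
by ncring.
Qed.

Lemma subst_z_swap f : subst f z x0 = subst (subst f z x1) x1 x0.
Proof.
have cz := @subst_cont k z x1 (z_nil k) erefl.
have c0 := @subst_cont k z x0 (z_nil k) erefl.
have cs := @subst_cont k x1 x0 erefl erefl.
move: f; apply: morphism_ext => //.
- exact: (cont_comp cs cz).
- by rewrite !subst1.
- by move=> f g; rewrite !substM ?z_nil.
- by move=> f g; rewrite !substM ?z_nil.
- rewrite !subst_x0 substB // substN // subst_x0 subst_x1.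
  by ncring.
- by rewrite !subst_x1.
Qed.

Lemma dR_swap l f : dR l (subst f x1 x0) = subst (dR (~~ l) f) x1 x0.
Proof.
rewrite [in LHS](decompR f) !substD // substZ // !substM // subst1 subst_x0 subst_x1.
rewrite !dRD dRZ dR1 scaler0 !dR_varM; case: l => /=; ncring.
Qed.

Lemma mu_swap f : mu (subst f x1 x0) = subst (mu f) x1 x0.
Proof.
have cs := @subst_cont k x1 x0 erefl erefl.
move: f; apply: cont_ext => [||w].
- exact: (cont_comp (@mu_cont k) cs).
- exact: (cont_comp cs (@mu_cont k)).
elim: w => [|l w IHw]; first by rewrite mono_nil subst1 mu1 subst0.
rewrite mono_cons substM // mu_varM substD // !substM // -IHw.
by case: l; rewrite ?subst_x0 ?subst_x1 mu_varM dR_swap.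
Qed.

(** Lie series without linear term are killed by [der 1 0]; hence [mu_subst_z]
    turns the coaction equation into the first equation. The second one is its
    image under the exchange of x_0 and x_1. *)
Lemma coaction_L1 psi : fr_gt1 psi -> coaction_eq psi ->
  mu (L1 psi).2 + dR true (L1 psi).2 =
    psubst (rser psi) x1 - psubst (rser psi) (x0 + x1) /\
  mu (L1 psi).1 + dR false (L1 psi).1 =
    psubst (rser psi) x0 - psubst (rser psi) (x0 + x1).
Proof.
move=> /fr_gt1P[F V1 V0] /coaction_eqP E.
have D0 : der 1 0 psi = 0 by apply: (@fr_der1 k false); [exact: F|exact: V1].
have E1 : mu (subst psi z x1) + dR true (subst psi z x1) =
    psubst (rser psi) (x0 + x1) - psubst (rser psi) x1.
  rewrite mu_subst_z D0 !subr0.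
  have -> : dR true (subst psi z x1) = subst (dR true psi) z x1 - subst (dR false psi) z x1.
    rewrite [in LHS](decompR psi) !substD ?substZ ?substM ?subst1 ?subst_x0 ?subst_x1 ?z_nil //.
    by rewrite mulrBl mulNr !dRD dRZ !dRN dR1 scaler0 !dR_varM /=; ncring.
  have -> : psubst (rser psi) (x0 + x1) - psubst (rser psi) x1 =
      subst (coact_rhs (rser psi)) z x1.
    rewrite /coact_rhs substD ?substN ?z_nil // !psubst_subst ?varN_nil ?z_nil //.
    rewrite substN ?z_nil // subst_x0 subst_x1 opprB opprK [x1 + x0]addrC.
    by ncring.
  by rewrite -E /coact !substD ?z_nil //; ncring.
have E1N : mu (L1 psi).2 + dR true (L1 psi).2 =
    psubst (rser psi) x1 - psubst (rser psi) (x0 + x1).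
  by rewrite /L1 /= muN dRN -opprD E1 opprB.
split=> //; have -> : (L1 psi).1 = subst (L1 psi).2 x1 x0.
  by rewrite /L1 /= substN // -subst_z_swap.
have sx : subst (x0 + x1) x1 x0 = x0 + x1 by rewrite substD // subst_x0 subst_x1 addrC.
rewrite mu_swap dR_swap -substD // E1N substB // !psubst_subst ?x01_nil //.
by rewrite subst_x1 sx.
Qed.

(** ** Cyclic invariance of special derivations *)

Definition comp u l : A := if l then u.2 else u.1.

(** The cyclic word, up to a factor in each degree, of which the special derivation
    [u] is the Hamiltonian derivation. *)
Definition hamilton u : A := fun w => if w is l :: v then comp u l v else 0.

Lemma hamilton_rot u n w : lie x0 u.1 + lie x1 u.2 = 0 ->
  hamilton u (rot n w) = hamilton u w.
Proof.
move=> Eu; have H1 (v : seq bool) : hamilton u (rot 1 v) = hamilton u v.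
  case: v => [//|l [|m v]] //; rewrite /rot /= ?drop0 ?take0 cats1 /=.
  have := congr1 (fun f : A => f (m :: rcons v l)) Eu.
  rewrite /lie !(seriesDE, seriesNE) !var_mul_cons -!rcons_cons !mul_var_rcons.
  by case: m; case: l => /=; rewrite !(mul0r, mul1r, mulr0, mulr1, add0r, addr0, oppr0, sub0r)
    => /eqP; rewrite ?subr_eq0 1?addrC ?subr_eq0 => /eqP.
elim: n => [|n IHn] in w *; first by rewrite rot0.
case: (ltnP n (size w)) => nw; first by rewrite rotS // H1 IHn.
by rewrite rot_oversize // leqW.
Qed.

(** Modulo commutators a series is the average of its rotations. With this
    function divided by the degree, [rotation_sum_rot] writes the difference as
    [rotate U - U]. *)
Definition rotation_sum f w : k :=
  \sum_(j < size w) \sum_(i < j) f (rot i w).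

Lemma rotation_sum_rot f w :
  rotation_sum f (rot 1 w) - rotation_sum f w =
  \sum_(j < size w) (f (rot j w) - f w).
Proof.
rewrite /rotation_sum size_rot -sumrB; apply: eq_bigr => j _; rewrite -sumrB.
have -> : \sum_(i < j) (f (rot i (rot 1 w)) - f (rot i w)) =
    \sum_(0 <= i < j) (f (rot i.+1 w) - f (rot i w)).
  rewrite big_mkord; apply: eq_bigr => i _.
  by rewrite -rotD ?addn1 // (leq_ltn_trans (ltnW (ltn_ord i)) (ltn_ord j)).
by rewrite telescope_sumr // rot0.
Qed.

(** Both sides sum the coefficients of [hamilton u] at the words obtained by
    doubling one letter of [w]: the divergence sees the first letter, and [mu] the
    other ones, which rotations bring to the front. *)
Lemma div_coaction u w : lie x0 u.1 + lie x1 u.2 = 0 ->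
  (div_series u + (x0 * mu u.1 + x1 * mu u.2)) w =
  \sum_(j < size w) div_series u (rot j w).
Proof.
move=> Eu; case: w => [|l w].
  by rewrite big_ord0 /div_series !seriesDE !var_mul_nil !addr0.
have divE m t : div_series u (m :: t) = hamilton u (m :: m :: t).
  rewrite /div_series seriesDE !var_mul_cons /= /comp.
  by case: m => /=; rewrite mul0r mul1r ?addr0 ?add0r.
rewrite seriesDE big_ord_recl rot0; congr (_ + _).
have -> : (x0 * mu u.1 + x1 * mu u.2) (l :: w) = mu (comp u l) w.
  by rewrite seriesDE !var_mul_cons; case: l => /=; rewrite mul0r mul1r ?addr0 ?add0r.
rewrite muE_sum; apply: eq_bigr => i _; rewrite lift0 /rot /=.
rewrite (drop_nth false (ltn_ord i)) /= divE.
rewrite -[LHS]/(hamilton u (l :: take i w ++ _)) -(hamilton_rot i.+1 _ Eu) /rot /= drop_size_cat; last first.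
  by rewrite size_takel // ltnW.
by rewrite take_size_cat // size_takel // ltnW.
Qed.

Lemma psubst_homog r a w : homog 1 a = a -> psubst r a w = r (size w) * (a ^+ size w) w.
Proof.
move=> a1; have an n (v : seq bool) : (a ^+ n) v != 0 -> size v = n.
  elim: n v => [|n IHn] v; first by rewrite expr0; case: v => // l v; rewrite eqxx.
  rewrite exprS => /mul_neq0[s [t [-> Hs /IHn tn]]]; rewrite size_cat tn.
  by move: Hs; rewrite -a1 /homog; case: (size s =P 1%N) => [->|]; rewrite ?eqxx.
rewrite /psubst (fsbigE [:: size w]) //; first by rewrite big_cons big_nil in_setT /= addr0.
move=> n _; rewrite inE => nw; case: (eqVneq ((a ^+ n) w) 0) => [->|/an wn]; first by rewrite mulr0.
by rewrite wn eqxx in nw.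
Qed.

(** The two equations compute the left-hand side of [div_coaction], while its
    right-hand side is the degree times the divergence modulo commutators. As
    the degree is invertible, the divergence itself is of the form required. *)
Lemma krv2_of_coaction u r : sder u ->
  mu u.1 + dR false u.1 = psubst r x0 - psubst r (x0 + x1) ->
  mu u.2 + dR true u.2 = psubst r x1 - psubst r (x0 + x1) -> krv2 u.
Proof.
move=> Su E1 E2; apply/krv2P; split=> //; have [u1 u2] := sder_nil Su.
(* The shift by one comes from the letters in front of [mu u_l + dR l u_l]. *)
pose s n := - (if n is m.+1 then r m else 0) / n%:R.
pose U : A := fun w => rotation_sum (div_series u) w / (size w)%:R.
exists s; suff -> : div_series u - kv_rhs s = - (rotate U - U).
  by rewrite rpredN comm_rotate.
have h1 l : homog 1 (var k l) = var k l.
  apply/funext => w; rewrite /homog; case: eqP => // w1.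
  by rewrite /var; case: (w =P _) w1 => // ->.
have h01 : homog 1 (x0 + x1) = x0 + x1 by rewrite homogD !h1.
have Ekv : div_series u + (x0 * mu u.1 + x1 * mu u.2) =
    - kv_rhs (fun n => if n is m.+1 then r m else 0).
  have -> : div_series u + (x0 * mu u.1 + x1 * mu u.2) =
      x0 * (mu u.1 + dR false u.1) + x1 * (mu u.2 + dR true u.2).
    by rewrite /div_series; ncring.
  by rewrite E1 E2 /kv_rhs -!psubst_shift ?x01_nil //; ncring.
apply/funext => w; rewrite !(seriesDE, seriesNE) /kv_rhs !(seriesDE, seriesNE).
rewrite /rotate /U size_rot -mulrBl rotation_sum_rot.
have := div_coaction w (proj2 Su); rewrite Ekv /kv_rhs !(seriesDE, seriesNE).
rewrite !psubst_homog // /s; case: w => [|l w] Ew.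
  by rewrite /div_series /= seriesDE !var_mul_nil /= invr0 !(mulr0, mul0r) !(addr0, oppr0).
have n0 : (size (l :: w))%:R != 0 :> k by exact: char0_neq0.
rewrite sumrB -Ew sumr_const card_ord -(mulr_natr (div_series u _)).
have alg (S n p a b c : k) : n != 0 ->
    S - (- p / n * a - - p / n * b - - p / n * c) =
    - ((- (p * a - p * b - p * c) - S * n) / n) by move=> nn0; field.
exact: alg.
Qed.

Lemma krv2_L1 psi : coaction_eq psi -> Vep psi -> krv2 (L1 psi).
Proof.
move=> C V; have [F _] := V; have [E2 E1] := coaction_L1 F C.
exact: krv2_of_coaction (sder_L1 V) E1 E2.
Qed.

Lemma rc0_Vep_lie_algebra : lie_algebra_on (@rc0 k `&` @Vep k) (@ihara k).
Proof.
apply: ihara_lie_algebra => [|c x y [Rx Vx] [Ry Vy]|x y [Rx Vx] [Ry Vy]]; split.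
- exact: rc0_0.
- exact: Vep0.
- exact: rc0_lin.
- exact: Vep_lin.
- exact: rc0_ihara.
- exact: Vep_ihara.
Qed.

Lemma L1_injective_lie_map :
  injective_lie_map (@rc0 k `&` @Vep k) (@ihara k) (@krv2 k) (@tder_lie k) (@L1 k).
Proof.
split=> [||x [[[_ C] _] V]|c x y _ _|x y [_ Vx] [_ Vy]|x y _ _].
- exact: rc0_Vep_lie_algebra.
- exact: krv2_lie_algebra.
- exact: krv2_L1.
- exact: L1_lin.
- exact: L1_ihara.
- exact: L1_inj.
Qed.

End Divergence.

(** * The stuffle coproduct *)

Section Stuffle.
Variable k : fieldType.

Notation AY := (series nat k).
Notation AYY := (series nat AY).

Implicit Types (f g a b : AY) (F G : AYY) (s t w : seq nat) (m n p q : nat) (c : k).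

Notation wtn := (fun m : nat => m.+1).

Lemma finite_wtn : finite_weight wtn.
Proof.
by split=> // n; exists (iota 0 n) => m mn; rewrite mem_iota add0n.
Qed.

Notation wty := (weight wtn).

Lemma yvarE n w : (yvar k n) w = ((size w <= 1)%N && (wty w == n))%:R.
Proof.
case: n => [|n] /=; case: w => [|m [|p w]] //=; rewrite /weight ?big_cons ?big_nil //=.
  by rewrite addn0 eqSS /var eqseq_cons andbT.
by rewrite /var eqseq_cons andbF.
Qed.

Lemma mulYYE F G s t : (F * G) s t = \sum_(i < (size s).+1) \sum_(j < (size t).+1)
  F (take i s) (take j t) * G (drop i s) (drop j t).
Proof.
rewrite -[F * G]/(series_mul F G) /series_mul.
by rewrite series_sumE.
Qed.

Lemma mulYY_neq0 F G s t : (F * G) s t != 0 -> exists s1 s2 t1 t2,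
  [/\ s = s1 ++ s2, t = t1 ++ t2, F s1 t1 != 0 & G s2 t2 != 0].
Proof.
move=> FG; apply: contrapT => H; case/eqP: FG; rewrite mulYYE.
apply: big1 => i _; apply: big1 => j _; apply: contrapT => /eqP.
rewrite mulf_eq0 negb_or => /andP[Fi Gi]; apply: H.
by exists (take i s), (drop i s), (take j t), (drop j t); rewrite !cat_take_drop.
Qed.

Lemma tensorM a b f g : tensor a b * tensor f g = tensor (a * f) (b * g).
Proof.
apply/funext => s; apply/funext => t; rewrite mulYYE /tensor.
rewrite -[(a * f) s]/(series_mul a f s) -[(b * g) t]/(series_mul b g t) /series_mul.
rewrite big_distrl /=; apply: eq_bigr => i _; rewrite mulr_sumr.
by apply: eq_bigr => j _; rewrite mulrACA.
Qed.

Lemma tensor11 : tensor (1 : AY) 1 = 1 :> AYY.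
Proof.
apply/funext => s; apply/funext => t; rewrite /tensor.
by case: s => [|m s]; [rewrite mul1r|rewrite mul0r].
Qed.

Lemma tensorDl a b f : tensor (a + b) f = tensor a f + tensor b f.
Proof. by apply/funext => s; apply/funext => t; rewrite /tensor !seriesDE mulrDl. Qed.
Lemma tensorDr a b f : tensor f (a + b) = tensor f a + tensor f b.
Proof. by apply/funext => s; apply/funext => t; rewrite /tensor !seriesDE mulrDr. Qed.

Lemma tensor0l f : tensor 0 f = 0.
Proof. by apply/funext => s; apply/funext => t; exact: mul0r. Qed.
Lemma tensor0r f : tensor f 0 = 0.
Proof. by apply/funext => s; apply/funext => t; exact: mulr0. Qed.

Lemma stuffle_varE n s t : (stuffle_var k n) s t =
  \sum_(i < n.+1) (yvar k i) s * (yvar k (n - i)) t.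
Proof.
by rewrite /stuffle_var !series_sumE.
Qed.

Lemma stuffle_word_low w s t : stuffle_word k w s t != 0 -> (wty w <= wty s + wty t)%N.
Proof.
elim: w s t => [|m w IHw] s t; first by rewrite /weight big_nil.
rewrite /stuffle_word big_cons => /mulYY_neq0[s1 [s2 [t1 [t2 [-> -> H /IHw H']]]]].
rewrite weight_cons !weight_cat addnACA leq_add //.
apply: contrapT => mst; case/eqP: H; rewrite stuffle_varE big1 // => i _.
rewrite !yvarE; case: eqP => [Es|]; last by rewrite andbF mul0r.
case: eqP => [Et|]; last by rewrite andbF mulr0.
by case: mst; rewrite Es Et subnKC ?leq_ord.
Qed.

Definition stuffle2 f (p : seq nat * seq nat) : k := stuffle f p.1 p.2.

Lemma stuffle2_cont : cont stuffle2.
Proof.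
move=> [s t]; have low w (p : seq nat * seq nat) :
    stuffle_word k w p.1 p.2 != 0 -> (wty w <= wty p.1 + wty p.2)%N.
  exact: stuffle_word_low.
exact: (clin_cont finite_wtn low (s, t)).
Qed.

Lemma stuffle_fin s t : finitary (fun f : AY => stuffle f s t).
Proof. exact: (stuffle2_cont (s, t)). Qed.

Lemma stuffle_agree f g n : (forall w, (wty w <= n)%N -> f w = g w) ->
  forall s t, (wty s + wty t <= n)%N -> stuffle f s t = stuffle g s t.
Proof.
move=> fg s t stn; apply: eq_fsbigr => w _ /=.
case: (eqVneq (stuffle_word k w s t) 0) => [->|/stuffle_word_low ws].
  by rewrite !mulr0.
by rewrite fg // (leq_trans ws).
Qed.

Lemma stuffle_ext (T T' : AY -> AYY) :
  (forall s t, finitary (fun f => T f s t)) -> (forall s t, finitary (fun f => T' f s t)) ->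
  (forall w, T (mono k w) = T' (mono k w)) -> T =1 T'.
Proof.
move=> cT cT' TT' f; apply/funext => s; apply/funext => t.
have := @cont_ext _ k _ (fun f (p : seq nat * seq nat) => T f p.1 p.2)
  (fun f (p : seq nat * seq nat) => T' f p.1 p.2).
move=> /(_ (fun p : seq nat * seq nat => cT p.1 p.2)
  (fun p : seq nat * seq nat => cT' p.1 p.2)) H.
have {}H := H _ f; rewrite -[LHS]/((fun p : seq nat * seq nat => T f p.1 p.2) (s, t)).
by rewrite H // => w; rewrite TT'.
Qed.

Lemma stuffle_mono w : stuffle (mono k w) = stuffle_word k w.
Proof. by apply/funext => s; apply/funext => t; rewrite /stuffle clin_mono. Qed.

Lemma stuffle_lin c f g : stuffle (c *: f + g) = (fun s => c *: stuffle f s + stuffle g s).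
Proof.
apply/funext => s; apply/funext => t; have [l Hl] := stuffle_fin s t.
rewrite seriesDE seriesZE !Hl mulr_sumr -big_split; apply: eq_bigr => p _ /=.
by rewrite seriesDE seriesZE mulrDr !mulrA (mulrC c).
Qed.

Lemma stuffleZ c f : stuffle (c *: f) = (fun s => c *: stuffle f s).
Proof.
apply/funext => s; apply/funext => t; have [l Hl] := stuffle_fin s t.
rewrite seriesZE !Hl mulr_sumr; apply: eq_bigr => p _ /=.
by rewrite seriesZE mulrCA.
Qed.

Lemma stuffleD f g : stuffle (f + g) = stuffle f + stuffle g.
Proof.
by rewrite -[f in LHS]scale1r stuffle_lin; apply/funext => s; rewrite scale1r.
Qed.

Lemma stuffle0 : stuffle (0 : AY) = 0.
Proof. by apply: (addrI (stuffle 0)); rewrite -stuffleD !addr0. Qed.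

Lemma stuffleN f : stuffle (- f) = - stuffle f.
Proof. by apply: (addrI (stuffle f)); rewrite -stuffleD !subrr stuffle0. Qed.

Lemma stuffle_sum (I : Type) (r : seq I) (P : pred I) (h : I -> AY) :
  stuffle (\sum_(i <- r | P i) h i) = \sum_(i <- r | P i) stuffle (h i).
Proof. exact: (big_morph (@stuffle k) stuffleD stuffle0). Qed.

Lemma stuffle_finMl F s t : finitary (fun f : AY => (F * stuffle f) s t).
Proof.
have [l Hl] : finitary (fun f : AY => \sum_(i < (size s).+1) \sum_(j < (size t).+1)
    F (take i s) (take j t) * stuffle f (drop i s) (drop j t)).
  apply: finitary_sum => i _; apply: finitary_sum => j _.
  by apply: finitaryZ; exact: stuffle_fin.
by exists l => f; rewrite mulYYE Hl.
Qed.

Lemma stuffle_finMr F s t : finitary (fun f : AY => (stuffle f * F) s t).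
Proof.
have [l Hl] : finitary (fun f : AY => \sum_(i < (size s).+1) \sum_(j < (size t).+1)
    F (drop i s) (drop j t) * stuffle f (take i s) (take j t)).
  apply: finitary_sum => i _; apply: finitary_sum => j _.
  by apply: finitaryZ; exact: stuffle_fin.
exists l => f; rewrite mulYYE -Hl; apply: eq_bigr => i _; apply: eq_bigr => j _.
by rewrite mulrC.
Qed.

Lemma stuffleM f g : stuffle (f * g) = stuffle f * stuffle g.
Proof.
move: f; apply: stuffle_ext => [s t|s t|u].
- by apply: (finitary_comp (stuffle_fin s t)); apply: contMr; exact: cont_id.
- exact: stuffle_finMr.
move: g; apply: stuffle_ext => [s t|s t|v].
- by apply: (finitary_comp (stuffle_fin s t)); apply: contMl; exact: cont_id.
- exact: stuffle_finMl.
by rewrite -mono_cat !stuffle_mono /stuffle_word big_cat.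
Qed.

Lemma stuffle1 : stuffle (1 : AY) = 1.
Proof. by rewrite -(mono_nil nat k) stuffle_mono /stuffle_word big_nil. Qed.

Lemma stuffle_yvar n : stuffle (yvar k n) = stuffle_var k n.
Proof.
case: n => [|n] /=; last by rewrite -mono1 stuffle_mono /stuffle_word big_seq1.
by rewrite stuffle1 /stuffle_var big_ord1 tensor11.
Qed.

Lemma stuffle_nil f : stuffle f [::] = f.
Proof.
apply/funext => t; move: f.
have cT : cont (fun f : AY => stuffle f [::] : AY) by move=> t'; exact: stuffle_fin.
move=> f; congr (_ t); move: f t => f _; move: f.
apply: cont_ext => // [|w]; first exact: cont_id.
rewrite stuffle_mono /stuffle_word; elim: w => [|m w IHw].
  by rewrite big_nil mono_nil.
rewrite big_cons mono_cons -IHw [LHS]series_mul_nil.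
suff -> : stuffle_var k m.+1 [::] = var k m by [].
apply/funext => t; rewrite stuffle_varE big_ord_recl subn0 big1 => [|i _].
  by rewrite addr0 /= mul1r.
by rewrite yvarE /weight big_nil lift0 mul0r.
Qed.

(** ** Derivations that are coderivations *)

Definition lift1 (D : AY -> AY) F : AYY := fun s t => D (fun s' => F s' t) s.
Definition lift2 (D : AY -> AY) F : AYY := fun s => D (F s).
Definition swapYY F : AYY := fun s t => F t s.

Lemma swapYYM F G : swapYY (F * G) = swapYY F * swapYY G.
Proof.
apply/funext => s; apply/funext => t; rewrite /swapYY !mulYYE exchange_big.
by apply: eq_bigr.
Qed.

Lemma lift1E D F : lift1 D F = swapYY (lift2 D (swapYY F)). Proof. by []. Qed.

Section Lift.
Variables (D : AY -> AY) (cD : cont D).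

Lemma lift2D F G : lift2 D (F + G) = lift2 D F + lift2 D G.
Proof. by apply/funext => s; rewrite seriesDE /lift2 seriesDE (cont_eqD cD). Qed.

Lemma lift1D F G : lift1 D (F + G) = lift1 D F + lift1 D G.
Proof. by rewrite !lift1E -[swapYY (F + G)]/(swapYY F + swapYY G) lift2D. Qed.

Lemma lift2_0 : lift2 D 0 = 0.
Proof. by apply: (addrI (lift2 D 0)); rewrite -lift2D !addr0. Qed.

Lemma lift1_0 : lift1 D 0 = 0.
Proof. by apply: (addrI (lift1 D 0)); rewrite -lift1D !addr0. Qed.

Lemma lift2_tensor a b : lift2 D (tensor a b) = tensor a (D b).
Proof.
apply/funext => s; rewrite /lift2; have -> : tensor a b s = a s *: b by [].
by rewrite (cont_eqZ cD).
Qed.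

Lemma lift1_tensor a b : lift1 D (tensor a b) = tensor (D a) b.
Proof.
apply/funext => s; apply/funext => t; rewrite /lift1 /tensor.
have -> : (fun s' => a s' * b t) = b t *: a.
  by apply/funext => s'; rewrite seriesZE mulrC.
by rewrite (cont_eqZ cD) seriesZE mulrC.
Qed.

Definition coder F : AYY := lift1 D F + lift2 D F.

Lemma coderD F G : coder (F + G) = coder F + coder G.
Proof. by rewrite /coder lift1D lift2D addrACA. Qed.

Lemma coder0 : coder 0 = 0.
Proof. by rewrite /coder lift1_0 lift2_0 addr0. Qed.

Lemma coder_tensor a b : coder (tensor a b) = tensor (D a) b + tensor a (D b).
Proof. by rewrite /coder lift1_tensor lift2_tensor. Qed.

Lemma coder_stuffle_var n : coder (stuffle_var k n) =
  \sum_(i < n.+1) (tensor (D (yvar k i)) (yvar k (n - i)) +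
                   tensor (yvar k i) (D (yvar k (n - i)))).
Proof.
rewrite /stuffle_var (big_morph coder coderD coder0).
by apply: eq_bigr => i _; rewrite coder_tensor.
Qed.

Lemma coder_fin s t : finitary (fun f => coder (stuffle f) s t).
Proof.
apply: finitaryD.
  have c1 : cont (fun f : AY => (fun s' => stuffle f s' t) : AY) by move=> s'; exact: stuffle_fin.
  exact: (finitary_comp (cD s) c1).
have c2 : cont (fun f : AY => stuffle f s : AY) by move=> t'; exact: stuffle_fin.
exact: (finitary_comp (cD t) c2).
Qed.

Hypothesis DM : forall f g, D (f * g) = D f * g + f * D g.

Lemma lift2M F G : lift2 D (F * G) = lift2 D F * G + F * lift2 D G.
Proof.
apply/funext => s; rewrite /lift2 -[F * G]/(series_mul F G) /series_mul.
rewrite (big_morph D (cont_eqD cD) (cont_eq0 cD)).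
rewrite -[RHS]/(series_mul (lift2 D F) G s + series_mul F (lift2 D G) s) /series_mul.
by rewrite -big_split; apply: eq_bigr => i _; rewrite DM.
Qed.

Lemma coderM F G : coder (F * G) = coder F * G + F * coder G.
Proof.
have E : lift1 D (F * G) = lift1 D F * G + F * lift1 D G.
  rewrite lift1E swapYYM lift2M.
  rewrite -[swapYY (_ + _)]/(swapYY (lift2 D (swapYY F) * swapYY G) +
    swapYY (swapYY F * lift2 D (swapYY G))).
  by rewrite !swapYYM.
by rewrite /coder E lift2M; ncring.
Qed.

Lemma coderivation_ext :
  (forall m, stuffle (D (var k m)) = coder (stuffle_var k m.+1)) ->
  forall f, stuffle (D f) = coder (stuffle f).
Proof.
move=> H; have D1 : D 1 = 0.
  by apply: (addrI (D 1)); rewrite addr0 -[in RHS](mulr1 1) DM mulr1 mul1r.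
apply: stuffle_ext => [s t|s t|w].
- exact: (finitary_comp (stuffle_fin s t) cD).
- exact: coder_fin.
elim: w => [|m w IHw].
  by rewrite mono_nil D1 stuffle0 stuffle1 -tensor11 coder_tensor D1 tensor0l tensor0r addr0.
rewrite mono_cons DM stuffleD !stuffleM IHw H coderM -[var k m]/(yvar k m.+1).
by rewrite stuffle_yvar.
Qed.

End Lift.

Definition primitive f : Prop := stuffle f = tensor 1 f + tensor f 1.

Lemma primitive_lin c f g : primitive f -> primitive g -> primitive (c *: f + g).
Proof.
rewrite /primitive => Hf Hg; rewrite stuffle_lin Hf Hg.
apply/funext => s; apply/funext => t.
rewrite /= !(seriesDE, seriesZE) /tensor !(seriesDE, seriesZE).
by ring.
Qed.

Lemma primitive0 : primitive 0.
Proof.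
by rewrite /primitive stuffle0 tensor0l tensor0r addr0.
Qed.

Lemma primitiveZ c f : primitive f -> primitive (c *: f).
Proof. by move=> Hf; rewrite -[_ *: _]addr0; apply: primitive_lin => //; exact: primitive0. Qed.

Lemma primitiveD f g : primitive f -> primitive g -> primitive (f + g).
Proof. by move=> Hf Hg; rewrite -[f]scale1r; exact: primitive_lin. Qed.

Lemma primitiveN f : primitive f -> primitive (- f).
Proof. by move=> Hf; rewrite -scaleN1r; exact: primitiveZ. Qed.

Lemma primitive_coderivation (D : AY -> AY) f : cont D -> D 1 = 0 ->
  (forall g, stuffle (D g) = coder D (stuffle g)) -> primitive f -> primitive (D f).
Proof.
move=> cD D1 HD Hf; by rewrite /primitive HD Hf coderD // !coder_tensor // D1 tensor0l tensor0r add0r addr0.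
Qed.

Lemma primitive_letter f m : primitive f -> stuffle f [:: m] = f [:: m] *: (1 : AY).
Proof.
move=> ->; rewrite seriesDE; apply/funext => t; rewrite seriesDE seriesZE /tensor.
by rewrite mul0r add0r.
Qed.

(** ** Lowering the indices *)

(** The derivation y_n |-> (n - 1) y_(n-1) is induced by d / d x_0, which deletes
    one of the n - 1 letters x_0 in the word of y_n. It is a coderivation because
    i + (m - i) = m. *)
Definition dY : AY -> AY := derivation (fun m => m%:R *: yvar k m).

Lemma dY_low : low wtn 1 (fun m => m%:R *: yvar k m).
Proof.
move=> m w; rewrite seriesZE yvarE addn1 ltnS.
by case: (eqVneq (wty w) m) => [->//|]; rewrite andbF mulr0 eqxx.
Qed.

Arguments dY_low : clear implicits.

Lemma dY_cont : cont dY. Proof. exact: (derivation_cont finite_wtn dY_low). Qed.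

Lemma dYM f g : dY (f * g) = dY f * g + f * dY g.
Proof. exact: (derivationM finite_wtn dY_low f g). Qed.

Lemma dY1 : dY 1 = 0. Proof. exact: derivation1. Qed.

Lemma dY_yvar n : dY (yvar k n) = n.-1%:R *: yvar k n.-1.
Proof.
case: n => [|n]; first by rewrite dY1 scale0r.
by rewrite [LHS]derivation_var.
Qed.

Lemma dY_coder f : stuffle (dY f) = coder dY (stuffle f).
Proof.
move: f; apply: coderivation_ext => [||m]; [exact: dY_cont|exact: dYM|].
rewrite [dY _]derivation_var coder_stuffle_var; last exact: dY_cont.
rewrite stuffleZ stuffle_yvar; apply/funext => s; apply/funext => t.
rewrite seriesZE stuffle_varE !series_sumE.
have S1 : \sum_(i < m.+2) i.-1%:R * ((yvar k i.-1) s * (yvar k (m.+1 - i)) t) =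
    \sum_(i < m.+1) i%:R * ((yvar k i) s * (yvar k (m - i)) t).
  by rewrite big_ord_recl mul0r add0r.
have S2 : \sum_(i < m.+2) (m.+1 - i).-1%:R * ((yvar k i) s * (yvar k (m.+1 - i).-1) t) =
    \sum_(i < m.+1) (m - i)%:R * ((yvar k i) s * (yvar k (m - i)) t).
  rewrite big_ord_recr /= subnn [0 * _]mul0r addr0.
  by apply: eq_bigr => i _; rewrite /= subSn ?leq_ord.
transitivity (\sum_(i < m.+1) i%:R * ((yvar k i) s * (yvar k (m - i)) t) +
              \sum_(i < m.+1) (m - i)%:R * ((yvar k i) s * (yvar k (m - i)) t)).
  rewrite -big_split mulr_sumr; apply: eq_bigr => i _ /=.
  by rewrite -mulrDl -natrD subnKC ?leq_ord.
rewrite -S1 -S2 -big_split; apply: eq_bigr => i _.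
rewrite !seriesDE /tensor !dY_yvar !seriesZE /=.
by ring.
Qed.

End Stuffle.

(** * From words in x_0, x_1 to words in the y_n *)

Section Comparison.
Variable k : fieldType.
Hypothesis char_k : [pchar k] =i pred0.

Notation A := (series bool k).
Notation x0 := (var k false : A).
Notation x1 := (var k true : A).
Notation AY := (series nat k).
Notation O n := (nseq n false).
Notation wty := (weight (fun m : nat => m.+1)).

Implicit Types (f g a psi : A) (v : seq bool) (s w : seq nat) (m n b c : nat).

Definition xletter m : A := mono k (rcons (O m) true).

Lemma x_word_cons m w : x_word (m :: w) = rcons (O m) true ++ x_word w.
Proof. by []. Qed.

Lemma size_x_word w : size (x_word w) = wty w.
Proof.
elim: w => [|m w IHw]; first by rewrite /weight big_nil.
by rewrite x_word_cons size_cat size_rcons size_nseq IHw weight_cons.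
Qed.

Lemma x_wordP v : exists w b, v = x_word w ++ O b.
Proof.
elim: v => [|l v [w [b ->]]]; first by exists [::], 0%N.
case: l; first by exists (0%N :: w), b.
by case: w => [|m w]; [exists [::], b.+1|exists (m.+1 :: w), b].
Qed.

Lemma xletter0 : xletter 0 = x1. Proof. exact: mono1. Qed.
Lemma xletterS m : xletter m.+1 = x0 * xletter m. Proof. exact: mono_cons. Qed.

Lemma mono_x_word m w b :
  mono k (x_word (m :: w) ++ O b) = xletter m * mono k (x_word w ++ O b).
Proof. by rewrite x_word_cons -catA mono_cat. Qed.

(** As every word is uniquely [x_word w ++ O b], the family of the [piY b f]
    determines [f]; the first one is pi_Y. *)
Definition piY b f : AY := fun w => (-1) ^+ size w * f (x_word w ++ O b).

Lemma piY_cont b : cont (piY b).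
Proof. by move=> w; apply: finitaryZ; exact: finitary_eval. Qed.

Lemma piY0E f : piY 0 f = pi_Y f.
Proof. by apply/funext => w; rewrite /piY /pi_Y cats0. Qed.

Lemma xletter_mulE m f c v :
  (xletter m * f) (rcons (O c) true ++ v) = (c == m)%:R * f v.
Proof.
elim: m c => [|m IHm] [|c]; rewrite ?xletter0 ?xletterS -?mulrA var_mul_cons //=.
- by rewrite mul0r mul0r.
- by rewrite mul0r mul0r.
by rewrite mul1r IHm eqSS.
Qed.

Lemma xletter_mul_nil m f b : (xletter m * f) (O b) = 0.
Proof.
elim: m b => [|m IHm] [|b]; rewrite ?xletter0 ?xletterS -?mulrA ?var_mul_nil //.
  by rewrite var_mul_cons mul0r.
by rewrite var_mul_cons IHm mulr0.
Qed.

Lemma piY_xletter b m f : piY b (xletter m * f) = - (yvar k m.+1 * piY b f).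
Proof.
apply/funext => -[|c w]; rewrite seriesNE ?var_mul_nil ?var_mul_cons /piY.
  by rewrite cat0s xletter_mul_nil mulr0 oppr0.
rewrite x_word_cons -catA xletter_mulE /= exprS mulN1r mulNr.
by congr (- _); rewrite mulrCA.
Qed.

Lemma piY_power b c : piY b (mono k (O c)) = (b == c)%:R *: (1 : AY).
Proof.
apply/funext => -[|m w]; rewrite /piY seriesZE monoE.
  have E : (O b == O c) = (b == c).
    by apply/eqP/eqP => [/(congr1 size)|->//]; rewrite !size_nseq.
  by rewrite cat0s mul1r mulr1 E.
rewrite [(1 : AY) _]/(0 : k) !mulr0; case: eqP => [E|_]; rewrite ?mulr0 //.
have : true \in O c by rewrite -E x_word_cons mem_cat mem_cat mem_rcons inE.
by rewrite mem_nseq andbF.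
Qed.

Lemma piY_ext (T T' : A -> AY) : cont T -> cont T' ->
  (forall m f, T f = T' f -> T (xletter m * f) = T' (xletter m * f)) ->
  (forall c, T (mono k (O c)) = T' (mono k (O c))) -> T =1 T'.
Proof.
move=> cT cT' TX T0; apply: cont_ext => // v.
have [w [b ->]] := x_wordP v; elim: w => [|m w IHw]; first exact: T0.
by rewrite mono_x_word; exact: TX.
Qed.

Lemma der_xletter m f : der 1 0 (xletter m * f) =
  (if m is m'.+1 then m%:R *: (xletter m' * f) else 0) + xletter m * der 1 0 f.
Proof.
elim: m => [|m IHm]; first by rewrite xletter0 derM der_x1 mul0r.
rewrite xletterS -mulrA derM der_x0 IHm mul1r mulrDr -!mulrA addrA; congr (_ + _).
case: m {IHm} => [|m]; first by rewrite mulr0 addr0 scale1r.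
by rewrite mul_scale mulrA -xletterS -{1}[xletter _ * f]scale1r -scalerDl nat1r.
Qed.

Lemma der_power c : der 1 0 (mono k (O c)) = c%:R *: mono k (O c.-1) :> A.
Proof.
elim: c => [|c IHc]; first by rewrite mono_nil der1 scale0r.
rewrite /= mono_cons derM der_x0 mul1r IHc mul_scale.
case: c {IHc} => [|c]; first by rewrite scale0r addr0 scale1r.
by rewrite /= -mono_cons -{1}[mono k _]scale1r -scalerDl nat1r.
Qed.

Lemma piY_der b f : piY b (der 1 0 f) = dY (piY b f) + b.+1%:R *: piY b.+1 f.
Proof.
have cp := @piY_cont; move: f; apply: piY_ext => [||m f IHf|c].
- exact: (cont_comp (cp b) (der_cont _ _)).
- by apply: contD; [exact: (cont_comp (@dY_cont k) (cp b))|apply: contZ; exact: cp].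
- rewrite der_xletter (cont_eqD (cp b)) !piY_xletter IHf.
  rewrite (cont_eqN (@dY_cont k)) dYM dY_yvar /= scale_mul.
  rewrite mulrDr mul_scale scalerN.
  case: m => [|m]; first by rewrite (cont_eq0 (cp b)) scale0r; ncring.
  by rewrite (cont_eqZ (cp b)) piY_xletter scalerN; ncring.
rewrite der_power (cont_eqZ (cp b)) !piY_power (cont_eqZ (@dY_cont k)) dY1 scaler0 add0r.
by case: c => [|c]; rewrite ?scale0r ?scaler0 //= eqSS; case: eqP => [->|]; rewrite ?scale0r ?scaler0.
Qed.

Lemma piY_succ b psi : der 1 0 psi = 0 ->
  piY b.+1 psi = - (b.+1%:R)^-1 *: dY (piY b psi).
Proof.
move=> D0; have := piY_der b psi; rewrite D0 (cont_eq0 (@piY_cont b)) => /esym/eqP.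
rewrite addrC addr_eq0 => /eqP E; rewrite scaleNr -scalerN -E scalerA mulVf ?scale1r //.
exact: char0_neq0.
Qed.

(** ** The coaction in terms of the stuffle product with y_1 *)

(** On Lie series this is [coact], but it has a simpler rule for the
    multiplication with the word of y_n ([ncoact_xletter]): it lowers n by one,
    like the part of the stuffle coproduct of y_n with y_1 in one factor. *)
Definition ncoact f : A := coact f - der 1 0 f.

Lemma ncoact_cont : cont ncoact.
Proof. by rewrite /ncoact /coact; continuity. Qed.

Lemma ncoact_x1 f : ncoact (x1 * f) = x1 * ncoact f + f.
Proof.
rewrite /ncoact /coact mu_varM dL_mul dL_var dR_varM derM der_x1 /= scaler0.
by ncring.
Qed.

Lemma ncoact_x0 f : ncoact (x0 * f) = x0 * ncoact f - (x0 + x1) * dR true f.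
Proof.
rewrite /ncoact /coact mu_varM dL_mul dL_var dR_varM derM der_x0 /=.
by rewrite [X in 1 * X](decompR f); ncring.
Qed.

Lemma ncoact_xletter m f : ncoact (xletter m * f) =
  xletter m * ncoact f + (if m is m'.+1 then - (xletter m' * f) else f).
Proof.
elim: m => [|m IHm]; first by rewrite xletter0 ncoact_x1.
rewrite xletterS -mulrA ncoact_x0 IHm.
case: m {IHm} => [|m]; first by rewrite xletter0 dR_varM /=; ncring.
by rewrite xletterS -!mulrA dR_varM /=; ncring.
Qed.

Lemma ncoact_power c : ncoact (mono k (O c)) = 0.
Proof.
elim: c => [|c IHc].
  by rewrite mono_nil /ncoact /coact mu1 dL1 dR1 der1 !addr0 subr0.
rewrite /= mono_cons ncoact_x0 IHc mulr0.
case: c {IHc} => [|c]; first by rewrite mono_nil dR1 mulr0 subr0.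
by rewrite /= mono_cons dR_varM mulr0 subr0.
Qed.

Definition lower1 (g : AY) : AY := stuffle g [:: 0%N].

Lemma lower1_cont : cont lower1.
Proof. by move=> t; exact: stuffle_fin. Qed.

Lemma lower1_yvar m (g : AY) :
  lower1 (yvar k m.+1 * g) = yvar k m.+1 * lower1 g + yvar k m * g.
Proof.
rewrite /lower1 stuffleM -[LHS]/(series_mul _ _ _) series_mul_cons stuffle_nil.
rewrite series_mul_nil stuffle_nil stuffle_yvar; congr (_ * _ + _ * _).
apply/funext => t; rewrite stuffle_varE big_ord_recl big_ord_recl big1 => [|i _].
  by rewrite !yvarE /weight big_seq1 /= mul0r add0r mul1r addr0 subSS subn0.
by rewrite yvarE /weight big_seq1 mul0r.
Qed.

Lemma lower1_1 : lower1 1 = 0.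
Proof. by rewrite /lower1 stuffle1. Qed.

Lemma piY_ncoact b f : piY b (ncoact f) = - lower1 (piY b f).
Proof.
have cp := @piY_cont b; move: f; apply: piY_ext => [||m f IHf|c].
- exact: (cont_comp cp ncoact_cont).
- by apply: contN; exact: (cont_comp lower1_cont cp).
- rewrite ncoact_xletter (cont_eqD cp) piY_xletter IHf piY_xletter.
  rewrite (cont_eqN lower1_cont) lower1_yvar.
  case: m => [|m]; first by rewrite mul1r; ncring.
  by rewrite (cont_eqN cp) piY_xletter; ncring.
rewrite ncoact_power (cont_eq0 cp) piY_power (cont_eqZ lower1_cont) lower1_1.
by rewrite scaler0 oppr0.
Qed.

(** ** The correction *)

Definition corr_coeff psi n : k :=
  if n is m.+1 then (-1) ^+ n / n%:R * psi (rcons (O m) true) else 0.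

Lemma psi_corrE psi : psi_corr psi = psubst (corr_coeff psi) (yvar k 1).
Proof. by []. Qed.

Lemma y1_nil : (yvar k 1) [::] = 0. Proof. by []. Qed.

Lemma dY_corr psi : dY (psi_corr psi) = 0.
Proof.
rewrite psi_corrE (@psubst_leibniz nat k (yvar k 1) y1_nil (@dY k) (corr_coeff psi) 0); first by ncring.
- exact: dY_cont.
- exact: dYM.
by rewrite dY_yvar scale0r /lie mulr0 mul0r subrr.
Qed.

Definition star b psi : AY := if b is 0 then psi_star psi else piY b psi.

Lemma starE b psi : star b psi = piY b psi + (if b is 0 then psi_corr psi else 0).
Proof. by case: b => [|b]; rewrite ?addr0 //= /psi_star piY0E addrC. Qed.

(** The words followed by one more x_0 arise from d psi / d x_0 = 0, which makes
    [star b.+1 psi] a multiple of the image of [star b psi] under the coderivation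
    [dY]. *)
Lemma star_primitive b psi : der 1 0 psi = 0 -> primitive (psi_star psi) ->
  primitive (star b psi).
Proof.
move=> D0 P; elim: b => [//|b IHb]; rewrite /star piY_succ //.
have -> : dY (piY b psi) = dY (star b psi).
  rewrite starE (cont_eqD (@dY_cont k)).
  by case: b {IHb} => [|b]; rewrite ?dY_corr ?(cont_eq0 (@dY_cont k)) addr0.
apply: primitiveZ; apply: primitive_coderivation => //.
- exact: dY_cont.
- exact: dY1.
- exact: dY_coder.
Qed.

Lemma exp_var (X : choiceType) (x : X) n : (var k x) ^+ n = mono k (nseq n x).
Proof. by elim: n => [|n IHn]; rewrite ?mono_nil //= exprS mono_cons IHn. Qed.

Lemma psubst_var (X : choiceType) (x : X) (r : nat -> k) (v : seq X) :
  psubst r (var k x) v = if v == nseq (size v) x then r (size v) else 0.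
Proof.
have v0 : (var k x : series X k) [::] = 0 by [].
suff E : (fun r : nat -> k => psubst r (var k x)) =1
    (fun (r : nat -> k) (v : seq X) => if v == nseq (size v) x then r (size v) else 0)
  by exact: (congr1 (fun h : seq X -> k => h v) (E r)).
apply: psubst_ext => [|v'|n]; first exact: (psubst_cont v0).
  by case: (v' == _); [exact: finitary_eval|exact: finitary0].
apply/funext => v'; rewrite psubst_dirac exp_var monoE.
case: (eqVneq v' (nseq n x)) => [->|vn]; first by rewrite size_nseq !eqxx.
by case: eqP => // E; case: eqP => // sn; case/eqP: vn; rewrite E sn.
Qed.

Lemma lower1_corr psi : psi [:: true] = 0 -> lower1 (psi_corr psi) =
  psubst (fun n => (-1) ^+ n.+1 * psi (rcons (O n) true)) (yvar k 1).
Proof.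
move=> psi1; rewrite psi_corrE.
have -> : (fun n => (-1) ^+ n.+1 * psi (rcons (O n) true)) =
    (fun n => n.+1%:R * corr_coeff psi n.+1).
  apply/funext => n; rewrite /corr_coeff mulrA; congr (_ * _).
  by rewrite mulrC divfK //; exact: char0_neq0.
move: (corr_coeff psi); apply: (psubst_ext (Z := seq nat)).
- exact: (cont_comp lower1_cont (psubst_cont y1_nil)).
- apply: (cont_comp (psubst_cont y1_nil)) => n; apply: finitaryZ; exact: finitary_eval.
move=> n; rewrite psubst_dirac; have L m : lower1 (yvar k 1 ^+ m) = m%:R *: yvar k 1 ^+ m.-1.
  elim: m => [|m IHm]; first by rewrite expr0 lower1_1 scale0r.
  rewrite exprS lower1_yvar IHm mul_scale mul1r.
  case: m {IHm} => [|m]; first by rewrite scale0r add0r scale1r.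
  by rewrite -exprS -[X in _ + X]scale1r -scalerDl natr1.
rewrite L; case: n => [|n].
  rewrite scale0r; have -> : (fun n => n.+1%:R * (n.+1 == 0%N)%:R) = (fun=> 0) :> (nat -> k).
    by apply/funext => n; rewrite mulr0.
  by rewrite psubst_zero.
have -> : (fun m => m.+1%:R * (m.+1 == n.+1)%:R) =
    (fun m => n.+1%:R * (m == n)%:R + (fun=> 0) m) :> (nat -> k).
  by apply/funext => m; rewrite eqSS addr0; case: eqP => [->|]; rewrite ?mulr0.
by rewrite psubst_lin ?y1_nil // psubst_dirac psubst_zero // addr0.
Qed.

Lemma x_word_true w b : w != [::] -> true \in x_word w ++ O b.
Proof. by case: w => // m w _; rewrite x_word_cons !mem_cat mem_rcons inE. Qed.

Lemma nseq_x_word w : x_word w = nseq (size (x_word w)) true -> w = nseq (size w) 0%N.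
Proof.
elim: w => [//|[|m] w IHw]; last by [].
by rewrite x_word_cons /= => -[/IHw <-].
Qed.

Lemma x_word_nseq n : x_word (nseq n 0%N) = nseq n true.
Proof. by elim: n => // n IHn; rewrite -[LHS]/(true :: x_word (nseq n 0%N)) IHn. Qed.

(** All the [star b psi] being primitive, [lower1] of them is constant, namely their
    coefficient at y_1. Through [piY_ncoact] these values are the coaction
    equation at the words [x_word w ++ O b]; the correction of psi_* accounts for
    the power series in x_1. *)
Lemma dmr0_coaction psi : dmr0 psi -> fr_gt1 psi -> coaction_eq psi.
Proof.
move=> [F [c0 c1 c01] P] /fr_gt1P[_ V1 V0].
have D0 : der 1 0 psi = 0 by exact: (@fr_der1 k false).
apply/coaction_eqP; have -> : coact psi = ncoact psi by rewrite /ncoact D0 subr0.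
apply/funext => v; have [w [b ->]] := x_wordP v.
have E : ncoact psi (x_word w ++ O b) = (-1) ^+ size w * - lower1 (piY b psi) w.
  by rewrite -seriesNE -piY_ncoact /piY mulrA -expr2 sqrr_sign mul1r.
rewrite E /coact_rhs seriesDE seriesNE psubst_opp // !psubst_var.
have N w' b' : w' != [::] -> x_word w' ++ O b' != O (size (x_word w' ++ O b')).
  move=> w0; apply/eqP => Ew; have := x_word_true b' w0.
  by rewrite Ew mem_nseq andbF.
case: b {E} => [|b].
  have -> : piY 0 psi = psi_star psi - psi_corr psi.
    by rewrite piY0E /psi_star addrAC subrr add0r.
  rewrite (cont_eqB lower1_cont) lower1_corr // [lower1 (psi_star _)]primitive_letter //.
  have -> : psi_star psi [:: 0%N] = 0.
    rewrite /psi_star seriesDE psi_corrE psubst_var /corr_coeff /= /pi_Y /x_word /=.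
    by rewrite c1 !mulr0 addr0.
  rewrite scale0r sub0r seriesNE opprK psubst_var cats0.
  case: (eqVneq w [::]) => [->|w0]; first by rewrite /= c1 !mulr0 oppr0 addr0.
  have := N w 0%N w0; rewrite cats0 => /negPf ->; rewrite addr0.
  case: (eqVneq w (nseq (size w) 0%N)) => [Ew|Nw].
    rewrite Ew x_word_nseq !size_nseq eqxx mulrA exprS mulN1r mulrN -expr2 sqrr_sign mulN1r.
    by case: (size w) => [|n] //=; rewrite c1.
  case: eqP => [/nseq_x_word Ew|_]; first by rewrite -Ew eqxx in Nw.
  by rewrite mulr0 oppr0.
have P' := star_primitive b.+1 D0 P.
rewrite [lower1 _](primitive_letter 0%N P').
case: (eqVneq w [::]) => [->|w0].
  rewrite cat0s /= size_nseq eqxx.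
  have e1 : (1 : AY) [::] = 1 by [].
  rewrite oppr0 add0r seriesZE /piY /= e1 mulr1 expr1 mulN1r opprK expr0 mul1r.
  have := fr_rev (rcons (O b.+1) true) F; rewrite rev_rcons rev_nseq => ->.
  by rewrite size_rcons size_nseq exprS mulN1r opprK.
rewrite (negPf (N w b.+1 w0)) addr0 seriesZE.
have -> : (1 : AY) w = 0 by case: w w0 {N}.
rewrite !mulr0 oppr0 mulr0; case: eqP => [Ew|_]; last by rewrite oppr0.
have : false \in x_word w ++ O b.+1 by rewrite mem_cat mem_nseq orbT.
by rewrite Ew mem_nseq andbF.
Qed.

End Comparison.

(** * The Ihara bracket and the stuffle coproduct *)

Section DoubleShuffle.
Variable k : fieldType.
Hypothesis char_k : [pchar k] =i pred0.

Notation A := (series bool k).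
Notation x0 := (var k false : A).
Notation x1 := (var k true : A).
Notation AY := (series nat k).
Notation AYY := (series nat AY).
Notation O n := (nseq n false).
Notation wty := (weight (fun m : nat => m.+1)).

Implicit Types (psi : A) (u v : seq bool) (s t w : seq nat) (i m n p q : nat) (f g : A).

(** ** Coefficients beyond [kappa] *)

Fixpoint trailL m psi : A := if m is m'.+1 then dL false (trailL m' psi) else psi.
Fixpoint trailR m psi : A := if m is m'.+1 then dR false (trailR m' psi) else psi.

Lemma trailLE m psi v : trailL m psi v = psi (v ++ O m).
Proof.
elim: m v => [|m IHm] v /=; first by rewrite cats0.
by rewrite /dL IHm cat_rcons.
Qed.

Lemma trailRE m psi v : trailR m psi v = psi (O m ++ v).
Proof.
elim: m v => [|m IHm] v //.
by rewrite [trailR _ _]/= /dR IHm -cat_rcons -nseqSr.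
Qed.

Lemma der_dL l f : der 1 0 (dL l f) = dL l (der 1 0 f) - dL l (dL false f).
Proof.
rewrite {2}(decompL f) !derD derZ der1 scaler0 !derM der_x0 der_x1 mulr0 add0r addr0 mulr1.
by rewrite !dLD !dL_Mvar; case: l => /=; ncring.
Qed.

Lemma der_dR l f : der 1 0 (dR l f) = dR l (der 1 0 f) - dR l (dR false f).
Proof.
rewrite {2}(decompR f) !derD derZ der1 scaler0 !derM der_x0 der_x1 mul0r add0r mul1r.
by rewrite !dRD !dR_varM; case: l => /=; ncring.
Qed.

Lemma der_trailL m psi : der 1 0 psi = 0 ->
  der 1 0 (trailL m psi) = - m%:R *: trailL m.+1 psi.
Proof.
move=> D0; elim: m => [|m IHm]; first by rewrite D0 oppr0 scale0r.
rewrite [trailL m.+1 psi]/= der_dL IHm dLZ -[in RHS]natr1 opprD scalerDl.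
by rewrite scaleN1r.
Qed.

Lemma der_trailR m psi : der 1 0 psi = 0 ->
  der 1 0 (trailR m psi) = - m%:R *: trailR m.+1 psi.
Proof.
move=> D0; elim: m => [|m IHm]; first by rewrite D0 oppr0 scale0r.
rewrite [trailR m.+1 psi]/= der_dR IHm dRZ -[in RHS]natr1 opprD scalerDl.
by rewrite scaleN1r.
Qed.

(** As d psi / d x_0 = 0, the derivation d / d x_0 maps the family of these
    expressions, indexed by [m], to multiples of its next members; the first one
    is [kappa psi]. *)
Lemma kappa_shift m psi v : der 1 0 psi = 0 -> kappa psi = 0 ->
  psi (v ++ true :: O m) - psi (v ++ O m.+1) - psi (O m ++ true :: v) + psi (O m.+1 ++ v) = 0.
Proof.
move=> D0 K0.
pose K m := dL true (trailL m psi) - trailL m.+1 psi - dR true (trailR m psi) + trailR m.+1 psi.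
have KE n : der 1 0 (K n) = - n.+1%:R *: K n.+1.
  rewrite /K !(derD, derN) der_dL der_dR !der_trailL // !der_trailR //.
  rewrite dLZ dRZ -!natr1 !(scalerBr, scalerDr, opprD, scalerDl, scaleNr, scale1r, scalerN).
  rewrite /=; ncring.
have K00 : K 0 = 0 by rewrite -[RHS]oppr0 -K0 /K /kappa /=; ncring.
have {KE K00} Km : K m = 0.
  elim: (m) => [//|n IHn]; have := KE n; rewrite IHn der0 => /esym/eqP.
  by rewrite scaler_eq0 oppr_eq0 (negPf (char0_neq0 char_k n)) => /eqP.
have := congr1 (fun f : A => f v) Km; rewrite /K !(seriesDE, seriesNE) !trailLE !trailRE.
by rewrite /dL /dR trailLE trailRE cat_rcons.
Qed.

(** ** The reversal of words in the y_n *)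

Definition revY (f : AY) : AY := fun w => (-1) ^+ wty w * f (rev w).

Lemma weight_rev w : wty (rev w) = wty w.
Proof. by rewrite /weight big_rev. Qed.

Definition revYY (F : AYY) : AYY := fun s t => (-1) ^+ (wty s + wty t) * F (rev s) (rev t).

Lemma revYYM F G : revYY (F * G) = revYY G * revYY F.
Proof.
apply/funext => s; apply/funext => t; rewrite /revYY !mulYYE !size_rev mulr_sumr.
rewrite (reindex_inj rev_ord_inj); apply: eq_bigr => -[i Hi] _ /=; rewrite ltnS in Hi.
rewrite mulr_sumr (reindex_inj rev_ord_inj); apply: eq_bigr => -[j Hj] _ /=.
rewrite ltnS in Hj; rewrite !subSS !take_rev !drop_rev !subKn //.
rewrite [RHS]mulrACA -exprD [X in _ = _ * X]mulrC; congr (_ ^+ _ * _).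
by rewrite addnACA -!weight_cat !cat_take_drop.
Qed.

Lemma revYY_stuffle_var n : revYY (stuffle_var k n) = (fun s => (-1) ^+ n *: stuffle_var k n s).
Proof.
apply/funext => s; apply/funext => t; rewrite seriesZE /revYY !stuffle_varE !mulr_sumr.
apply: eq_bigr => i _; rewrite !yvarE !size_rev !weight_rev.
case: eqP => [->|]; last by rewrite andbF !mul0r !mulr0.
case: eqP => [->|]; last by rewrite andbF !mulr0.
by rewrite subnKC // leq_ord.
Qed.

Lemma revY_cont : cont revY.
Proof. by move=> w; apply: finitaryZ; exact: finitary_eval. Qed.

Lemma revY_mono w : revY (mono k w) = (-1) ^+ wty w *: mono k (rev w).
Proof.
apply/funext => t; rewrite /revY seriesZE !monoE.
have -> : (rev t == w) = (t == rev w) by apply/eqP/eqP => [<-|->]; rewrite revK.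
by case: eqP => [->|_]; rewrite ?mulr0 ?weight_rev.
Qed.

Lemma stuffle_revY (f : AY) : stuffle (revY f) = revYY (stuffle f).
Proof.
move: f; apply: stuffle_ext => [s t|s t|w].
- exact: (finitary_comp (stuffle_fin k s t) revY_cont).
- by apply: finitaryZ; exact: stuffle_fin.
rewrite revY_mono stuffleZ !stuffle_mono /stuffle_word; elim: w => [|m w IHw].
  apply/funext => s; apply/funext => t; rewrite seriesZE /revYY (_ : rev [::] = [::] :> seq nat) // !big_nil.
  rewrite {1}/weight big_nil expr0 mul1r.
  case: s => [|c s]; last by rewrite rev_cons; case: (rev s) => *; rewrite mulr0.
  rewrite /weight big_nil; case: t => [|c t]; first by rewrite big_nil mul1r.
  by rewrite rev_cons; case: (rev t) => *; rewrite mulr0.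
rewrite rev_cons -cats1 big_cat big_seq1 big_cons revYYM -IHw revYY_stuffle_var weight_cons.
set F := \prod_(_ <- _) _; set G := stuffle_var k m.+1.
apply/funext => s; apply/funext => t; rewrite /= seriesZE !mulYYE mulr_sumr.
apply: eq_bigr => i _; rewrite mulr_sumr; apply: eq_bigr => j _.
by rewrite !seriesZE exprD; ring.
Qed.

Lemma primitive_revY (f : AY) : primitive f -> primitive (revY f).
Proof.
move=> Hf; rewrite /primitive stuffle_revY Hf.
apply/funext => s; apply/funext => t; rewrite /revYY !seriesDE /tensor /revY mulrDr.
have one (r : seq nat) : (1 : AY) (rev r) = (1 : AY) r /\ (-1) ^+ wty r * (1 : AY) r = (1 : AY) r.
  case: r => [|c r]; first by rewrite /weight big_nil expr0 mul1r.
  by rewrite mulr0; split=> //; rewrite rev_cons; case: (rev r).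
have [-> Es] := one s; have [-> Et] := one t; rewrite exprD.
by rewrite mulrACA Es mulrACA Et.
Qed.

(** ** A coderivation attached to two families of primitive elements *)

Section Family.
Variables a b : nat -> AY.
Hypotheses (prim_a : forall i, primitive (a i)) (prim_b : forall i, primitive (b i)).

Definition cross i p : AY := a i * yvar k p + yvar k p * b i.

(** The derivation below would map y_(-m) to this sum over [p]. *)
Hypothesis cross0 : forall m w N, (wty w < N)%N -> \sum_(p < N) cross (m + p) p w = 0.

Definition cross_letter m : AY := fun w => \sum_(i < (wty w).+1) cross i (m.+1 + i) w.

Lemma cross_low i p w : cross i p w != 0 -> (p <= wty w)%N.
Proof.
rewrite /cross seriesDE => H.
have /orP[] : ((a i * yvar k p) w != 0) || ((yvar k p * b i) w != 0).
- by apply: contraNT H; rewrite negb_or !negbK => /andP[/eqP-> /eqP->]; rewrite addr0.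
- case/mul_neq0 => [s [t [-> _]]]; rewrite yvarE weight_cat.
  by case: (wty t =P p) => [-> _|]; rewrite ?leq_addl // andbF eqxx.
case/mul_neq0 => [s [t [-> H' _]]]; move: H'; rewrite yvarE weight_cat.
by case: (wty s =P p) => [-> _|]; rewrite ?leq_addr // andbF eqxx.
Qed.

Lemma cross_letterE m w N : (wty w < N)%N ->
  cross_letter m w = \sum_(i < N) cross i (m.+1 + i) w.
Proof.
move=> wN; rewrite /cross_letter -!(big_mkord xpredT (fun i => cross i (m.+1 + i) w)).
rewrite [RHS](big_cat_nat (leq0n _) wN) /= [X in _ = _ + X]big_nat_cond [X in _ = _ + X]big1 ?addr0 // => i.
rewrite andbT => /andP[wi _]; apply/eqP; apply: contraTT wi => /cross_low H.
by rewrite -leqNgt (leq_trans _ H) // leq_addl.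
Qed.

Lemma cross_letter_low : low (fun m : nat => m.+1) 0 cross_letter.
Proof.
move=> m w; rewrite addn0 => H; apply: contrapT => mw; case/eqP: H.
apply: big1 => i _; apply/eqP; case: eqP => // /eqP /cross_low wi.
by case: mw; apply: leq_trans wi; rewrite leq_addr.
Qed.
Arguments cross_letter_low : clear implicits.

Definition cross_der : AY -> AY := derivation cross_letter.

Lemma cross_der_cont : cont cross_der.
Proof. exact: (derivation_cont (@finite_wtn) cross_letter_low). Qed.

Lemma cross_derM (f g : AY) : cross_der (f * g) = cross_der f * g + f * cross_der g.
Proof. exact: (derivationM (@finite_wtn) cross_letter_low f g). Qed.

Lemma cross_der1 : cross_der 1 = 0. Proof. exact: derivation1. Qed.

Lemma cross_der_yvar n w :
  cross_der (yvar k n) w = if n is m.+1 then cross_letter m w else 0.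
Proof.
by case: n => [|n]; [rewrite cross_der1|rewrite [cross_der _]derivation_var].
Qed.

Lemma sum_yvar (X : nat -> k) M t : \sum_(q < M) X q * (yvar k q) t =
  if (size t <= 1)%N && (wty t < M)%N then X (wty t) else 0.
Proof.
case: ifP => [/andP[t1 tM]|Ht].
  rewrite (bigD1 (Ordinal tM)) //= big1 => [|q qt]; rewrite yvarE t1.
    by rewrite eqxx mulr1 addr0.
  by case: eqP => [E|_]; rewrite ?mulr0 //; case/eqP: qt; apply: val_inj.
apply: big1 => q _; rewrite yvarE; case: eqP => [E|_]; last by rewrite andbF mulr0.
by move: Ht; rewrite E ltn_ord andbT => ->; rewrite mulr0.
Qed.

Lemma stuffle_cross i M s t : stuffle (cross i M) s t =
  \sum_(q < M.+1) (cross i (M - q) s * (yvar k q) t + (yvar k q) s * cross i (M - q) t).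
Proof.
have tensor_sum F : \sum_(q < M.+1) tensor (yvar k (M - q)) (yvar k q) * F =
    stuffle_var k M * F.
  rewrite -mulr_suml /stuffle_var (reindex_inj rev_ord_inj); congr (_ * _).
  by apply: eq_bigr => q _ /=; rewrite subSS subKn // leq_ord.
rewrite /cross stuffleD !stuffleM stuffle_yvar prim_a prim_b.
have -> : (tensor 1 (a i) + tensor (a i) 1) * stuffle_var k M +
    stuffle_var k M * (tensor 1 (b i) + tensor (b i) 1) =
    \sum_(q < M.+1) (tensor (cross i (M - q)) (yvar k q) + tensor (yvar k q) (cross i (M - q))).
  rewrite big_split /= [X in _ = X + _](_ : _ =
    tensor (a i) 1 * stuffle_var k M + stuffle_var k M * tensor (b i) 1); last first.
    rewrite /stuffle_var mulr_sumr mulr_suml -big_split (reindex_inj rev_ord_inj).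
    by apply: eq_bigr => q _ /=; rewrite subSS subKn ?leq_ord // /cross tensorDl !tensorM mul1r mulr1.
  rewrite [X in _ = _ + X](_ : _ =
    tensor 1 (a i) * stuffle_var k M + stuffle_var k M * tensor 1 (b i)); last first.
    rewrite /stuffle_var mulr_sumr mulr_suml -big_split.
    by apply: eq_bigr => q _ /=; rewrite /cross tensorDr !tensorM mul1r mulr1.
  by ncring.
by rewrite !series_sumE; apply: eq_bigr => q _; rewrite !seriesDE.
Qed.

(** The terms with y_q in the second factor. For q <= m they add up to the value of
    the derivation at y_(m+1-q); for q = m+1 and q > m+1 they are [cross0], for
    the index 0 and for negative indices. *)
Lemma half_cross m s t N : (wty s + wty t < N)%N ->
  \sum_(i < N) \sum_(q < (m.+1 + i).+1) cross i (m.+1 + i - q) s * (yvar k q) t =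
  \sum_(q < m.+2) cross_der (yvar k (m.+1 - q)) s * (yvar k q) t.
Proof.
move=> stN; rewrite (sum_yvar (fun q => cross_der (yvar k (m.+1 - q)) s)).
under eq_bigr => i _ do rewrite (sum_yvar (fun q => cross i (m.+1 + i - q) s)).
case: (leqP (size t) 1) => /= [_|_]; last by rewrite big1.
set q := wty t; case: (ltnP q m.+1) => [qm|mq].
  rewrite ltnS in qm; rewrite !ltnS leqW // subSn // cross_der_yvar (@cross_letterE _ _ N).
    apply: eq_bigr => i _; rewrite addSn ltnS leqW ?(leq_trans qm (leq_addr _ _)) //.
    by rewrite subSn ?(leq_trans qm (leq_addr _ _)) // addSn addnBAC.
  by apply: leq_ltn_trans stN; rewrite leq_addr.
have -> : (if (q < m.+2)%N then cross_der (yvar k (m.+1 - q)) s else 0) = 0.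
  by case: ifP => // _; rewrite (eqP (_ : m.+1 - q == 0)%N) ?cross_der_yvar // subn_eq0.
pose d := (q - m.+1)%N; have Eq : q = (d + m.+1)%N by rewrite subnK.
have dN : (d <= N)%N.
  by apply: ltnW; apply: leq_ltn_trans stN; rewrite -/q Eq addnCA leq_addr.
rewrite -(big_mkord xpredT (fun i => if (q < (m.+1 + i).+1)%N then cross i (m.+1 + i - q) s else 0)).
rewrite (big_cat_nat (leq0n _) dN) /= [X in X + _]big_nat_cond [X in X + _]big1 ?add0r; last first.
  move=> i /andP[/andP[_ id] _]; rewrite ltnS Eq addnC leq_add2l leqNgt id //.
rewrite -{1}[d]add0n big_addn big_mkord -[RHS](@cross0 d s (N - d)); last first.
  by rewrite ltn_subRL addnC (leq_ltn_trans _ stN) // -/q Eq leq_add2l leq_addr.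
apply: eq_bigr => p _; rewrite ltnS Eq [(d + _)%N]addnC leq_add2l leq_addl.
by rewrite subnDl addnK addnC.
Qed.

Lemma cross_coderivation (f : AY) : stuffle (cross_der f) = coder cross_der (stuffle f).
Proof.
move: f; apply: coderivation_ext => [||m].
- exact: cross_der_cont.
- exact: cross_derM.
rewrite [cross_der _]derivation_var coder_stuffle_var; last exact: cross_der_cont.
apply/funext => s; apply/funext => t; pose N := (wty s + wty t).+1.
rewrite (@stuffle_agree k _ (\sum_(i < N) cross i (m.+1 + i)) (wty s + wty t)) //; last first.
  by move=> w wst; rewrite series_sumE -cross_letterE.
rewrite stuffle_sum !series_sumE.
under eq_bigr => i _ do rewrite stuffle_cross big_split.
rewrite big_split /= half_cross //.
under [X in _ + X]eq_bigr => i _ do under eq_bigr => q _ do rewrite mulrC.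
rewrite half_cross; last by rewrite addnC.
rewrite [X in X + _](reindex_inj rev_ord_inj) /= -big_split; apply: eq_bigr => q _ /=.
rewrite subSS subKn ?leq_ord // !seriesDE; congr (_ + _).
by rewrite mulrC.
Qed.

End Family.

End DoubleShuffle.

Section Closure.
Variable k : fieldType.
Hypothesis char_k : [pchar k] =i pred0.

Notation A := (series bool k).
Notation x0 := (var k false : A).
Notation x1 := (var k true : A).
Notation AY := (series nat k).
Notation O n := (nseq n false).
Notation wty := (weight (fun m : nat => m.+1)).

Implicit Types (psi : A) (u v : seq bool) (s t w : seq nat) (i m n p q c e : nat) (f g h : A).

Lemma xletterE m : xletter k m = mono k (O m) * x1.
Proof. by rewrite /xletter -cats1 mono_cat mono1. Qed.

Lemma x_word_rcons w e : x_word (rcons w e) = rcons (x_word w ++ O e) true.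
Proof.
rewrite /x_word map_rcons -cats1 flatten_cat /= cats0 -!cats1 -catA.
by [].
Qed.

Lemma x_word_rev w : rcons (rev (x_word (rev w))) true = true :: x_word w.
Proof.
elim: w => [|c w IHw] //; rewrite rev_cons x_word_rcons rev_rcons rev_cat rev_nseq.
by rewrite rcons_cons rcons_cat IHw x_word_cons cat_rcons.
Qed.

(** The series [f * x1] only has words ending with x_1, which are words in the y_n. *)
Lemma piY_mul f g : piY 0 (f * x1 * g) = piY 0 (f * x1) * piY 0 g.
Proof.
have cp := @piY_cont k 0; move: f; apply: piY_ext => [||m f IHf|c].
- by apply: (cont_comp cp); continuity.
- by apply: contMr; apply: (cont_comp cp); continuity.
- by rewrite -!mulrA !piY_xletter !mulrA IHf; ncring.
have E : piY 0 (xletter k c) = - yvar k c.+1.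
  by rewrite -[xletter k c]mulr1 piY_xletter -mono_nil (piY_power k 0 0) scale1r mulr1.
by rewrite -xletterE piY_xletter E mulNr.
Qed.

Lemma xletter_rmul f w e m : (f * xletter k m) (x_word (rcons w e)) =
  if (m <= e)%N then f (x_word w ++ O (e - m)) else 0.
Proof.
rewrite xletterE mulrA x_word_rcons mul_var_rcons eqxx mulr1.
elim: m e => [|m IHm] e; first by rewrite mono_nil mulr1 subn0.
rewrite nseqSr -cats1 mono_cat mono1 mulrA; case: e => [|e].
  rewrite cats0; case: (lastP w) => [|w1 c]; first by rewrite mul_var_nil.
  by rewrite x_word_rcons mul_var_rcons mulr0.
by rewrite nseqSr -rcons_cat mul_var_rcons eqxx mulr1 IHm.
Qed.

Lemma power_lmul f u c m : head true u -> (mono k (O m) * f) (O c ++ u) =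
  if (m <= c)%N then f (O (c - m) ++ u) else 0.
Proof.
move=> hu; elim: m c => [|m IHm] c; first by rewrite mono_nil mul1r subn0.
rewrite mono_cons -mulrA; case: c => [|c]; last by rewrite var_mul_cons eqxx mul1r IHm.
case: u hu {IHm} => [|[] u] // _; first by rewrite var_mul_nil.
by rewrite var_mul_cons mul0r.
Qed.

Lemma head_rev_x_word w : head true (rev (x_word w)).
Proof. by case: (lastP w) => [|{}w e] //; rewrite x_word_rcons rev_rcons. Qed.

(** ** The derivation of the y_n induced by a double shuffle element *)

Section Element.
Variable psi : A.
Hypotheses (Fpsi : fr_gt1 psi) (coef01 : psi [:: false; true] = 0).
Hypotheses (Cpsi : coaction_eq psi) (Ppsi : primitive (psi_star psi)).

Let F : fr psi. Proof. by case: Fpsi. Qed.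

Let D0 : der 1 0 psi = 0.
Proof. by have /fr_gt1P[_ V1 _] := Fpsi; apply: (@fr_der1 k false) => //; exact: V1. Qed.

Let K0 : kappa psi = 0.
Proof. exact: kappa_eq0. Qed.

(** By the antipode, these are the coefficients of [psi] at words that start with
    x_0^i, up to sign and correction ([famRE]). *)
Definition famR i : AY := (-1) ^+ i *: revY (star i psi).

Lemma famR_primitive i : primitive (famR i).
Proof. by apply: primitiveZ; apply: primitive_revY; exact: star_primitive. Qed.

(** Only the powers y_1^n with n odd occur, as r_psi is even. *)
Lemma revY_corr : revY (psi_corr psi) = - psi_corr psi.
Proof.
apply/funext => w; rewrite seriesNE /revY psi_corrE !psubst_var size_rev.
have -> : (rev w == nseq (size w) 0%N) = (w == nseq (size w) 0%N).
  by apply/eqP/eqP => [/(congr1 rev)|E]; [rewrite revK rev_nseq|rewrite {1}E rev_nseq].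
case: eqP => [->|_]; last by rewrite mulr0 oppr0.
rewrite size_nseq; have -> : wty (nseq (size w) 0%N) = size w.
  by rewrite /weight big_nseq iter_addn_0 mul1n.
rewrite -signr_odd; case: (boolP (odd (size w))) => [_|]; first by rewrite mulN1r.
case: (size w) => [|[|n]] //; rewrite /corr_coeff => podd; first by rewrite mulr0 oppr0.
have -> : psi (rcons (O n.+1) true) = rser psi n.+1 by [].
by rewrite (rser_odd char_k Fpsi Cpsi coef01) ?mulr0 ?oppr0 //= -[~~ _]negbK.
Qed.

Lemma piY_rev i w : (-1) ^+ (i + wty w) * piY i psi (rev w) =
  - (-1) ^+ size w * psi (O i ++ rev (x_word (rev w))).
Proof.
have := fr_rev (x_word (rev w) ++ O i) F.
rewrite rev_cat rev_nseq => ->; rewrite size_cat size_nseq size_x_word weight_rev.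
by rewrite /piY size_rev addnC; ring.
Qed.

Lemma famRE i w : famR i w = - (-1) ^+ size w * psi (O i ++ rev (x_word (rev w)))
  - (if i is 0 then psi_corr psi w else 0).
Proof.
rewrite /famR seriesZE starE -piY_rev /revY seriesDE !mulrDr mulrA -exprD; congr (_ + _).
case: i => [|i]; last by rewrite !mulr0 oppr0.
by rewrite mul1r -[LHS]/(revY (psi_corr psi) w) revY_corr.
Qed.

(** At each word this is an instance of [kappa_shift]: the terms of index 0 give
    the two values at words with one more x_1, and exactly two other terms are
    nonzero, which delete the last or the first letter of the word. *)
Lemma star_cross0 m w N : (wty w < N)%N ->
  \sum_(p < N) cross (fun i => star i psi) famR (m + p) p w = 0.
Proof.
case: N => [//|N]; rewrite ltnS => wN; rewrite big_ord_recl /= addn0.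
rewrite {1}/cross [yvar k 0]/(1 : AY) mulr1 mul1r.
case: (lastP w) wN => [_|{}w e wN].
  rewrite big1 => [|p _]; last by rewrite /cross seriesDE mul_var_nil var_mul_nil addr0.
  rewrite seriesDE famRE starE seriesDE /piY /= cats0 expr0.
  have P0 : psi_corr psi [::] = 0 by rewrite psi_corrE psubst_var.
  case: m => [|m]; rewrite ?P0 !(addr0, subr0) mul1r mulN1r.
    by rewrite subrr.
  by rewrite subrr.
have [c [w' Ew]] : exists c w', rcons w e = c :: w'.
  by case: w {wN} => [|c w]; [exists e, [::]|exists c, (rcons w e)].
have eN : (e < N)%N.
  by apply: leq_trans wN; rewrite -cats1 weight_cat weight_cons addnCA leq_addr.
have cN : (c < N)%N by apply: leq_trans wN; rewrite Ew weight_cons leq_addr.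
have -> : \sum_(i < N) cross (fun i => star i psi) famR (m + lift ord0 i) (lift ord0 i) (rcons w e) =
    star (m + e.+1) psi w + famR (m + c.+1) w'.
  rewrite (eq_bigr (fun i : 'I_N => star (m + i.+1) psi w * (e == i)%:R +
      (c == i)%:R * famR (m + i.+1) w')); last first.
    by move=> i _; rewrite lift0 /cross seriesDE mul_var_rcons {1}Ew var_mul_cons.
  rewrite big_split /=; congr (_ + _).
    rewrite (bigD1 (Ordinal eN)) //= eqxx mulr1 big1 ?addr0 // => i ie.
    by case: eqP => [E|_]; rewrite ?mulr0 //; case/eqP: ie; apply: val_inj.
  rewrite (bigD1 (Ordinal cN)) //= eqxx mul1r big1 ?addr0 // => i ie.
  by case: eqP => [E|_]; rewrite ?mul0r //; case/eqP: ie; apply: val_inj.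
pose V := x_word w ++ O e.
have E1 : rev (x_word (rev (rcons w e))) = true :: V.
  by apply: (@rcons_injl _ true); rewrite x_word_rev x_word_rcons.
have E2 : O c ++ rev (x_word (rev w')) = V.
  apply: (@rcons_injl _ true); rewrite rcons_cat x_word_rev -x_word_rcons Ew x_word_cons.
  by rewrite cat_rcons.
rewrite seriesDE !famRE !starE !seriesDE /piY !addnS E1.
have -> : O (m + e).+1 = O e ++ O m.+1 by rewrite -nseqD addnS addnC.
have -> : O (m + c).+1 = O m.+1 ++ O c by rewrite -nseqD addSn.
rewrite -!catA E2 x_word_rcons cat_rcons catA -/V.
have Es : size w' = size w by have := congr1 size Ew; rewrite size_rcons => -[].
rewrite Es size_rcons exprS mulN1r -[RHS](mulr0 (- (-1) ^+ size w)) -[X in _ = _ * X](kappa_shift char_k m V D0 K0).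
by case: m => [|m]; rewrite ?[(0 : AY) _]series0E; ring.
Qed.

Definition dmr_der : AY -> AY := cross_der (fun i => star i psi) famR.

Lemma dmr_der_primitive (f : AY) : primitive f -> primitive (dmr_der f).
Proof.
apply: primitive_coderivation.
- exact: cross_der_cont.
- exact: cross_der1.
- apply: cross_coderivation => [i|i|]; last exact: star_cross0.
    exact: star_primitive.
  exact: famR_primitive.
Qed.

(** As [lie psi (mono k (O m)) * x1] is the value of ad psi + d_psi at the word of
    y_(m+1), [dmr_der] is induced by ad psi + d_psi up to the bracket with the
    correction. *)
Lemma dmr_der_yvar m : dmr_der (yvar k m.+1) =
  - piY 0 ((psi * mono k (O m) - mono k (O m) * psi) * x1)
  + psi_corr psi * yvar k m.+1 - yvar k m.+1 * psi_corr psi.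
Proof.
apply/funext => w; rewrite /dmr_der cross_der_yvar /cross_letter.
rewrite !(seriesDE, seriesNE).
case: (lastP w) => [|{}w e].
  rewrite /piY /= mul_var_nil var_mul_nil mul_var_nil mulr0 !oppr0 !addr0.
  by apply: big1 => i _; rewrite /cross seriesDE addSn mul_var_nil var_mul_nil addr0.
have [c [w' Ew]] : exists c w', rcons w e = c :: w'.
  by case: w => [|c w]; [exists e, [::]|exists c, (rcons w e)].
have Es : size w' = size w by have := congr1 size Ew; rewrite size_rcons => -[].
set N := (wty (rcons w e)).+1.
have eN : (e < N)%N.
  by apply: leqW; rewrite -cats1 weight_cat weight_cons addnCA leq_addr.
have cN : (c < N)%N by rewrite /N Ew weight_cons ltnS leqW // leq_addr.
have sel (X : nat -> k) d : (d < N)%N ->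
    \sum_(i < N) X i * (d == m + i)%N%:R = if (m <= d)%N then X (d - m)%N else 0.
  move=> dN; case: leqP => [md|dm].
    have dmN : (d - m < N)%N by rewrite (leq_ltn_trans _ dN) // leq_subr.
    rewrite (bigD1 (Ordinal dmN)) //= subnKC // eqxx mulr1 big1 ?addr0 // => i im.
    by case: eqP => [E|_]; rewrite ?mulr0 //; case/eqP: im; apply: val_inj; rewrite /= E addKn.
  apply: big1 => i _; case: eqP => [E|_]; rewrite ?mulr0 //.
  by move: dm; rewrite E ltnNge leq_addr.
have -> : \sum_(i < N) cross (fun i => star i psi) famR i (m.+1 + i) (rcons w e) =
    (if (m <= e)%N then star (e - m) psi w else 0) + (if (m <= c)%N then famR (c - m) w' else 0).
  rewrite -(sel (fun i => star i psi w) e eN) -(sel (fun i => famR i w') c cN) -big_split.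
  apply: eq_bigr => i _; rewrite /cross seriesDE mul_var_rcons {1}Ew var_mul_cons.
  by rewrite [_%:R * _]mulrC.
have -> : piY 0 ((psi * mono k (O m) - mono k (O m) * psi) * x1) (rcons w e) =
    - (-1) ^+ size w * ((if (m <= e)%N then psi (x_word w ++ O (e - m)) else 0)
      - (if (m <= c)%N then psi (O (c - m) ++ rev (x_word (rev w'))) else 0)).
  rewrite piY0E /pi_Y size_rcons exprS mulN1r mulrBl !seriesBE -mulrA -xletterE xletter_rmul.
  congr (_ * (_ - _)); rewrite Ew x_word_cons cat_rcons -x_word_rev -rcons_cat mul_var_rcons.
  by rewrite eqxx mulr1 power_lmul // head_rev_x_word.
rewrite mul_var_rcons {1}Ew var_mul_cons famRE starE seriesDE Es /piY.
have C (X : nat -> k) d (a : k) : (if (m <= d)%N then X (d - m)%N + (if (d - m)%N is 0 then a else 0) else 0) =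
    (if (m <= d)%N then X (d - m)%N else 0) + (d == m)%:R * a.
  case: (ltngtP m d) => [md|dm|->]; rewrite ?subnn ?mul1r ?mul0r ?addr0 //.
  by move: md; rewrite -subn_gt0; case: (d - m)%N => // n _; rewrite addr0.
rewrite [X in X + _ = _](_ : _ = (if (m <= e)%N then (-1) ^+ size w * psi (x_word w ++ O (e - m)) else 0)
    + (e == m)%:R * psi_corr psi w); last first.
  rewrite -(C (fun i => (-1) ^+ size w * psi (x_word w ++ O i)) e); case: ifP => // _.
  by case: (e - m)%N.
rewrite [X in _ + X = _](_ : _ = (if (m <= c)%N then - (-1) ^+ size w * psi (O (c - m) ++ rev (x_word (rev w'))) else 0)
    + (c == m)%:R * - psi_corr psi w'); last first.
  rewrite -(C (fun i => - (-1) ^+ size w * psi (O i ++ rev (x_word (rev w')))) c); case: ifP => // _.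
  by case: (c - m)%N => [//|n]; rewrite subr0 addr0.
by case: (m <= e)%N; case: (m <= c)%N; ring.
Qed.

Lemma der_ihara_power c : der_ihara psi (mono k (O c)) = 0.
Proof.
rewrite /der_ihara; elim: c => [|c IHc]; first by rewrite mono_nil der1.
by rewrite /= mono_cons derM der_x0 IHc mul0r mulr0 addr0.
Qed.

(** The action [f |-> psi f + d_psi f] of [psi] on series, once corrected,
    becomes [dmr_der] up to a right multiplication. *)
Lemma piY_action f : piY 0 (psi * f + der_ihara psi f) + psi_corr psi * piY 0 f =
  dmr_der (piY 0 f) + piY 0 f * psi_star psi.
Proof.
have cp := @piY_cont k 0; have cD := @cross_der_cont k (fun i => star i psi) famR.
move: f; apply: piY_ext => [||m f IHf|c].
- apply: contD; last by apply: contMl; exact: cp.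
  by apply: (cont_comp cp); rewrite /der_ihara; continuity.
- by apply: contD; [exact: (cont_comp cD cp)|apply: contMr; exact: cp].
- have -> : psi * (xletter k m * f) + der_ihara psi (xletter k m * f) =
      (psi * mono k (O m) - mono k (O m) * psi) * x1 * f +
      xletter k m * (psi * f + der_ihara psi f).
    have := der_ihara_power m; rewrite /der_ihara derM xletterE derM der_x1 => ->.
    by ncring.
  rewrite (cont_eqD cp) piY_mul !piY_xletter [in RHS]/dmr_der (cont_eqN cD) cross_derM -/dmr_der.
  have -> : piY 0 (psi * f + der_ihara psi f) =
      dmr_der (piY 0 f) + piY 0 f * psi_star psi - psi_corr psi * piY 0 f.
    by rewrite -IHf addrK.
  by rewrite dmr_der_yvar; ncring.
rewrite der_ihara_power addr0 piY_power; case: c => [|c].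
  by rewrite mono_nil mulr1 scale1r [dmr_der 1]cross_der1 add0r mul1r mulr1 piY0E /psi_star addrC.
rewrite scale0r /dmr_der (cont_eq0 cD) !mul0r mulr0 !addr0.
apply/funext => w; rewrite piY0E /pi_Y nseqSr -cats1 mono_cat mono1 mulrA.
case: (lastP w) => [|{}w e]; first by rewrite mul_var_nil mulr0.
by rewrite x_word_rcons mul_var_rcons !mulr0.
Qed.

Lemma dmr_der_corr (g : A) : dmr_der (psi_corr g) = 0.
Proof.
rewrite psi_corrE (@psubst_leibniz nat k (yvar k 1) (y1_nil k) dmr_der (corr_coeff g) 0).
- by ncring.
- exact: cross_der_cont.
- exact: cross_derM.
rewrite dmr_der_yvar mono_nil mulr1 mul1r subrr mul0r (cont_eq0 (@piY_cont k 0)).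
by rewrite psi_corrE psubst_comm ?y1_nil //; ncring.
Qed.

End Element.

Lemma primitive_lie (f g : AY) : primitive f -> primitive g -> primitive (lie f g).
Proof.
rewrite /primitive => Hf Hg; rewrite /lie stuffleD stuffleN !stuffleM Hf Hg.
have tB (a b : AY) : tensor 1 (a - b) = tensor 1 a - tensor 1 b :> series nat AY.
  by apply/funext => s; apply/funext => t; rewrite !seriesBE /tensor seriesBE mulrBr.
have tB' (a b : AY) : tensor (a - b) 1 = tensor a 1 - tensor b 1 :> series nat AY.
  by apply/funext => s; apply/funext => t; rewrite !seriesBE /tensor seriesBE mulrBl.
rewrite !(mulrDl, mulrDr) !tensorM !mul1r !mulr1 tB tB'.
by ncring.
Qed.

Lemma corr_ihara f g : fr_gt1 f -> fr_gt1 g -> psi_corr (ihara f g) = 0.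
Proof.
move=> /fr_gt1P[_ Vf _] /fr_gt1P[_ Vg _]; have V := vanish_ihara Vf Vg.
rewrite psi_corrE; have -> : corr_coeff (ihara f g) = fun=> 0.
  apply/funext => -[|n] //; rewrite /corr_coeff V ?mulr0 //.
  by rewrite -cats1 count_cat count_nseq.
by rewrite psubst_zero ?y1_nil.
Qed.

(** By [piY_action] psi_* of the bracket is D_g(f_* ) - D_f(g_* ) + [f_*, g_*], where
    D_f and D_g are the coderivations [dmr_der f] and [dmr_der g].
    The corrections are killed by them and commute with each other. *)
Lemma dmr0_ihara f g : (@dmr0 k `&` @Skew k) f -> (@dmr0 k `&` @Skew k) g ->
  dmr0 (ihara f g).
Proof.
move=> [Df [Ff _]] [Dg [Fg _]]; have Cf := dmr0_coaction char_k Df Ff.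
have Cg := dmr0_coaction char_k Dg Fg.
have [_ [_ _ cf] Pf] := Df; have [_ [_ _ cg] Pg] := Dg.
have /fr_gt1P[F V1 V0] := fr_gt1_ihara Ff Fg.
have [/fr_gt1P[_ Vf _] /fr_gt1P[_ Vg _]] := (Ff, Fg).
split=> //.
  by split; [exact: V1|exact: V0|exact: (vanish_ihara Vf Vg)].
rewrite -/(primitive _).
have -> : psi_star (ihara f g) = dmr_der g (psi_star f) - dmr_der f (psi_star g) +
    lie (psi_star f) (psi_star g).
  rewrite /psi_star corr_ihara // add0r -!piY0E.
  have -> : ihara f g = (g * f + der_ihara g f) - (f * g + der_ihara f g).
    by rewrite /ihara; ncring.
  have sP h : psi_star h = psi_corr h + piY 0 h by rewrite piY0E.
  have Ef := piY_action Fg cg Cg f; have Eg := piY_action Ff cf Cf g.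
  rewrite (cont_eqB (@piY_cont k 0)).
  have -> : piY 0 (g * f + der_ihara g f) = dmr_der g (piY 0 f) + piY 0 f * psi_star g
      - psi_corr g * piY 0 f by rewrite -Ef addrK.
  have -> : piY 0 (f * g + der_ihara f g) = dmr_der f (piY 0 g) + piY 0 g * psi_star f
      - psi_corr f * piY 0 g by rewrite -Eg addrK.
  have dD (p h : A) : fr_gt1 p -> p [:: false; true] = 0 -> coaction_eq p ->
      dmr_der p (psi_corr h + piY 0 h) = dmr_der p (piY 0 h).
    move=> Fp cp Cp; rewrite {1}/dmr_der (cont_eqD (@cross_der_cont k _ _)) -/(dmr_der p).
    by rewrite (dmr_der_corr Fp cp Cp) add0r.
  rewrite !dD // !sP.
  have Cc : psi_corr f * psi_corr g = psi_corr g * psi_corr f.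
    rewrite !psi_corrE; move: (corr_coeff f); apply: psubst_ext.
    - by apply: contMr; exact: psubst_cont.
    - by apply: contMl; exact: psubst_cont.
    move=> n; rewrite psubst_dirac; elim: n => [|n IHn]; first by rewrite expr0 mul1r mulr1.
    by rewrite exprS -mulrA IHn mulrA psubst_comm ?y1_nil // -mulrA.
  rewrite -[LHS]addr0 -(subrr (psi_corr f * psi_corr g)) {2}Cc.
  by ncring.
apply: primitiveD; last exact: primitive_lie.
by apply: primitiveD; [|apply: primitiveN]; exact: dmr_der_primitive.
Qed.

Lemma psi_star_lin (c : k) f g : psi_star (c *: f + g) = c *: psi_star f + psi_star g.
Proof.
rewrite /psi_star scalerDr addrACA; congr (_ + _).
  rewrite !psi_corrE -psubst_lin ?y1_nil //; congr psubst; apply/funext => -[|n].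
    by rewrite /= mulr0 addr0.
  by rewrite /corr_coeff seriesDE seriesZE; ring.
apply/funext => w; rewrite seriesDE seriesZE /pi_Y seriesDE seriesZE.
by ring.
Qed.

Lemma dmr0_lin (c : k) f g : dmr0 f -> dmr0 g -> dmr0 (c *: f + g).
Proof.
move=> [Ff [f0 f1 f01] Pf] [Fg [g0 g1 g01] Pg]; split.
- by apply: frD => //; exact: frZ.
- by split; rewrite seriesDE seriesZE ?f0 ?g0 ?f1 ?g1 ?f01 ?g01 mulr0 addr0.
by rewrite psi_star_lin; exact: primitive_lin.
Qed.

Lemma dmr0_0 : dmr0 (0 : A).
Proof.
split=> //; first exact: fr0.
have E : psi_star (0 : A) = 0.
  apply: (addrI (psi_star 0)); rewrite addr0 -[X in X + _]scale1r -psi_star_lin.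
  by rewrite scale1r addr0.
by rewrite E; exact: primitive0.
Qed.

Lemma dmr0_Skew_rc0 f : (@dmr0 k `&` @Skew k) f -> rc0 f.
Proof.
move=> [Df Sf]; have [_ [_ _ c01] _] := Df; split=> //; split=> //.
by apply: dmr0_coaction => //; case: Sf.
Qed.

End Closure.

Theorem theoremD (k : fieldType) (char_k : [pchar k] =i pred0) :
  [/\ injective_lie_map (@dmr0 k `&` @Skew k) (@ihara k) (@rc0 k) (@ihara k)
        (fun psi : series bool k => psi),
      injective_lie_map (@dmr0 k `&` @Skew k `&` @Vep k) (@ihara k)
        (@rc0 k `&` @Vep k) (@ihara k) (fun psi : series bool k => psi) &
      injective_lie_map (@rc0 k `&` @Vep k) (@ihara k) (@krv2 k) (@tder_lie k)
        (@L1 k)].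
Proof.
have dmrS_lin (c : k) f g : (@dmr0 k `&` @Skew k) f -> (@dmr0 k `&` @Skew k) g ->
    (@dmr0 k `&` @Skew k) (c *: f + g).
  by move=> [Df Sf] [Dg Sg]; split; [exact: dmr0_lin|exact: Skew_lin].
have dmrS_ihara (f g : series bool k) : (@dmr0 k `&` @Skew k) f -> (@dmr0 k `&` @Skew k) g ->
    (@dmr0 k `&` @Skew k) (ihara f g).
  move=> Hf Hg; have [_ Sf] := Hf; have [_ Sg] := Hg.
  by split; [exact: dmr0_ihara|exact: Skew_ihara].
have dmrS_0 : (@dmr0 k `&` @Skew k) 0 by split; [exact: dmr0_0|exact: Skew0].
split; last exact: L1_injective_lie_map.
  split=> // [||x]; last exact: dmr0_Skew_rc0.
    by apply: ihara_lie_algebra.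
  by apply: ihara_lie_algebra; [exact: rc0_0|exact: rc0_lin|exact: rc0_ihara].
split=> // [||x [Hx Vx]]; last by split=> //; exact: dmr0_Skew_rc0.
  apply: ihara_lie_algebra => [|c x y [Hx Vx] [Hy Vy]|x y [Hx Vx] [Hy Vy]].
  - by split=> //; exact: Vep0.
  - by split; [exact: dmrS_lin|exact: Vep_lin].
  - by split; [exact: dmrS_ihara|exact: Vep_ihara].
exact: rc0_Vep_lie_algebra.
Qed.
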